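(* Let $s,s_1,s_2\in\mathbb{R}$, $1<p,p_1,p_2<\infty$, $1\le q_1,q_2\le\infty$ and $0<\theta<1$. Put $s_*=(1-\theta)s_1+\theta s_2$, $\frac1{p_*}=\frac{1-\theta}{p_1}+\frac{\theta}{p_2}$, $\frac1{q_*}=\frac{1-\theta}{q_1}+\frac{\theta}{q_2}$. If there is a constant $C>0$ such that $$\|f\|_{B^{s,1}_{p,q_*}}\le C\,\|f\|_{B^{s_1,\infty}_{p_1,q_1}}^{1-\theta}\|f\|_{B^{s_2,\infty}_{p_2,q_2}}^{\theta}\quad\text{for all } f\in B^{s_1,\infty}_{p_1,q_1}\cap B^{s_2,\infty}_{p_2,q_2},$$ then one of the following conditions is satisfied: (i) $s_*=s$, $p_*=p$, $s_1\ne s_2$, $s_2-s_1\ne n/p_2-n/p_1$; (ii) $s_*>s$, $p_*=p$; (iii) $s_*-s=n/p_*-n/p>0$, $s_2-s_1\ne n/p_2-n/p_1$; (iv) $s_*-s>n/p_*-n/p>0$.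
   Context: All spaces are on $\mathbb{R}^n$; $\mathscr{S}$ is the Schwartz class and $\mathscr{S}'$ its dual. Lorentz spaces: for $1\le p<\infty$, $1\le q\le\infty$, $L^{p,q}$ is the space of measurable $f$ on $\mathbb{R}^n$ with finite quasi-norm $\|f\|_{L^{p,q}}=\left(p\int_0^\infty[\alpha\mu_f(\alpha)^{1/p}]^q\frac{d\alpha}{\alpha}\right)^{1/q}$ if $q<\infty$, and $\sup_{\alpha>0}\alpha\mu_f(\alpha)^{1/p}$ if $q=\infty$, where $\mu_f(\alpha)=|\{x:|f(x)|>\alpha\}|$. Inhomogeneous Besov-Lorentz spaces: fix $\{\psi_j\}_{j\ge0}\subset C_c^\infty(\mathbb{R}^n)$ with $\operatorname{supp}\psi_0\subset\{|\xi|\le2\}$, $\operatorname{supp}\psi_j\subset\{2^{j-1}\le|\xi|\le2^{j+1}\}$ for $j\ge1$, $\sup_{j,\xi}2^{j|\alpha|}|D^\alpha\psi_j(\xi)|<\infty$ for every multi-index $\alpha$, and $\sum_{j\ge0}\psi_j=1$ on $\mathbb{R}^n$. Let $\Delta_jf=(\psi_j\hat f)^\vee$ for $f\in\mathscr{S}'$. Then $B^{s,r}_{p,q}$ is the space of $f\in\mathscr{S}'$ with $$\|f\|_{B^{s,r}_{p,q}}=\Big\|\big\{2^{js}\|\Delta_jf\|_{L^{p,q}}\big\}_{j\ge0}\Big\|_{l^r}<\infty .$$ *)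

(* Defs.v *)
From HB Require Import structures.
From mathcomp Require Import all_boot all_order all_algebra.
From mathcomp Require Import all_classical all_reals all_analysis.
From mathcomp Require Import complex.

Set Implicit Arguments.
Unset Strict Implicit.
Unset Printing Implicit Defensive.

Import Order.TTheory GRing.Theory Num.Theory.
Import numFieldNormedType.Exports.

Local Open Scope classical_set_scope.
Local Open Scope ring_scope.
Local Open Scope complex_scope.

Notation normc := complex.ComplexField.Normc.normc.

(* R^n is 'rV[R]_n. Its sigma-algebra is the product one, as for n.-tuple R:
   it is generated by the coordinates. *)
Definition rV_display : measure_display. Proof. exact: default_measure_display. Qed.

Definition rV_coord (R : realType) (n : nat) (i : 'I_n) (v : 'rV[R]_n) :
  measurableTypeR R := v ord0 i.

Section measurable_rV.
Variables (R : realType) (n : nat).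

Let rV_set0 : g_sigma_preimage (@rV_coord R n) set0.
Proof. exact: sigma_algebra0. Qed.

Let rV_setC A :
  g_sigma_preimage (@rV_coord R n) A -> g_sigma_preimage (@rV_coord R n) (~` A).
Proof. exact: sigma_algebraC. Qed.

Let rV_bigcup (F : (set 'rV[R]_n)^nat) :
  (forall i, g_sigma_preimage (@rV_coord R n) (F i)) ->
  g_sigma_preimage (@rV_coord R n) (\bigcup_i (F i)).
Proof. exact: sigma_algebra_bigcup. Qed.

HB.instance Definition _ := @isMeasurable.Build rV_display
  'rV[R]_n (g_sigma_preimage (@rV_coord R n)) rV_set0 rV_setC rV_bigcup.

End measurable_rV.

Definition rV_cons (R : realType) (n : nat) (u : measurableTypeR R * 'rV[R]_n) :
  'rV[R]_n.+1 := row_mx (u.1%:M : 'M[R]_1) u.2.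

(* Lebesgue measure on R^n.+1 is the product of those on R and on R^n. *)
Fixpoint lebesgue_rV (R : realType) (n : nat) : set 'rV[R]_n -> \bar R :=
  match n with
  | 0 => \d_ (0 : 'rV[R]_0)
  | m.+1 =>
      pushforward (@lebesgue_measure R \x^ @lebesgue_rV R m)%E (@rV_cons R m)
  end.
Arguments lebesgue_rV {R n} _.

Section lebesgue_rV_measure.
Variable R : realType.

Lemma measurable_rV_coord n (i : 'I_n) : measurable_fun setT (@rV_coord R n i).
Proof.
move=> _ Y mY; rewrite setTI; apply: sub_sigma_algebra => /=.
rewrite -bigcup_seq/=; exists i => /=; first by rewrite mem_index_enum.
by exists Y => //; rewrite setTI.
Qed.

Lemma measurable_rV_cons n : measurable_fun setT (@rV_cons R n).
Proof.
apply: (@measurability _ _ _ _ _ _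
  (\big[setU/set0]_(i < n.+1)
     preimage_set_system setT (@rV_coord R n.+1 i) measurable)) => //.
move=> _ [A + <-]; rewrite -bigcup_seq => -[/= i _ [B mB <-]].
rewrite !setTI -comp_preimage.
rewrite -[X in measurable X]setTI.
case: (unliftP ord0 i) => [j|] ->.
- rewrite (_ : _ \o _ = @rV_coord R n j \o snd).
    by apply: (measurableT_comp (@measurable_rV_coord n j) measurable_snd).
  apply/funext => u /=; rewrite /rV_coord /rV_cons -rshift1.
  exact: (@row_mxEr _ 1 1 n).
- rewrite (_ : _ \o _ = fst); first by exact: measurable_fst.
  apply/funext => u /=; rewrite /rV_coord /rV_cons.
  rewrite (_ : ord0 = lshift n (ord0 : 'I_1)); last exact/val_inj.
  by rewrite (@row_mxEl _ 1 1 n) mxE eqxx mulr1n.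
Qed.

Lemma lebesgue_rV_is_measure n :
  exists m : {measure set 'rV[R]_n -> \bar R}, m = @lebesgue_rV R n :> (_ -> _).
Proof.
elim: n => [|n [m IH]]; first by exists (\d_ (0 : 'rV[R]_0)).
have mc := @measurable_rV_cons n.
pose m1 : {measure set (measurableTypeR R * 'rV[R]_n)%type -> \bar R} :=
  (@lebesgue_measure R \x^ m)%E.
unshelve eexists.
  refine (measure_function_pushforward__canonical__measure_function_Measure m1 mc).
by rewrite /= -IH.
Qed.

Variable n : nat.

Let lebesgue_rV0 : @lebesgue_rV R n set0 = 0%E.
Proof. by have [m <-] := lebesgue_rV_is_measure n; rewrite measure0. Qed.

Let lebesgue_rV_ge0 A : (0 <= @lebesgue_rV R n A)%E.
Proof. by have [m <-] := lebesgue_rV_is_measure n; exact: measure_ge0. Qed.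

Let lebesgue_rV_sigma_additive : semi_sigma_additive (@lebesgue_rV R n).
Proof.
by have [m <-] := lebesgue_rV_is_measure n; exact: measure_semi_sigma_additive.
Qed.

HB.instance Definition _ := isMeasure.Build _ _ _ (@lebesgue_rV R n)
  lebesgue_rV0 lebesgue_rV_ge0 lebesgue_rV_sigma_additive.

End lebesgue_rV_measure.

Section euclidean.
Variables (R : realType) (n : nat).
Implicit Types x y : 'rV[R]_n.

Definition dotp x y : R := \sum_(i < n) x ord0 i * y ord0 i.

(* The library norm of 'rV[R]_n is the sup norm. *)
Definition enorm x : R := Num.sqrt (dotp x x).

End euclidean.

Section smooth.
Variables (R : realType) (n : nat).
Implicit Types (u : 'rV[R]_n -> R) (f : 'rV[R]_n -> R[i]).

Definition reF f : 'rV[R]_n -> R := fun x => complex.Re (f x).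
Definition imF f : 'rV[R]_n -> R := fun x => complex.Im (f x).

(* A multi-index a is given as the sequence of the directions in which one
   differentiates, so that |a| is size a; on the smooth functions to which this
   is applied, the order of the directions is immaterial. *)
Definition partial_r (a : seq 'I_n) u : 'rV[R]_n -> R :=
  foldr (fun i v => 'D_(delta_mx ord0 i) v) u a.

Definition partial (a : seq 'I_n) f : 'rV[R]_n -> R[i] :=
  fun x => partial_r a (reF f) x +i* partial_r a (imF f) x.

Definition smooth_r u := forall a : seq 'I_n,
  continuous (partial_r a u) /\
  forall (i : 'I_n) x, derivable (partial_r a u) x (delta_mx ord0 i).

Definition smooth f := smooth_r (reF f) /\ smooth_r (imF f).

Definition fsupport f : set 'rV[R]_n := closure [set x | f x != 0].

Definition test_function f := smooth f /\ compact (fsupport f).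

Definition schwartz f := smooth f /\
  forall (k : nat) (a : seq 'I_n), exists M : R, forall x,
    (1 + enorm x) ^+ k * normc (partial a f x) <= M.

(* The balls centred at 0, for N and d > 0, form a basis of neighbourhoods of 0
   for the usual topology of the Schwartz space. *)
Definition schwartz_ball (N : nat) (d : R) f :=
  forall (k : nat) (a : seq 'I_n), (k <= N)%N -> (size a <= N)%N ->
    forall x, (1 + enorm x) ^+ k * normc (partial a f x) < d.

End smooth.

Section fourier.
Variables (R : realType) (n : nat).
Implicit Types f g : 'rV[R]_n -> R[i].

Definition integrableC f :=
  (@lebesgue_rV R n).-integrable setT (EFin \o reF f) /\
  (@lebesgue_rV R n).-integrable setT (EFin \o imF f).

Definition integralC f : R[i] :=
  (\int[@lebesgue_rV R n]_x reF f x) +i* (\int[@lebesgue_rV R n]_x imF f x).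

Definition cis (t : R) : R[i] := cos t +i* sin t.

Definition fourier f : 'rV[R]_n -> R[i] :=
  fun xi => integralC (fun x => cis (- (2 * pi * dotp x xi)) * f x).

Definition fourier_inv f : 'rV[R]_n -> R[i] :=
  fun x => integralC (fun xi => cis (2 * pi * dotp x xi) * f xi).

End fourier.

Section tempered_distributions.
Variables (R : realType) (n : nat).
Local Notation fct := ('rV[R]_n -> R[i]).

(* A tempered distribution is represented by a functional on all functions,
   of which only the values on Schwartz functions are relevant. *)
Definition tempered (T : fct -> R[i]) :=
  (forall (c : R[i]) (f g : fct), schwartz f -> schwartz g ->
     T (fun x => c * f x + g x) = c * T f + T g) /\
  (forall f : fct, schwartz f -> forall e : R, 0 < e ->
     exists (N : nat) (d : R), 0 < d /\
       forall g : fct, schwartz g -> schwartz_ball N d (fun x => g x - f x) ->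
         normc (T g - T f) < e).

Definition dfourier (T : fct -> R[i]) : fct -> R[i] :=
  fun phi => T (fourier phi).

Definition dfourier_inv (T : fct -> R[i]) : fct -> R[i] :=
  fun phi => T (fourier_inv phi).

Definition dmul (psi : fct) (T : fct -> R[i]) : fct -> R[i] :=
  fun phi => T (fun x => psi x * phi x).

Definition represents (g : fct) (T : fct -> R[i]) :=
  [/\ measurable_fun setT (reF g), measurable_fun setT (imF g) &
      forall phi : fct, schwartz phi ->
        integrableC (fun x => g x * phi x) /\
        T phi = integralC (fun x => g x * phi x)].

End tempered_distributions.

Section lorentz.
Variables (R : realType) (n : nat).
Implicit Types (g : 'rV[R]_n -> R[i]) (p : R) (q : \bar R).
Local Open Scope ereal_scope.

Definition distribution_function g (a : R) : \bar R :=
  @lebesgue_rV R n [set x | (a < normc (g x))%R].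

Definition lorentz_norm p q g : \bar R :=
  if q is r%:E then
    (p%:E * \int[lebesgue_measure]_(a in `]0%R, +oo[)
      ((a%:E * distribution_function g a `^ p^-1) `^ r * (a^-1)%:E)) `^ r^-1
  else
    ereal_sup [set a%:E * distribution_function g a `^ p^-1 | a in `]0%R, +oo[].

(* The norm of a distribution that is a function; the representing function is
   unique almost everywhere. It is +oo = ereal_inf set0 if there is none. *)
Definition lorentz_dnorm p q (T : ('rV[R]_n -> R[i]) -> R[i]) : \bar R :=
  ereal_inf [set lorentz_norm p q g | g in [set g | represents g T]].

End lorentz.

Section besov_lorentz.
Variables (R : realType) (n : nat).
Implicit Types (psi : nat -> 'rV[R]_n -> R[i]) (T : ('rV[R]_n -> R[i]) -> R[i]).

Definition dyadic_resolution psi :=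
  [/\ forall j, test_function (psi j),
      fsupport (psi 0%N) `<=` [set xi | enorm xi <= 2],
      forall j, (0 < j)%N -> fsupport (psi j) `<=`
        [set xi | 2 ^+ j.-1 <= enorm xi <= 2 ^+ j.+1],
      forall a : seq 'I_n, exists M : R, forall j xi,
        2 ^+ (j * size a) * normc (partial a (psi j) xi) <= M &
      forall xi, normc (\sum_(j < N) psi j xi - 1) @[N --> \oo] --> (0 : R)].

Definition lp_block psi (j : nat) T := dfourier_inv (dmul (psi j) (dfourier T)).

Definition besov_lorentz_norm psi (s : R) (r : \bar R) (p : R) (q : \bar R) T :
    \bar R :=
  'N[counting]_r[(fun j : nat =>
    (2 `^ (j%:R * s))%:E * lorentz_dnorm p q (lp_block psi j T))]%E.

Definition besov_lorentz psi (s : R) (r : \bar R) (p : R) (q : \bar R) T :=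
  tempered T /\ (besov_lorentz_norm psi s r p q T < +oo)%E.

End besov_lorentz.

(* Main.v *)
Require Import Defs.
From HB Require Import structures.
From mathcomp Require Import all_boot all_order all_algebra.
From mathcomp Require Import all_classical all_reals all_analysis.
From mathcomp Require Import measurable_realfun ess_sup_inf complex.
From mathcomp Require Import ring lra.

(** The inequality is tested on superpositions of wave packets

      f = sum_(i < N) a_i W_i,   W_i(x) = e^(2 pi i x.w_i) prod_l F(lam_i x_l),

    where F(x) is (1 - cos (2 pi x)) / x^2 divided by its integral.  The Fourier
    transform of W_i is the explicit function lam_i^(-n) prod_l
    tri((xi_l - w_(i,l)) / lam_i), tri being the triangle max(0, 1 - |.|); it is
    obtained from the scaling of int (1 - cos (2 pi c t)) / t^2 dt in c, because
    a triangle is a second difference of the absolute value (fourier_sinc2,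
    fourier_packet).  The frequency w_i has length (3/2) 4^i and lam_i is at most
    4^i / (4 n), so that the spectrum of W_i lies in the annulus
    4^i < |xi| < 2 4^i (tent_annulus), which meets only the blocks 2 i and
    2 i + 1, the two cut-offs adding up to 1 there.

    The norm of such a block in L^(p,q) is comparable to a_i lam_i^(-n/p).

    - Upper bound (pulse_dnorm_le).  The kernel of the block is bounded by
      a_i prod_l 1 / max(1, lam_i |x_l|).  This is read off from finite
      differences of the multiplier psi_k prod_l tri(.), with the steps
      1 / (2 x_l) that change the sign of the oscillation
      (fourier_inv_decay); differences apply to the Lipschitz tents as well as
      to the smooth psi_k.  A function bounded by K whose level sets satisfy
      mu(|g| > a) <= (K / a)^r L for some r < p has its norm in L^(p,q) bounded
      by K L^(1/p) (lorentz_norm_le).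

    - Lower bound (pulse_dnorm_ge).  Any function representing the block is
      paired with a test function of the form |psi_0(c x)|^2 e^(-2 pi i x.w_i),
      c proportional to lam_i; the pairing is bounded above by Hoelder's
      inequality in weak L^p (lorentz_dnorm_ge) and below because, on the
      support of the tent, which is non-negative, the inverse Fourier transform
      of the test function has a large real part (pulse_pairing_ge).

    Hence the hypothesis implies (pulse_inequality)

      sum_i a_i 4^(i s) lam_i^(-n/p)
        <= K (sup_i a_i 4^(i s1) lam_i^(-n/p1))^(1 - theta)
             (sup_i a_i 4^(i s2) lam_i^(-n/p2))^theta.

    Take a_i = 4^(i m) and lam_i proportional to 4^(i v) with v <= 1.  Comparing
    the growth in N of both sides gives s - v n/p <= s_star - v n/p_star
    (exponent_inequality); the value v = 1 and the limit v -> -oo yield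
    n/p_star - n/p <= s_star - s and n/p <= n/p_star.  If the three exponents
    s + m - v n/p, s_j + m - v n/p_j vanish together, then the left-hand side is
    proportional to N while the right-hand side is constant, which is absurd
    (exponents_not_zero): v = 1 excludes s_j - n/p_j = s - n/p for j = 1, 2, and
    v = 0 excludes s1 = s2 = s.  The four alternatives are what remains. *)

Set Implicit Arguments.
Unset Strict Implicit.
Unset Printing Implicit Defensive.

Import Order.TTheory GRing.Theory Num.Theory.
Import numFieldNormedType.Exports.

Local Open Scope classical_set_scope.
Local Open Scope ring_scope.
Local Open Scope complex_scope.

Local Notation normc := complex.ComplexField.Normc.normc.

(** * Integration of complex-valued functions *)

Section complex_basics.
Variable R : rcfType.
Implicit Types x y : R[i].

Lemma cReD x y : complex.Re (x + y) = complex.Re x + complex.Re y.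
Proof. by case: x; case: y. Qed.

Lemma cImD x y : complex.Im (x + y) = complex.Im x + complex.Im y.
Proof. by case: x; case: y. Qed.

Lemma cReN x : complex.Re (- x) = - complex.Re x.
Proof. by case: x. Qed.

Lemma cImN x : complex.Im (- x) = - complex.Im x.
Proof. by case: x. Qed.

Lemma cReM x y :
  complex.Re (x * y) = complex.Re x * complex.Re y - complex.Im x * complex.Im y.
Proof. by case: x; case: y. Qed.

Lemma cImM x y :
  complex.Im (x * y) = complex.Re x * complex.Im y + complex.Im x * complex.Re y.
Proof. by case: x; case: y. Qed.

Lemma complex_ext x y : complex.Re x = complex.Re y -> complex.Im x = complex.Im y -> x = y.
Proof. by case: x; case: y => a b c d /= -> ->. Qed.

Lemma normc_ge0 x : 0 <= normc x.
Proof. by case: x => a b; exact: sqrtr_ge0. Qed.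

Lemma normr_Re_le x : `|complex.Re x| <= normc x.
Proof.
case: x => a b /=; rewrite -sqrtr_sqr; apply: ler_wsqrtr; rewrite lerDl; exact: sqr_ge0.
Qed.

Lemma normr_Im_le x : `|complex.Im x| <= normc x.
Proof.
case: x => a b /=; rewrite -sqrtr_sqr; apply: ler_wsqrtr; rewrite lerDr; exact: sqr_ge0.
Qed.

Lemma normc_le_ReIm x : normc x <= `|complex.Re x| + `|complex.Im x|.
Proof.
case: x => a b /=; rewrite -[leRHS]ger0_norm ?addr_ge0// -(sqrtr_sqr (_ + _)); apply: ler_wsqrtr.
rewrite sqrrD !real_normK ?num_real// -addrA lerD2l lerDr.
by rewrite mulrn_wge0// mulr_ge0.
Qed.

Lemma normc_real (a : R) : normc a%:C = `|a|.
Proof. by rewrite /= expr0n/= addr0 sqrtr_sqr. Qed.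

Lemma normcM x y : normc (x * y) = normc x * normc y.
Proof. exact: complex.ComplexField.Normc.normcM. Qed.

Lemma normcN x : normc (- x) = normc x.
Proof. by case: x => a b /=; rewrite !sqrrN. Qed.

Lemma normcD x y : normc (x + y) <= normc x + normc y.
Proof. exact: complex.le_normcD. Qed.

End complex_basics.

Section cis.
Variable R : realType.
Implicit Types s t : R.

Lemma cisD s t : cis (s + t) = cis s * cis t :> R[i].
Proof. by apply: complex_ext; rewrite /= ?cReM ?cImM/= ?cosD// sinD addrC; congr (_ + _); rewrite mulrC. Qed.

Lemma cis0 : cis 0 = 1 :> R[i].
Proof. by rewrite /cis cos0 sin0. Qed.

Lemma normc_cis t : normc (cis t : R[i]) = 1.
Proof. by rewrite /= cos2Dsin2 sqrtr1. Qed.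

End cis.

Section complex_integral.
Context d (T : measurableType d) (R : realType).
Variable mu : {measure set T -> \bar R}.
Implicit Types f g : T -> R[i].

(** The integrals over R^n are studied together with those on the line and on
    product spaces, which occur when they are computed by Fubini's theorem. *)
Definition mfunC f :=
  measurable_fun setT (fun x => complex.Re (f x)) /\
  measurable_fun setT (fun x => complex.Im (f x)).

Definition itgC f :=
  mu.-integrable setT (fun x => (complex.Re (f x))%:E) /\
  mu.-integrable setT (fun x => (complex.Im (f x))%:E).

Definition intC f : R[i] :=
  (\int[mu]_x complex.Re (f x)) +i* (\int[mu]_x complex.Im (f x)).

Lemma mfunC_cst (c : R[i]) : mfunC (fun=> c).
Proof. by split; exact: measurable_cst. Qed.

Lemma mfunC_real (u : T -> R) : measurable_fun setT u -> mfunC (fun x => (u x)%:C).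
Proof. by move=> mu'; split => //=; exact: measurable_cst. Qed.

Lemma mfunCM f g : mfunC f -> mfunC g -> mfunC (fun x => f x * g x).
Proof.
move=> [? ?] [? ?]; split; [under eq_fun do rewrite cReM|under eq_fun do rewrite cImM].
  by apply: measurable_funB; exact: measurable_funM.
by apply: measurable_funD; exact: measurable_funM.
Qed.

Lemma mfunC_prod (I : Type) (r : seq I) (F : I -> T -> R[i]) :
  (forall i, mfunC (F i)) -> mfunC (fun x => \prod_(i <- r) F i x).
Proof.
move=> mF; elim: r => [|i r IH].
  by under [X in mfunC X]eq_fun do rewrite big_nil; exact: mfunC_cst.
by under [X in mfunC X]eq_fun do rewrite big_cons; exact: mfunCM.
Qed.

Lemma mfunC_cis (u : T -> R) : measurable_fun setT u -> mfunC (fun x => cis (u x)).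
Proof.
move=> mu'; split => /=.
  by apply: measurableT_comp => //; apply: continuous_measurable_fun; exact: continuous_cos.
by apply: measurableT_comp => //; apply: continuous_measurable_fun; exact: continuous_sin.
Qed.

Lemma mfunC_normc f : mfunC f -> measurable_fun setT (fun x => normc (f x)).
Proof.
move=> [mr mi].
rewrite (_ : (fun x => _) =
    fun x => (complex.Re (f x) ^+ 2 + complex.Im (f x) ^+ 2) `^ 2^-1); last first.
  apply/funext => x; case: (f x) => a b /=.
  by rewrite powR12_sqrt// addr_ge0// sqr_ge0.
apply: (measurableT_comp (measurable_powR _)).
by apply: measurable_funD; apply: measurable_funX.
Qed.

Lemma itgC_mfunC f : itgC f -> mfunC f.
Proof. by move=> [/measurable_int/measurable_EFinP ? /measurable_int/measurable_EFinP ?]. Qed.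

Lemma le_itgC f (u : T -> R) : mfunC f -> mu.-integrable setT (EFin \o u) ->
  (forall x, normc (f x) <= u x) -> itgC f.
Proof.
move=> [mr mi] iu fu; split.
  apply: le_integrable iu => //=; first exact/measurable_EFinP.
  move=> x _; rewrite lee_fin (le_trans (normr_Re_le _))// (le_trans (fu x))//.
  exact: ler_norm.
apply: le_integrable iu => //=; first exact/measurable_EFinP.
move=> x _; rewrite lee_fin (le_trans (normr_Im_le _))// (le_trans (fu x))//.
exact: ler_norm.
Qed.

Lemma itgC_normc f : itgC f -> mu.-integrable setT (fun x => (normc (f x))%:E).
Proof.
move=> If; have mf := itgC_mfunC If; case: If => ir ii.
have := integrableD measurableT (integrable_norm ir) (integrable_norm ii).
apply: le_integrable => //; first exact/measurable_EFinP/mfunC_normc.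
move=> x _; rewrite /= lee_fin ger0_norm ?normc_ge0// ger0_norm ?addr_ge0//.
exact: normc_le_ReIm.
Qed.

Lemma itgC_lty f : mfunC f -> (\int[mu]_x (normc (f x))%:E < +oo)%E -> itgC f.
Proof.
move=> mf If; apply: (@le_itgC _ (fun x => normc (f x))) => //.
apply/integrableP; split; first exact/measurable_EFinP/mfunC_normc.
by under eq_integral => x _ do rewrite /= ger0_norm ?normc_ge0//.
Qed.

Lemma intC_norm_le f : itgC f ->
  ((normc (intC f))%:E <= 2%:E * \int[mu]_x (normc (f x))%:E)%E.
Proof.
move=> If; have iN := itgC_normc If; have mf := itgC_mfunC If.
case: If => ir ii.
apply: (@le_trans _ _ (`|\int[mu]_x (complex.Re (f x))%:E| +
                       `|\int[mu]_x (complex.Im (f x))%:E|)%E).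
  rewrite /intC -[X in (`|X| + _)%E]fineK; last exact: integrable_fin_num.
  rewrite -[X in (_ + `|X|)%E]fineK; last exact: integrable_fin_num.
  rewrite !abse_EFin -EFinD lee_fin; exact: (le_trans (normc_le_ReIm _)).
rewrite -[2%:E]/((1 + 1)%:E) EFinD ge0_muleDl// !mul1e leeD//.
  apply: (le_trans (le_abse_integral mu measurableT _)); first exact/measurable_EFinP/mf.1.
  apply: ge0_le_integral => //; do ?[exact/measurable_EFinP/mfunC_normc].
  - by apply: measurableT_comp => //; exact/measurable_EFinP/mf.1.
  - by move=> x _; rewrite lee_fin normr_Re_le.
apply: (le_trans (le_abse_integral mu measurableT _)); first exact/measurable_EFinP/mf.2.
apply: ge0_le_integral => //; do ?[exact/measurable_EFinP/mfunC_normc].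
- by apply: measurableT_comp => //; exact/measurable_EFinP/mf.2.
- by move=> x _; rewrite lee_fin normr_Im_le.
Qed.

Lemma itgCD f g : itgC f -> itgC g -> itgC (fun x => f x + g x).
Proof.
move=> [a b] [c e]; split.
  by under eq_fun do rewrite cReD EFinD; exact: integrableD.
by under eq_fun do rewrite cImD EFinD; exact: integrableD.
Qed.

Lemma intCD f g : itgC f -> itgC g -> intC (fun x => f x + g x) = intC f + intC g.
Proof.
move=> [a b] [c e]; apply: complex_ext; rewrite ?cReD ?cImD /=.
  by under eq_Rintegral do rewrite cReD; exact: RintegralD.
by under eq_Rintegral do rewrite cImD; exact: RintegralD.
Qed.

Lemma itgCZ (c : R[i]) f : itgC f -> itgC (fun x => c * f x).
Proof.
move=> [a b]; split.
  under eq_fun do rewrite cReM EFinB !EFinM.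
  by apply: integrableB => //; exact: integrableZl.
under eq_fun do rewrite cImM EFinD !EFinM.
by apply: integrableD => //; exact: integrableZl.
Qed.

Lemma intCZ (c : R[i]) f : itgC f -> intC (fun x => c * f x) = c * intC f.
Proof.
move=> [a b].
have iZ (r : R) (h : T -> R) : mu.-integrable setT (EFin \o h) ->
    mu.-integrable setT (EFin \o (fun x => r * h x)).
  by move=> ih; exact: (integrableZl measurableT r ih).
apply: complex_ext; rewrite ?cReM ?cImM /=.
  under eq_Rintegral do rewrite cReM.
  by rewrite RintegralB ?RintegralZl//; exact: iZ.
under eq_Rintegral do rewrite cImM.
by rewrite RintegralD ?RintegralZl//; exact: iZ.
Qed.

Lemma intCN f : itgC f -> intC (fun x => - f x) = - intC f.
Proof.
by move=> If; rewrite -mulN1r -intCZ//; congr intC; apply/funext => x; rewrite mulN1r.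
Qed.

Lemma itgCN f : itgC f -> itgC (fun x => - f x).
Proof.
by move=> /(itgCZ (-1)); rewrite (_ : (fun x => _) = (fun x => - f x))//;
  apply/funext => x; rewrite mulN1r.
Qed.

Lemma itgC0 : itgC (fun=> 0).
Proof. by split; exact: integrable0. Qed.

Lemma intC0 : intC (fun=> 0) = 0.
Proof. by apply: complex_ext => /=; rewrite /Rintegral integral0. Qed.

Lemma itgC_sum (I : Type) (r : seq I) (F : I -> T -> R[i]) :
  (forall i, itgC (F i)) -> itgC (fun x => \sum_(i <- r) F i x).
Proof.
move=> iF; elim: r => [|i r IH].
  by under [X in itgC X]eq_fun do rewrite big_nil; exact: itgC0.
by under [X in itgC X]eq_fun do rewrite big_cons; exact: itgCD.
Qed.

Lemma intC_sum (I : Type) (r : seq I) (F : I -> T -> R[i]) :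
  (forall i, itgC (F i)) ->
  intC (fun x => \sum_(i <- r) F i x) = \sum_(i <- r) intC (F i).
Proof.
move=> iF; elim: r => [|i r IH].
  by under [X in intC X]eq_fun do rewrite big_nil; rewrite intC0 big_nil.
under [X in intC X]eq_fun do rewrite big_cons.
by rewrite intCD ?IH ?big_cons//; exact: itgC_sum.
Qed.

End complex_integral.

Lemma mfunC_comp d d' (T : measurableType d) (T' : measurableType d') (R : realType)
    (phi : T -> T') (f : T' -> R[i]) :
  measurable_fun setT phi -> mfunC f -> mfunC (fun x => f (phi x)).
Proof.
move=> mphi [mr mi]; split.
  exact: (measurableT_comp mr mphi).
exact: (measurableT_comp mi mphi).
Qed.

Lemma ge0_integral_image d d' (T : measurableType d) (T' : measurableType d')
    (R : realType) (mu : {measure set T -> \bar R}) (nu : {measure set T' -> \bar R})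
    (phi : T -> T') (f : T' -> \bar R) :
  measurable_fun setT phi ->
  (forall A, measurable A -> nu A = mu (phi @^-1` A)) ->
  measurable_fun setT f -> (forall x, 0 <= f x)%E ->
  (\int[nu]_x f x = \int[mu]_x f (phi x))%E.
Proof.
move=> mphi nuE mf f0.
have -> : (\int[nu]_x f x = \int[pushforward mu phi]_x f x)%E.
  by apply: eq_measure_integral => A mA _; exact: nuE.
by rewrite ge0_integral_pushforward.
Qed.

Lemma Rintegral_image d d' (T : measurableType d) (T' : measurableType d')
    (R : realType) (mu : {measure set T -> \bar R}) (nu : {measure set T' -> \bar R})
    (phi : T -> T') (h : T' -> R) :
  measurable_fun setT phi ->
  (forall A, measurable A -> nu A = mu (phi @^-1` A)) ->
  measurable_fun setT h -> mu.-integrable setT (fun x => (h (phi x))%:E) ->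
  nu.-integrable setT (EFin \o h) /\ \int[nu]_x h x = \int[mu]_x h (phi x).
Proof.
move=> mphi nuE mh ih; have mEh : measurable_fun setT (EFin \o h) by exact/measurable_EFinP.
have E (k : T' -> \bar R) : (\int[nu]_x k x = \int[pushforward mu phi]_x k x)%E.
  by apply: eq_measure_integral => A mA _; exact: nuE.
split.
  have /integrableP[_ fi] := integrable_pushforward mphi mEh ih measurableT.
  by apply/integrableP; split => //; rewrite E.
by rewrite /Rintegral E; congr fine; rewrite (integral_pushforward mphi mEh ih).
Qed.

Lemma intC_pushforward d d' (T : measurableType d) (T' : measurableType d')
    (R : realType) (mu : {measure set T -> \bar R}) (nu : {measure set T' -> \bar R})
    (phi : T -> T') (f : T' -> R[i]) :
  measurable_fun setT phi ->
  (forall A, measurable A -> nu A = mu (phi @^-1` A)) ->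
  mfunC f -> itgC mu (f \o phi) -> itgC nu f /\ intC nu f = intC mu (f \o phi).
Proof.
move=> mphi nuE [mr mi] [ir ii].
have [Ir Er] := Rintegral_image mphi nuE mr ir.
have [Ii Ei] := Rintegral_image mphi nuE mi ii.
by split; [split|rewrite /intC Er Ei].
Qed.

Lemma intC_fubini d1 d2 (T1 : measurableType d1) (T2 : measurableType d2)
    (R : realType) (m1 : {sigma_finite_measure set T1 -> \bar R})
    (m2 : {sigma_finite_measure set T2 -> \bar R}) (f : T1 * T2 -> R[i]) :
  itgC (m1 \x m2)%E f ->
  (forall x, itgC m2 (fun y => f (x, y))) ->
  (forall y, itgC m1 (fun x => f (x, y))) ->
  intC m1 (fun x => intC m2 (fun y => f (x, y))) =
  intC m2 (fun y => intC m1 (fun x => f (x, y))).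
Proof.
move=> [ir ii] i1 i2; apply: complex_ext => /=; rewrite /Rintegral; congr fine.
  under eq_integral => x _ do rewrite fineK ?(integrable_fin_num _ (i1 x).1)//.
  under [RHS]eq_integral => x _ do rewrite fineK ?(integrable_fin_num _ (i2 x).1)//.
  exact: (Fubini ir).
under eq_integral => x _ do rewrite fineK ?(integrable_fin_num _ (i1 x).2)//.
under [RHS]eq_integral => x _ do rewrite fineK ?(integrable_fin_num _ (i2 x).2)//.
exact: (Fubini ii).
Qed.

Lemma intC_prod_measure d1 d2 (T1 : measurableType d1) (T2 : measurableType d2)
    (R : realType) (m1 : {sigma_finite_measure set T1 -> \bar R})
    (m2 : {sigma_finite_measure set T2 -> \bar R}) (f : T1 * T2 -> R[i]) :
  itgC (m1 \x m2)%E f ->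
  (forall x, itgC m2 (fun y => f (x, y))) ->
  intC (m1 \x m2)%E f = intC m1 (fun x => intC m2 (fun y => f (x, y))).
Proof.
move=> [ir ii] i1; apply: complex_ext => /=; rewrite /Rintegral; congr fine.
  under [RHS]eq_integral => x _ do rewrite fineK ?(integrable_fin_num _ (i1 x).1)//.
  by rewrite -(integral12_prod_meas1 ir).
under [RHS]eq_integral => x _ do rewrite fineK ?(integrable_fin_num _ (i1 x).2)//.
by rewrite -(integral12_prod_meas1 ii).
Qed.

(** * Lebesgue measure on R^n *)

Section lebesgue_rV_theory.
Variable R : realType.
Local Notation mu1 := (@lebesgue_measure R).

Lemma measurable_coord n (i : 'I_n) :
  measurable_fun setT (fun x : 'rV[R]_n => x ord0 i).
Proof. exact: measurable_rV_coord. Qed.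

Lemma normr_coord_le n (x : 'rV[R]_n) i : `|x ord0 i| <= `|x|.
Proof.
by rewrite [leRHS]/Num.norm /= mx_normrE; apply/bigmax_geP; right => /=; exists (ord0, i).
Qed.

Lemma rV_cons0 n (u : R * 'rV[R]_n) : rV_cons u ord0 ord0 = u.1.
Proof.
rewrite /rV_cons (_ : ord0 = lshift n (ord0 : 'I_1)); last exact/val_inj.
by rewrite (@row_mxEl _ 1 1 n) mxE eqxx mulr1n.
Qed.

Lemma rV_consS n (u : R * 'rV[R]_n) i : rV_cons u ord0 (lift ord0 i) = u.2 ord0 i.
Proof. by rewrite /rV_cons -rshift1; exact: (@row_mxEr _ 1 1 n). Qed.

Lemma measurable_rV_box n (A : 'I_n -> set R) : (forall i, measurable (A i)) ->
  measurable [set x : 'rV[R]_n | forall i, A i (x ord0 i)].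
Proof.
move=> mA; rewrite (_ : [set _ | _] =
    \bigcap_(i in setT) (fun x : 'rV[R]_n => x ord0 i) @^-1` A i).
  apply: fin_bigcap_measurable; first exact: finite_finset.
  by move=> i _; rewrite -[X in measurable X]setTI; exact: measurable_coord.
by apply/seteqP; split => x /= h i; [move=> _; exact: h|exact: (h i)].
Qed.

Lemma lebesgue_rV_box n (A : 'I_n -> set R) : (forall i, measurable (A i)) ->
  @lebesgue_rV R n [set x : 'rV[R]_n | forall i, A i (x ord0 i)] = (\prod_i mu1 (A i))%E.
Proof.
elim: n A => [|n IH] A mA.
  by rewrite big_ord0 /= diracE mem_set//= => -[].
rewrite /= /pushforward (_ : _ @^-1` _ =
    A ord0 `*` [set y : 'rV[R]_n | forall i, A (lift ord0 i) (y ord0 i)]).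
  rewrite (@product_measure2E _ _ _ _ R mu1 (@lebesgue_rV R n))//.
    rewrite big_ord_recl; congr (_ * _)%E.
    exact: (IH (fun i => A (lift ord0 i))).
    exact: mA.
  exact: (measurable_rV_box (fun i => mA (lift ord0 i))).
apply/seteqP; split => -[s y] /= h.
  split; first by move: (h ord0); rewrite rV_cons0.
  by move=> i; move: (h (lift ord0 i)); rewrite rV_consS.
by move=> i; case: (unliftP ord0 i) => [j|] ->; rewrite ?rV_cons0 ?rV_consS;
  [exact: h.2|exact: h.1].
Qed.

Lemma lebesgue_rV_sigma_finite n : sigma_finite setT (@lebesgue_rV R n).
Proof.
exists (fun k => [set x : 'rV[R]_n | forall i : 'I_n, `[- k%:R, k%:R]%classic (x ord0 i)]).
  apply/seteqP; split => // x _ /=; have [k xk] : exists k : nat, `|x| <= k%:R.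
    by exists (Num.bound `|x|); apply/ltW/archi_boundP.
  exists k => // i /=; rewrite in_itv/= -ler_norml.
  exact: (le_trans (normr_coord_le _ _)).
move=> k; split.
  exact: (measurable_rV_box (fun=> measurable_itv _)).
rewrite (lebesgue_rV_box (fun=> measurable_itv _)).
rewrite (_ : (\prod_i _)%E = (\prod_(i < n) (if - k%:R < k%:R :> R then k%:R + k%:R else 0))%:E).
  exact: ltry.
rewrite -prodEFin; apply: eq_bigr => i _; rewrite lebesgue_measure_itv/= lte_fin.
by case: ifP => // _; rewrite -EFinB opprK.
Qed.

HB.instance Definition _ n := Measure_isSigmaFinite.Build _ _ _
  (@lebesgue_rV R n) (lebesgue_rV_sigma_finite n).

Lemma lebesgue_rVS n (A : set 'rV[R]_n.+1) : measurable A ->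
  @lebesgue_rV R n.+1 A = (mu1 \x @lebesgue_rV R n)%E (@rV_cons R n @^-1` A).
Proof.
move=> mA; rewrite /= /pushforward; apply/esym.
apply: (@product_measure_unique _ _ _ _ _ mu1 (@lebesgue_rV R n)
  (mu1 \x^ @lebesgue_rV R n)%E) => //.
  by move=> B C mB mC /=; rewrite product_measure2E.
by rewrite -[X in measurable X]setTI; exact: measurable_rV_cons.
Qed.

Lemma ge0_integral_rVS n (f : 'rV[R]_n.+1 -> \bar R) :
  measurable_fun setT f -> (forall x, 0 <= f x)%E ->
  (\int[@lebesgue_rV R n.+1]_x f x =
   \int[mu1]_s \int[@lebesgue_rV R n]_y f (rV_cons (s, y)))%E.
Proof.
move=> mf f0.
rewrite (ge0_integral_image (@measurable_rV_cons R n) (@lebesgue_rVS n))//.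
have mfc : measurable_fun setT (f \o @rV_cons R n).
  by apply: measurableT_comp => //; exact: measurable_rV_cons.
rewrite (@fubini_tonelli1 _ _ _ _ _ mu1 (@lebesgue_rV R n) _ mfc)//.
by move=> x; exact: f0.
Qed.

Lemma intC_rVS n (f : 'rV[R]_n.+1 -> R[i]) : itgC (@lebesgue_rV R n.+1) f ->
  (forall s, itgC (@lebesgue_rV R n) (fun y => f (rV_cons (s, y)))) ->
  intC (@lebesgue_rV R n.+1) f =
  intC mu1 (fun s => intC (@lebesgue_rV R n) (fun y => f (rV_cons (s, y)))).
Proof.
move=> fi f1; have mf := itgC_mfunC fi.
have mc := @measurable_rV_cons R n.
have mfc : mfunC (f \o @rV_cons R n) := mfunC_comp mc mf.
have ifc : itgC (mu1 \x @lebesgue_rV R n)%E (f \o @rV_cons R n).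
  apply: itgC_lty => //.
  have mN := mfunC_normc mf.
  have /integrableP[_ ] := itgC_normc fi.
  under eq_integral => x _ do rewrite gee0_abs ?lee_fin ?normc_ge0//.
  rewrite (ge0_integral_image (@measurable_rV_cons R n) (@lebesgue_rVS n))//.
    exact/measurable_EFinP.
  by move=> x; rewrite lee_fin normc_ge0.
have [_ ->] := intC_pushforward mc (@lebesgue_rVS n) mf ifc.
by rewrite intC_prod_measure.
Qed.

Lemma integral_rV0 (f : 'rV[R]_0 -> \bar R) :
  (\int[@lebesgue_rV R 0]_x f x)%E = f 0.
Proof.
rewrite (eq_integral (cst (f 0))); last by move=> x _; rewrite (thinmx0 x).
by rewrite integral_cst//= /dirac indicE mem_set// mule1.
Qed.

Lemma ge0_integral_rV_prod n (f : 'I_n -> R -> R) (c : 'I_n -> R) :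
  (forall i, measurable_fun setT (f i)) -> (forall i t, 0 <= f i t) ->
  (forall i, \int[mu1]_t (f i t)%:E = (c i)%:E)%E ->
  (\int[@lebesgue_rV R n]_x (\prod_i f i (x ord0 i))%:E = (\prod_i c i)%:E)%E.
Proof.
elim: n f c => [|n IH] f c mf f0 fc.
  by rewrite integral_rV0 !big_ord0.
rewrite ge0_integral_rVS; last 2 first.
- by apply/measurable_EFinP; apply: measurable_prod => i _; exact: (measurableT_comp (mf i) (@measurable_coord _ i)).
- by move=> x; rewrite lee_fin prodr_ge0.
have c0 i : 0 <= c i by rewrite -lee_fin -fc integral_ge0// => t _; rewrite lee_fin.
have E s (y : 'rV[R]_n) : \prod_i f i (rV_cons (s, y) ord0 i) =
    f ord0 s * \prod_(i < n) f (lift ord0 i) (y ord0 i).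
  rewrite big_ord_recl rV_cons0; congr (_ * _).
  by apply: eq_bigr => i _; rewrite rV_consS.
under eq_integral => s _.
  under eq_integral => y _ do rewrite E EFinM.
  rewrite ge0_integralZl//; last 3 first.
  - by apply/measurable_EFinP; apply: measurable_prod => i _;
      exact: (measurableT_comp (mf (lift ord0 i)) (@measurable_coord _ i)).
  - by move=> y _; rewrite lee_fin prodr_ge0.
  - by rewrite lee_fin.
  rewrite (IH (fun i => f (lift ord0 i)) (fun i => c (lift ord0 i)))//.
  over.
have mE : measurable_fun setT (fun s => (f ord0 s)%:E) by exact/measurable_EFinP.
rewrite ge0_integralZr//; solve [by rewrite fc -EFinM big_ord_recl | exact: mE |
  by move=> x _; rewrite lee_fin | by rewrite lee_fin prodr_ge0].
Qed.

Lemma normc_prod (I : Type) (r : seq I) (F : I -> R[i]) :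
  normc (\prod_(i <- r) F i) = \prod_(i <- r) normc (F i).
Proof.
apply: (big_morph _ (@normcM R)); exact: complex.ComplexField.Normc.normc1.
Qed.

Lemma itgC_rV_prod n (f : 'I_n -> R -> R[i]) : (forall i, itgC mu1 (f i)) ->
  itgC (@lebesgue_rV R n) (fun x => \prod_i f i (x ord0 i)).
Proof.
move=> fi; apply: itgC_lty.
  apply: mfunC_prod => i.
  exact: (mfunC_comp (@measurable_coord n i) (itgC_mfunC (fi i))).
under eq_integral => x _ do rewrite normc_prod.
rewrite (@ge0_integral_rV_prod _ (fun i t => normc (f i t))
  (fun i => fine (\int[mu1]_t (normc (f i t))%:E)%E)) ?ltry//.
- by move=> i; exact: (mfunC_normc (itgC_mfunC (fi i))).
- by move=> i t; exact: normc_ge0.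
- by move=> i; rewrite fineK//; apply: integrable_fin_num => //; exact: itgC_normc.
Qed.

(** The multiplicativity of the integral over a product, which turns the
    Fourier transform of a tensor product into a product of transforms. *)
Lemma intC_rV_prod n (f : 'I_n -> R -> R[i]) : (forall i, itgC mu1 (f i)) ->
  intC (@lebesgue_rV R n) (fun x => \prod_i f i (x ord0 i)) =
  \prod_i intC mu1 (f i).
Proof.
elim: n f => [|n IH] f fi.
  by rewrite big_ord0 /intC /Rintegral !integral_rV0 big_ord0.
have E s : (fun y => \prod_i f i (rV_cons (s, y) ord0 i)) =
    (fun y => f ord0 s * \prod_(i < n) f (lift ord0 i) (y ord0 i)).
  apply/funext => y; rewrite big_ord_recl rV_cons0; congr (_ * _).
  by apply: eq_bigr => i _; rewrite rV_consS.
have iS := itgC_rV_prod (fun i => fi (lift ord0 i)).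
rewrite intC_rVS; [|exact: itgC_rV_prod|by move=> s; rewrite E; exact: itgCZ].
rewrite (_ : (fun s => _) = (fun s => (\prod_(i < n) intC mu1 (f (lift ord0 i))) * f ord0 s)).
  by rewrite intCZ// big_ord_recl mulrC.
by apply/funext => s; rewrite E intCZ// (IH (fun i => f (lift ord0 i)))// mulrC.
Qed.

Lemma lebesgue_measure_shift (a : R) (A : set R) : measurable A ->
  mu1 ((fun s => s + a) @^-1` A) = mu1 A.
Proof.
move=> mA; have ms : measurable_fun setT (fun s : R => s + a : measurableTypeR R).
  by apply: measurable_funD => //; exact: measurable_cst.
rewrite -/(pushforward mu1 (fun s : R => s + a : measurableTypeR R) A).
apply/esym/lebesgue_measure_unique => // _ [[b c]] _ <-; rewrite /= /pushforward.
rewrite (_ : _ @^-1` _ = `]b - a, c - a]%classic); last first.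
  by apply/seteqP; split => s; rewrite /= !in_itv/= ltrBlDr lerBrDr.
by rewrite /= !lebesgue_measure_itv/= !lte_fin ltrD2r -!EFinB; congr (if _ then _%:E else _); ring.
Qed.

Lemma lebesgue_measure_dilation (c : R) (A : set R) : 0 < c -> measurable A ->
  mu1 ((fun s => c * s) @^-1` A) = ((c^-1)%:E * mu1 A)%E.
Proof.
move=> c0 mA; have c0' : 0 <= c by exact: ltW.
have ms : measurable_fun setT (fun s : measurableTypeR R => c * s : measurableTypeR R).
  exact: mulrl_measurable.
pose m := mscale (NngNum c0')
  (measure_function_pushforward__canonical__measure_function_Measure mu1 ms).
have <- : m A = mu1 A.
  apply/esym; apply: lebesgue_measure_unique => //.
  move=> _ [[a b]] _ <-.
  rewrite [RHS](_ : _ = (c%:E * mu1 `](a / c)%R, (b / c)%R]%classic)%E); last first.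
    rewrite /= /mscale /= /pushforward; congr (_ * mu1 _)%E.
    by apply/seteqP; split => s /=; rewrite !in_itv/= ltr_pdivrMr// ler_pdivlMr// ![s * c]mulrC.
  rewrite !lebesgue_measure_itv/= !lte_fin ltr_pM2r ?invr_gt0//.
  case: ifP => _; last by rewrite mule0.
  by rewrite -!EFinB -EFinM -mulrBl mulrCA divff ?mulr1// gt_eqF.
by rewrite /m /mscale/= muleA -EFinM mulVf ?mul1e// gt_eqF.
Qed.

Lemma measurable_rV_shift n (a : 'rV[R]_n) : measurable_fun setT (fun x : 'rV[R]_n => x + a).
Proof.
apply: (@measurability _ _ _ _ _ _
  (\big[setU/set0]_(i < n) preimage_set_system setT (@rV_coord R n i) measurable)) => //.
move=> _ [A + <-]; rewrite -bigcup_seq => -[/= i _ [B mB <-]].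
rewrite !setTI -comp_preimage -[X in measurable X]setTI.
rewrite (_ : _ \o _ = (fun t : R => t + a ord0 i) \o (fun x : 'rV[R]_n => x ord0 i)).
  have mc : measurable_fun setT ((fun t : R => t + a ord0 i) \o (fun x : 'rV[R]_n => x ord0 i)).
    apply: measurableT_comp; last exact: measurable_coord.
    by apply: measurable_funD => //; exact: measurable_cst.
  exact: mc.
by apply/funext => x /=; rewrite /rV_coord mxE.
Qed.

Lemma lebesgue_rV_shift n (a : 'rV[R]_n) (A : set 'rV[R]_n) : measurable A ->
  @lebesgue_rV R n ((fun x : 'rV[R]_n => x + a) @^-1` A) = @lebesgue_rV R n A.
Proof.
elim: n a A => [|n IH] a A mA.
  by congr lebesgue_rV; apply/funext => x /=; rewrite (thinmx0 (x + a)) (thinmx0 x).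
have mc := @measurable_rV_cons R n.
have mcA : measurable (@rV_cons R n @^-1` A) by rewrite -[X in measurable X]setTI; exact: mc.
rewrite /= /pushforward /product_measure2.
pose b : 'rV[R]_n := \row_j a ord0 (lift ord0 j).
pose g y := mu1 (ysection (@rV_cons R n @^-1` A) y).
transitivity (\int[@lebesgue_rV R n]_y g (y + b)%R)%E.
  apply: eq_integral => y _ /=; rewrite /g.
  rewrite -[RHS](lebesgue_measure_shift (a ord0 ord0) (measurable_ysection (y + b) mcA)).
  congr mu1; apply/seteqP; split => s; rewrite /ysection/= !inE/=;
    (rewrite (_ : rV_cons (s, y) + a = rV_cons (s + a ord0 ord0, y + b))//;
    apply/matrixP => i j; rewrite ord1 mxE;
    case: (unliftP ord0 j) => [k|] ->; rewrite ?rV_cons0 ?rV_consS//= !mxE//).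
have mg : measurable_fun setT g by exact: measurable_fun_ysection.
have IHb B : measurable B -> @lebesgue_rV R n B =
  @lebesgue_rV R n ((fun y : 'rV[R]_n => y + b) @^-1` B) by move=> /(IH b).
by apply/esym/(ge0_integral_image (measurable_rV_shift b) IHb mg).
Qed.

Lemma intC_rV_shift n (a : 'rV[R]_n) (f : 'rV[R]_n -> R[i]) :
  itgC (@lebesgue_rV R n) f ->
  itgC (@lebesgue_rV R n) (fun x => f (x + a)) /\
  intC (@lebesgue_rV R n) (fun x => f (x + a)) = intC (@lebesgue_rV R n) f.
Proof.
move=> fi; have mf := itgC_mfunC fi.
have ma := measurable_rV_shift (- a).
have mfa : mfunC (fun x : 'rV[R]_n => f (x + a)) := mfunC_comp (measurable_rV_shift a) mf.
have E : (fun x : 'rV[R]_n => f (x + a)) \o (fun x => x - a) = f.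
  by apply/funext => x /=; rewrite subrK.
have := @intC_pushforward _ _ _ _ R (@lebesgue_rV R n) (@lebesgue_rV R n) _ _ ma
  (fun A mA => esym (lebesgue_rV_shift (- a) mA)) mfa.
by rewrite E; exact.
Qed.

Lemma open_measurable_rV n (A : set 'rV[R]_n) : open A -> measurable A.
Proof.
move=> oA.
pose B (q : 'rV[rat]_n * nat) := [set x : 'rV[R]_n |
  forall i, `|x ord0 i - ratr (q.1 ord0 i)| < q.2.+1%:R^-1].
have -> : A = \bigcup_(q in [set q | B q `<=` A]) B q.
  apply/seteqP; split => x; last by move=> [q /= qA]; exact: qA.
  move=> Ax; have /nbhs_ballP[e /= e0 xe] : nbhs x A by exact: open_nbhs_nbhs.
  pose k := Num.bound (2 / e).
  have ke : 2 / e < k.+1%:R.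
    apply: (lt_trans (archi_boundP _)); first by rewrite divr_ge0// ltW.
    by rewrite ltr_nat.
  have k0 : 0 < (k.+1%:R^-1 : R) by rewrite invr_gt0.
  have h i : exists q : rat, `|x ord0 i - ratr q| < k.+1%:R^-1.
    have xlt : x ord0 i < x ord0 i + k.+1%:R^-1 by rewrite ltrDl.
    have [q] := rat_in_itvoo xlt.
    rewrite in_itv/= => /andP[q1 q2]; exists q.
    by rewrite distrC gtr0_norm ?subr_gt0// ltrBlDl.
  have [q hq] := choice h.
  exists (\row_i q i, k); last by move=> i /=; rewrite mxE.
  move=> y /= Hy; apply: xe; split => // i j; rewrite ord1/= /ball/=.
  have := Hy j; rewrite mxE => yj; have xj := hq j.
  have k2 : k.+1%:R^-1 + k.+1%:R^-1 < e.
    rewrite -mulr2n -[ltLHS]mulr_natl ltr_pdivrMr// mulrC -ltr_pdivrMr//.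
  rewrite (_ : _ - _ = (x ord0 j - ratr (q j)) - (y ord0 j - ratr (q j))); last ring.
  by apply: (le_lt_trans (ler_normB _ _)); apply: lt_trans k2; exact: ltrD.
rewrite bigcup_mkcond; apply: countable_bigcupT_measurable => [|q]; first exact: countableP.
case: ifPn => // _; apply: (@measurable_rV_box n (fun i => [set t | `|t - ratr (q.1 ord0 i)| < q.2.+1%:R^-1])).
move=> i; rewrite (_ : [set _ | _] = ball (ratr (q.1 ord0 i) : R) (q.2.+1%:R^-1 : R)).
  exact: measurable_ball.
by apply/seteqP; split => t; rewrite /ball/= distrC.
Qed.

Lemma continuous_measurable_rV n (u : 'rV[R]_n -> R) : continuous u -> measurable_fun setT u.
Proof.
move=> cu; apply: (measurability _ (RGenOInfty.measurableE R)) => //.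
move=> _ [_ [a ->] <-]; rewrite setTI; apply: open_measurable_rV.
by apply: open_comp => // x _; exact: cu.
Qed.

Lemma measurable_dotp n : measurable_fun setT
  (fun z : 'rV[R]_n * 'rV[R]_n => dotp z.1 z.2).
Proof.
apply: measurable_sum => i; apply: measurable_funM.
  exact: (measurableT_comp (@measurable_coord n i) measurable_fst).
exact: (measurableT_comp (@measurable_coord n i) measurable_snd).
Qed.

End lebesgue_rV_theory.

(** * Dyadic decompositions of integrals *)

Section dyadic_layers.
Variable R : realType.

Lemma powR_lt1 (a x : R) : 1 < a -> x < 0 -> a `^ x < 1.
Proof.
move=> a1 x0; rewrite /powR gt_eqF ?(lt_trans ltr01)//.
by rewrite -expR0 ltr_expR pmulr_llt0// ln_gt0.
Qed.

Lemma dyadic_ex (x : R) : 1 <= x -> exists m, 2 ^+ m <= x < 2 ^+ m.+1.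
Proof.
move=> x1; have ex : exists m, x < 2 ^+ m.+1.
  exists (Num.bound x); apply: (lt_trans (archi_boundP (le_trans ler01 x1))).
  by rewrite -natrX ltr_nat (ltn_trans (ltnSn _))// ltn_expl.
case: (ex_minnP ex) => m xm min; exists m; rewrite xm andbT.
case: m xm min => [|m] _ min; first by rewrite expr0.
by rewrite leNgt; apply/negP => /min; rewrite ltnn.
Qed.

Lemma nneseries_geometric_le (C q : R) (u : nat -> \bar R) :
  0 <= C -> 0 <= q -> q < 1 -> (forall m, 0 <= u m)%E ->
  (forall m, u m <= (C * q ^+ m)%:E)%E ->
  (\sum_(m <oo) u m <= (C / (1 - q))%:E)%E.
Proof.
move=> C0 q0 q1 u0 uC.
apply: lime_le; first exact: is_cvg_nneseries.
near=> N; rewrite /=.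
apply: (@le_trans _ _ (\sum_(0 <= m < N) (C * q ^+ m)%:E)%E).
  by apply: lee_sum => m _; exact: uC.
have /(congr1 (fun f => f N)) := @geometric_seriesE R C q (negbT (lt_eqF q1)).
rewrite /series/= sumEFin => ->; rewrite lee_fin ler_pM2r ?invr_gt0 ?subr_gt0//.
by rewrite ler_piMr// lerBlDr lerDl exprn_ge0.
Unshelve. all: by end_near. Qed.

(** The sets A_m need not be disjoint: f is at most the sum of the c_m 1_(A_m),
    whose integrals form a geometric series. *)
Lemma ge0_integral_dyadic_le d (T : measurableType d) (mu : {measure set T -> \bar R})
    (f : T -> \bar R) (A : nat -> set T) (c : nat -> R) (C q : R) :
  0 <= C -> 0 <= q -> q < 1 -> measurable_fun setT f -> (forall x, 0 <= f x)%E ->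
  (forall m, measurable (A m)) -> (forall m, 0 <= c m) ->
  (forall x, f x != 0%E -> exists m, A m x /\ (f x <= (c m)%:E)%E) ->
  (forall m, (c m)%:E * mu (A m) <= (C * q ^+ m)%:E)%E ->
  (\int[mu]_x f x <= (C / (1 - q))%:E)%E.
Proof.
move=> C0 q0 q1 mf f0 mA c0 fA cA.
pose g m x := (c m * \1_(A m) x)%:E.
have mg m : measurable_fun setT (g m).
  apply/measurable_EFinP; apply: measurable_funM; first exact: measurable_cst.
  exact: measurable_indic.
have g0 m x : (0 <= g m x)%E by rewrite lee_fin mulr_ge0.
apply: (@le_trans _ _ (\int[mu]_x \sum_(m <oo) g m x)%E).
  apply: ge0_le_integral => //; first exact: ge0_emeasurable_sum.
  move=> x _; have [->|/fA[m [Am fm]]] := eqVneq (f x) 0%E.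
    exact: nneseries_ge0.
  apply: (le_trans fm).
  have -> : (c m)%:E = g m x by rewrite /g indicE mem_set// mulr1.
  apply: (@le_trans _ _ (\sum_(0 <= i < m.+1) g i x)%E).
    by rewrite big_nat_recr//= leeDr// sume_ge0.
  exact: nneseries_lim_ge.
rewrite integral_nneseries//; apply: nneseries_geometric_le => // m.
  by apply: integral_ge0 => x _; exact: g0.
rewrite /g; under eq_integral => x _ do rewrite EFinM.
rewrite ge0_integralZl//; solve [exact/measurable_EFinP/measurable_indic |
  by rewrite lee_fin | by rewrite integral_indic// setIT; exact: cA].
Qed.

End dyadic_layers.

Section weight.
Variable R : realType.
Local Notation mu1 := (@lebesgue_measure R).

(** A substitute for (1 + |t|)^(-r) that is at most 1 and whose powers are again
    weights of the same form. *)
Definition wt (r t : R) : R := (Num.max 1 `|t|) `^ (- r).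

Lemma wt_ge0 r t : 0 <= wt r t. Proof. exact: powR_ge0. Qed.

Lemma wt_le1 r t : 0 <= r -> wt r t <= 1.
Proof.
move=> r0; rewrite -(powRr0 (Num.max 1 `|t|)); apply: ler_powR.
  by rewrite le_max lexx.
by rewrite oppr_le0.
Qed.

Lemma measurable_wt r : measurable_fun setT (wt r).
Proof.
apply: (measurableT_comp (measurable_powR _)).
by apply: measurable_maxr => //; exact: measurable_cst.
Qed.

Lemma integral_wt_lty r : 1 < r -> (\int[mu1]_t (wt r t)%:E < +oo)%E.
Proof.
move=> r1.
pose A m := `[(- (2 ^+ m.+1)), (2 ^+ m.+1)]%classic : set R.
pose q : R := 2 `^ (1 - r).
have q1 : q < 1.
  by apply: powR_lt1; rewrite ?ltr1n// subr_lt0.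
apply: (@le_lt_trans _ _ (4 / (1 - q))%:E); last exact: ltry.
apply: (@ge0_integral_dyadic_le R _ _ mu1 _ A (fun m => (2 ^+ m) `^ (- r)) 4 q) => //.
- exact: powR_ge0.
- by apply/measurable_EFinP; exact: measurable_wt.
- by move=> t; rewrite lee_fin wt_ge0.
- by move=> m; exact: measurable_itv.
- move=> t _; have [|m /andP[m1 m2]] := @dyadic_ex R (Num.max 1 `|t|).
    by rewrite le_max lexx.
  exists m; split.
    rewrite /A/= in_itv/= -ler_norml; apply: le_trans (ltW m2).
    by rewrite le_max lexx orbT.
  have M0 : 0 < Num.max 1 `|t| by rewrite lt_max ltr01.
  rewrite lee_fin /wt !powRN lef_pV2 ?posrE ?powR_gt0 ?exprn_gt0//.
  apply: ge0_ler_powR => //; first by rewrite (le_trans _ (ltW r1)).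
    by rewrite nnegrE exprn_ge0.
  by rewrite nnegrE le_max ler01.
move=> m; rewrite /A /= lebesgue_measure_itv/= lte_fin.
have p0 : (0 : R) < 2 ^+ m.+1 by rewrite exprn_gt0.
rewrite ifT; last by rewrite -subr_gt0 opprK addr_gt0.
rewrite -EFinB -EFinM lee_fin opprK.
have -> : (2 ^+ m) `^ (- r) = 2 `^ (m%:R * - r) :> R by rewrite powRrM powR_mulrn.
have -> : q ^+ m = 2 `^ (m%:R * - r) * 2 ^+ m.
  rewrite -powR_mulrn ?powR_ge0// -powRrM -[2 ^+ m]powR_mulrn// -powRD; last first.
    by rewrite pnatr_eq0 implybT.
  by congr (_ `^ _); ring.
by rewrite exprS le_eqVlt; apply/orP; left; apply/eqP; ring.
Qed.


Lemma ge0_integral_dilation (f : R -> \bar R) c : 0 < c -> measurable_fun setT f ->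
  (forall t, 0 <= f t)%E ->
  (\int[mu1]_t f (c * t)%R = (c^-1)%:E * \int[mu1]_t f t)%E.
Proof.
move=> c0 mf f0; have c0' : 0 <= c^-1 by rewrite invr_ge0 ltW.
have mc : measurable_fun setT (fun s : measurableTypeR R => c * s : measurableTypeR R).
  exact: mulrl_measurable.
rewrite -[c^-1]/((NngNum c0')%:num) -ge0_integral_mscale//.
apply/esym/ge0_integral_image => // A mA.
exact/esym/lebesgue_measure_dilation.
Qed.

Definition wt_mass (r : R) : R := fine (\int[mu1]_t (wt r t)%:E)%E.

Lemma integral_wt_dilation r c : 1 < r -> 0 < c ->
  (\int[mu1]_t (wt r (c * t))%:E = (c^-1 * wt_mass r)%:E)%E.
Proof.
move=> r1 c0.
rewrite (ge0_integral_dilation (f := fun t => (wt r t)%:E))//.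
- rewrite EFinM /wt_mass fineK// ge0_fin_numE ?integral_wt_lty//.
  by apply: integral_ge0 => t _; rewrite lee_fin wt_ge0.
- by apply/measurable_EFinP; exact: measurable_wt.
- by move=> t; rewrite lee_fin wt_ge0.
Qed.

Lemma wt_mass_ge0 r : 0 <= wt_mass r.
Proof.
by rewrite fine_ge0// integral_ge0// => t _; rewrite lee_fin wt_ge0.
Qed.

End weight.

(** * Fourier transform of the squared cardinal sine *)

Section sinc2.
Variable R : realType.
Local Notation mu1 := (@lebesgue_measure R).

Lemma normr_sin_le (x : R) : `|sin x| <= `|x|.
Proof.
have H (y : R) : 0 <= y -> `|sin y| <= y.
  move=> y0.
  have [c _] := @MVT_segment R sin cos 0 y y0 (fun x _ => is_derive_sin x)
    (continuous_subspaceT (@continuous_sin R)).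
  rewrite sin0 !subr0 => ->; rewrite normrM (ger0_norm y0) ler_piMl//.
  exact: cos_max.
have [x0|x0] := leP 0 x; first by rewrite (ger0_norm x0) H.
by rewrite -normrN -sinN (ltr0_norm x0) H// oppr_ge0 ltW.
Qed.

(** The function t -> (1 - cos (2 pi c t)) / t^2 is 2 (sin (pi c t) / t)^2; in
    this form products with cos (2 pi zeta t) are linearised by the addition
    formulas. *)
Definition dcos (c t : R) : R := (1 - cos (2 * pi * (c * t))) / t ^+ 2.

Lemma dcos_ge0 c t : 0 <= dcos c t.
Proof. by rewrite divr_ge0 ?sqr_ge0// subr_ge0 cos_le1. Qed.

Lemma dcosN c t : dcos (- c) t = dcos c t.
Proof. by rewrite /dcos mulNr mulrN cosN. Qed.

Lemma dcos_dilation c t : dcos c t = c ^+ 2 * dcos 1 (c * t).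
Proof.
rewrite /dcos mul1r; have [->|c0] := eqVneq c 0.
  by rewrite !mul0r mulr0 cos0 subrr mul0r expr0n/= mul0r.
have [->|t0] := eqVneq t 0; first by rewrite mulr0 expr0n/= invr0 !mulr0.
by field; rewrite t0.
Qed.

Lemma measurable_dcos c : measurable_fun setT (dcos c).
Proof.
apply: measurable_funM.
  apply: measurable_funB; first exact: measurable_cst.
  apply: (measurableT_comp (continuous_measurable_fun (@continuous_cos R))).
  by do 2 apply: measurable_funM => //; exact: measurable_cst.
rewrite (_ : (fun t => _) = (fun t : R => (t ^+ 2) `^ (- 1))).
  by apply: (measurableT_comp (measurable_powR _)); exact: measurable_funX.
by apply/funext => t; rewrite powR_inv1// sqr_ge0.
Qed.

Lemma dcos_le (t : R) : dcos 1 t <= 2 * pi ^+ 2 * wt 2 t.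
Proof.
have [->|t0] := eqVneq t 0.
  by rewrite /dcos expr0n/= invr0 mulr0 mulr_ge0 ?wt_ge0// mulr_ge0// sqr_ge0.
rewrite /wt powRN powR_mulrn ?le_max ?ler01// /dcos mul1r.
have pi1 : 1 <= pi :> R by rewrite (le_trans _ (pi_ge2 R))// ler1n.
have E : 1 - cos (2 * pi * t) = 2 * sin (pi * t) ^+ 2.
  rewrite -mulrA mulr_natl cos_mulr2n cos2sin2; ring.
have s2 : sin (pi * t) ^+ 2 <= (pi * t) ^+ 2.
  by rewrite -[leLHS]real_normK ?num_real// -[leRHS]real_normK ?num_real//
     ler_pXn2r ?nnegrE// normr_sin_le.
have t2 : 0 < t ^+ 2 by rewrite exprn_even_gt0.
rewrite E ler_pdivrMr//; have [t1|t1] := leP `|t| 1.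
  rewrite expr1n invr1 mulr1; move: s2; rewrite exprMn.
  by move=> h; nra.
rewrite real_normK ?num_real// mulfVK ?gt_eqF// ler_pM2l//.
apply: (@le_trans _ _ 1); last by rewrite exprn_ege1.
by rewrite -[leLHS]real_normK ?num_real// exprn_ile1// sin_max.
Qed.

(** Dividing by this constant (which is 2 pi^2) normalises the transforms
    without evaluating the integral. *)
Definition dcos_mass : R := fine (\int[mu1]_t (dcos 1 t)%:E)%E.

Lemma integral_dcos1 : (\int[mu1]_t (dcos 1 t)%:E = dcos_mass%:E)%E.
Proof.
rewrite /dcos_mass fineK// ge0_fin_numE; last first.
  by apply: integral_ge0 => t _; rewrite lee_fin dcos_ge0.
apply: (@le_lt_trans _ _ (\int[mu1]_t ((2 * pi ^+ 2)%:E * (wt 2 t)%:E))%E).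
  apply: ge0_le_integral => //.
  - by move=> t _; rewrite lee_fin dcos_ge0.
  - by apply/measurable_EFinP; exact: measurable_dcos.
  - by apply/measurable_EFinP; apply: measurable_funM;
      [exact: measurable_cst|exact: measurable_wt].
  - by move=> t _; rewrite -EFinM lee_fin dcos_le.
have w0 t : (0 <= (wt 2 t : R)%:E)%E by rewrite lee_fin wt_ge0.
rewrite ge0_integralZl//; last by rewrite lee_fin mulr_ge0// exprn_ge0// pi_ge0.
  by rewrite lte_mul_pinfty// ?lee_fin ?mulr_ge0 ?exprn_ge0 ?pi_ge0// integral_wt_lty// ltr1n.
by apply/measurable_EFinP; exact: measurable_wt.
Qed.

Lemma dcos_mass_gt0 : 0 < dcos_mass.
Proof.
rewrite -lte_fin -integral_dcos1.
pose A := `[(4^-1 : R), (2^-1 : R)]%classic.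
apply: (@lt_le_trans _ _ (\int[mu1]_(t in A) 4%:E)%E).
  rewrite /A integral_cst//= lebesgue_measure_itv/= lte_fin ifT; last by lra.
  by rewrite -EFinB -EFinM lte_fin; lra.
apply: (@le_trans _ _ (\int[mu1]_(t in A) (dcos 1 t)%:E)%E); last first.
  apply: ge0_subset_integral => //.
  - exact: measurable_itv.
  - by apply/measurable_EFinP; exact: measurable_dcos.
  - by move=> t _; rewrite lee_fin dcos_ge0.
apply: ge0_le_integral => //.
- exact: measurable_itv.
- by apply: measurable_funTS; apply/measurable_EFinP; exact: measurable_dcos.
move=> t; rewrite /A/= in_itv/= => /andP[t1 t2]; rewrite lee_fin /dcos mul1r.
have t0 : 0 < t ^+ 2 by rewrite exprn_gt0//; lra.
rewrite ler_pdivlMr//.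
have cle : cos (2 * pi * t) <= 0.
  rewrite -[2 * pi * t](subrK (pi / 2)) cosDpihalf oppr_le0.
  have pi0 := pi_gt0 R.
  apply: sin_ge0_pi; apply/andP; split; nra.
have : t ^+ 2 <= 4^-1 by nra.
by lra.
Qed.

Lemma integral_dcos c : (\int[mu1]_t (dcos c t)%:E = (`|c| * dcos_mass)%:E)%E.
Proof.
wlog c0 : c / 0 <= c => [H|].
  have [/H//|c0] := leP 0 c.
  rewrite -normrN -H ?oppr_ge0 ?ltW//.
  by apply: eq_integral => t _; rewrite dcosN.
rewrite (ger0_norm c0); move: c0; rewrite le_eqVlt => /predU1P[<-|c0].
  rewrite mul0r integral0_eq// => t _.
  by rewrite /dcos mul0r mulr0 cos0 subrr mul0r.
under eq_integral => t _ do rewrite dcos_dilation EFinM.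
have mf : measurable_fun setT (fun t => (dcos 1 t)%:E).
  by apply/measurable_EFinP; exact: measurable_dcos.
have mfc : measurable_fun setT (fun t => (dcos 1 (c * t))%:E).
  apply/measurable_EFinP; apply: (measurableT_comp (@measurable_dcos 1)).
  exact: mulrl_measurable.
rewrite ge0_integralZl//; last 2 first.
- by move=> t _; rewrite lee_fin dcos_ge0.
- by rewrite lee_fin sqr_ge0.
rewrite (ge0_integral_dilation (f := fun t => (dcos 1 t)%:E))//.
  by rewrite integral_dcos1 -!EFinM; congr _%:E; field; rewrite gt_eqF.
by move=> t; rewrite lee_fin dcos_ge0.
Qed.

Lemma integrable_dcos c : mu1.-integrable setT (EFin \o dcos c).
Proof.
apply/integrableP; split; first by apply/measurable_EFinP; exact: measurable_dcos.
under eq_integral => t _ do rewrite /= ger0_norm ?dcos_ge0//.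
by rewrite integral_dcos ltry.
Qed.

Definition tri (u : R) : R := Num.max 0 (1 - `|u|).

Lemma tri_second_difference (u : R) :
  2^-1 * `|u + 1| + 2^-1 * `|u - 1| - `|u| = tri u.
Proof.
rewrite /tri; have [u0|u0] := leP 0 u.
  rewrite (ger0_norm u0) (@ger0_norm _ (u + 1)); last by lra.
  have [u1|u1] := leP 1 u.
    by rewrite ger0_norm; [rewrite max_l; lra|lra].
  by rewrite ltr0_norm; [rewrite max_r; lra|lra].
rewrite (ltr0_norm u0) (@ltr0_norm _ (u - 1)); last by lra.
have [u1|u1] := leP (- 1) u.
  by rewrite ger0_norm; [rewrite max_r; lra|lra].
by rewrite ltr0_norm; [rewrite max_l; lra|lra].
Qed.

Lemma tri_ge0 u : 0 <= tri u. Proof. by rewrite /tri le_max lexx. Qed.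

Lemma tri_le1 u : tri u <= 1.
Proof. by rewrite /tri ge_max ler01/= gerDl oppr_le0. Qed.

Lemma tri_eq0 u : 1 <= `|u| -> tri u = 0.
Proof. by move=> u1; rewrite /tri max_l// subr_le0. Qed.

Lemma tri_lipschitz u v : `|tri u - tri v| <= `|u - v|.
Proof.
have := lerB_dist u v; have := lerB_dist v u; rewrite [`|v - u|]distrC /tri.
move: `|u - v| (normr_ge0 (u - v)) => D D0 h1 h2.
rewrite ler_norml.
have [a|a] := leP 0 (1 - `|u|); have [b|b] := leP 0 (1 - `|v|);
  rewrite ?(max_r a) ?(max_r b) ?(max_l (ltW a)) ?(max_l (ltW b));
  apply/andP; split; lra.
Qed.

Definition sinc2 (lam t : R) : R := dcos lam t / (lam ^+ 2 * dcos_mass).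

Lemma sinc2_cis (lam zeta t : R) :
  cis (- (2 * pi * (t * zeta))) * (sinc2 lam t)%:C =
   ((2^-1 * dcos (zeta + lam) t + 2^-1 * dcos (zeta - lam) t - dcos zeta t) /
     (lam ^+ 2 * dcos_mass)) +i* (- (sin (2 * pi * (t * zeta)) * sinc2 lam t)) :> R[i].
Proof.
apply: complex_ext; last by rewrite cImM /= sinN mulr0 add0r mulNr.
rewrite cReM /= mulr0 subr0 cosN.
rewrite /sinc2 /dcos; move: (t ^+ 2)^-1 (lam ^+ 2 * dcos_mass)^-1 => w K.
rewrite (_ : 2 * pi * ((zeta + lam) * t) = 2 * pi * (t * zeta) + 2 * pi * (lam * t)); last ring.
rewrite (_ : 2 * pi * ((zeta - lam) * t) = 2 * pi * (t * zeta) - 2 * pi * (lam * t)); last ring.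
by rewrite (mulrC zeta t) cosB cosD; field.
Qed.

(** The Fourier transform of the rescaled squared cardinal sine is a triangle:
    expanding the product of cosines reduces it to integrals of the form
    int (1 - cos (2 pi c t)) / t^2 dt, which are proportional to |c| by
    scaling, and the triangle is the second difference of |.|. *)
Lemma fourier_sinc2 (lam zeta : R) : 0 < lam ->
  itgC mu1 (fun t => cis (- (2 * pi * (t * zeta))) * (sinc2 lam t)%:C) /\
  intC mu1 (fun t => cis (- (2 * pi * (t * zeta))) * (sinc2 lam t)%:C) =
  (lam^-1 * tri (zeta / lam))%:C.
Proof.
move=> lam0; have lamn0 : lam != 0 by rewrite gt_eqF.
have Kn0 : dcos_mass != 0 by rewrite gt_eqF// dcos_mass_gt0.
have ms : measurable_fun setT (sinc2 lam).
  by apply: measurable_funM; [exact: measurable_dcos|exact: measurable_cst].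
have mcis : mfunC (fun t : R => cis (- (2 * pi * (t * zeta)))).
  apply: mfunC_cis; apply: measurableT_comp => //; apply: measurable_funM => //.
  by apply: measurable_funM => //; exact: measurable_cst.
have s0 t : 0 <= sinc2 lam t.
  by rewrite divr_ge0 ?dcos_ge0// mulr_ge0 ?sqr_ge0// ltW// dcos_mass_gt0.
have is_ : mu1.-integrable setT (EFin \o sinc2 lam).
  have /(_ (lam ^+ 2 * dcos_mass)^-1) := integrableZr measurableT _ (integrable_dcos lam).
  by apply.
have itg : itgC mu1 (fun t => cis (- (2 * pi * (t * zeta))) * (sinc2 lam t)%:C).
  refine (@le_itgC _ _ R mu1 _ (sinc2 lam) _ _ _) => //.
    by apply: mfunCM => //; exact: mfunC_real.
  by move=> t; rewrite normcM normc_cis mul1r normc_real ger0_norm.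
split => //; rewrite /intC -complexr0; congr (_ +i* _).
  under eq_Rintegral => t _ do rewrite sinc2_cis /=.
  have i2 c : mu1.-integrable setT (EFin \o (fun t => 2^-1 * dcos c t)).
    exact: (integrableZl measurableT _ (integrable_dcos c)).
  have R2 c : \int[mu1]_t dcos c t = `|c| * dcos_mass by rewrite /Rintegral integral_dcos.
  have iD : mu1.-integrable setT
      (EFin \o (fun t => 2^-1 * dcos (zeta + lam) t + 2^-1 * dcos (zeta - lam) t)).
    exact: (integrableD measurableT (i2 _) (i2 _)).
  rewrite RintegralZr//; last exact: (integrableB measurableT iD (integrable_dcos zeta)).
  rewrite RintegralB//; last exact: integrable_dcos.
  rewrite RintegralD// !RintegralZl//; try exact: integrable_dcos.
  rewrite !R2 -tri_second_difference.
  rewrite (_ : zeta / lam + 1 = (zeta + lam) / lam); last by field.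
  rewrite (_ : zeta / lam - 1 = (zeta - lam) / lam); last by field.
  rewrite !normrM normfV (gtr0_norm lam0).
  by field; rewrite lamn0.
(* The imaginary part is odd, hence opposite to itself. *)
rewrite /Rintegral.
pose h t := complex.Im (cis (- (2 * pi * (t * zeta))) * (sinc2 lam t)%:C : R[i]).
have hN t : h (- t) = - h t.
  rewrite /h !sinc2_cis /= mulNr mulrN sinN /sinc2 /dcos mulrN mulrN cosN sqrrN; ring.
have mo : measurable_fun setT (fun t : measurableTypeR R => - t : measurableTypeR R).
  exact: oppr_measurable.
have leb A : measurable A -> mu1 A = mu1 ((fun t : measurableTypeR R => - t) @^-1` A).
  by move=> mA; rewrite -[LHS]lebesgue_measureN.
have mh : measurable_fun setT h by case: (itgC_mfunC itg).
have ihN : mu1.-integrable setT (fun t => (h (- t))%:E).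
  under eq_fun do rewrite hN EFinN; exact: integrableN itg.2.
have [_ Eh] := Rintegral_image mo leb mh ihN.
have : \int[mu1]_t h t = - \int[mu1]_t h t.
  rewrite {1}Eh; under eq_Rintegral do rewrite hN -mulN1r.
  by rewrite RintegralZl ?mulN1r//; exact: itg.2.
by rewrite /Rintegral /h /=; move: (fine _) => I; lra.
Qed.

End sinc2.

(** * Finite differences and decay of Fourier transforms *)

Section differences.
Variables (R : realType) (n : nat).
Local Notation dir := ('I_n * R)%type.

Definition fdiff (V : zmodType) (p : dir) (u : 'rV[R]_n -> V) : 'rV[R]_n -> V :=
  fun x => u (x + p.2 *: delta_mx ord0 p.1) - u x.

Definition fdiffs (V : zmodType) (l : seq dir) (u : 'rV[R]_n -> V) :=
  foldl (fun v p => fdiff p v) u l.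

Section zmod.
Variable V : zmodType.
Implicit Types u v : 'rV[R]_n -> V.

Lemma fdiffC p q u : fdiff p (fdiff q u) = fdiff q (fdiff p u).
Proof.
apply/funext => x; rewrite /fdiff [x + _ + _]addrAC.
by rewrite !opprD !opprK addrACA.
Qed.

Lemma fdiffs_fdiff l p u : fdiffs l (fdiff p u) = fdiff p (fdiffs l u).
Proof. by elim: l u => //= q l IH u; rewrite fdiffC IH. Qed.

Lemma fdiffs_shift l u a x : fdiffs l (fun y => u (y + a)) x = fdiffs l u (x + a).
Proof.
elim: l u x => //= p l IH u x; rewrite -IH; congr (fdiffs l _ x).
by apply/funext => y; rewrite /fdiff addrAC.
Qed.

Lemma fdiffsD l u v x : fdiffs l (fun y => u y + v y) x = fdiffs l u x + fdiffs l v x.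
Proof.
elim: l u v x => //= p l IH u v x; rewrite -IH; congr (fdiffs l _ x).
by apply/funext => y; rewrite /fdiff opprD addrACA.
Qed.

Lemma fdiff_invariant p u : (forall x t, u (x + t *: delta_mx ord0 p.1) = u x) ->
  fdiff p u = (fun=> 0).
Proof. by move=> h; apply/funext => x; rewrite /fdiff h subrr. Qed.

Lemma fdiffs0 l : fdiffs l (fun=> 0 : V) = (fun=> 0).
Proof.
elim: l => //= p l IH; rewrite fdiff_invariant//.
Qed.

(** Each difference enlarges the support by its step. *)
Lemma fdiffs_support l u (w : 'rV[R]_n) (rho delta : R) :
  (forall (x : 'rV[R]_n) i, rho < `|x ord0 i - w ord0 i| -> u x = 0) ->
  (forall p, p \in l -> `|p.2| <= delta) -> 0 <= delta ->
  forall (x : 'rV[R]_n) i, rho + (size l)%:R * delta < `|x ord0 i - w ord0 i| -> fdiffs l u x = 0.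
Proof.
move=> u0 ld d0; elim: l rho u u0 ld => [|p l IH] rho u u0 ld x i.
  by rewrite mul0r addr0; exact: u0.
move=> h; apply: (IH (rho + delta) _ _ _ x i); last 2 first.
- by move=> q ql; apply: ld; rewrite inE ql orbT.
- by move: h; rewrite /= -natr1 mulrDl mul1r [_ * _ + _]addrC addrA.
move=> y j yj; have pd := ld p (mem_head _ _).
have e1 : u y = 0 by apply: (u0 y j); lra.
have e2 : u (y + p.2 *: delta_mx ord0 p.1) = 0; last by rewrite /fdiff e1 e2 subrr.
apply: (u0 _ j); rewrite !mxE eqxx/=.
have : `|p.2 * (j == p.1)%:R| <= `|p.2|.
  by rewrite normrM ler_piMr// ger0_norm// lern1 leq_b1.
have := ler_normB (y ord0 j + p.2 * (j == p.1)%:R - w ord0 j) (p.2 * (j == p.1)%:R).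
rewrite (_ : _ + _ - _ - _ = y ord0 j - w ord0 j); last by ring.
by move: yj pd; move: `|_| `|_| `|_| => *; lra.
Qed.

End zmod.

Lemma fdiffs_Re l (u : 'rV[R]_n -> R[i]) x :
  complex.Re (fdiffs l u x) = fdiffs l (reF u) x.
Proof.
elim: l u x => //= p l IH u x; rewrite IH; congr (fdiffs l _ x).
by apply/funext => y; rewrite /reF /fdiff cReD cReN.
Qed.

Lemma fdiffs_Im l (u : 'rV[R]_n -> R[i]) x :
  complex.Im (fdiffs l u x) = fdiffs l (imF u) x.
Proof.
elim: l u x => //= p l IH u x; rewrite IH; congr (fdiffs l _ x).
by apply/funext => y; rewrite /imF /fdiff cImD cImN.
Qed.

(** The quantification over the sublists of l is what makes the property stable
    under products, since the Leibniz rule distributes the steps of l between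
    the factors. *)
Definition fdiffs_bounded (l : seq dir) (tau : dir -> R) (A : R) (u : 'rV[R]_n -> R[i]) :=
  forall l', subseq l' l -> forall x,
    normc (fdiffs l' u x) <= A * \prod_(p <- l') tau p.

Lemma fdiffs_boundedS l tau tau' A A' u :
  (forall p, 0 <= tau p <= tau' p) -> 0 <= A <= A' ->
  fdiffs_bounded l tau A u -> fdiffs_bounded l tau' A' u.
Proof.
move=> tt /andP[A0 AA] ub l' l'l x; apply: (le_trans (ub _ l'l x)).
apply: ler_pM => //.
  by apply: prodr_ge0 => p _; have /andP[] := tt p.
by apply: ler_prod => p _; exact: tt.
Qed.

(** Leibniz rule: the difference of u v is that of u times a translate of v,
    plus u times that of v.  The number of terms doubles at each step, whence
    the factor 2 on the weights. *)
Lemma fdiffs_boundedM l tau A B u v : (forall p, 0 <= tau p) -> 0 <= A -> 0 <= B ->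
  fdiffs_bounded l tau A u -> fdiffs_bounded l tau B v ->
  fdiffs_bounded l (fun p => 2 * tau p) (A * B) (fun x => u x * v x).
Proof.
move=> t0 A0 B0 ub vb l' l'l x.
have {}ub l'' : subseq l'' l' -> forall x, normc (fdiffs l'' u x) <= A * \prod_(p <- l'') tau p.
  by move=> h; apply: ub; exact: subseq_trans l'l.
have {}vb l'' : subseq l'' l' -> forall x, normc (fdiffs l'' v x) <= B * \prod_(p <- l'') tau p.
  by move=> h; apply: vb; exact: subseq_trans l'l.
elim: l' A B A0 B0 u v ub vb x {l'l} => [|p l' IH] A B A0 B0 u v ub vb x.
  rewrite big_nil mulr1 /= normcM.
  by apply: ler_pM; rewrite ?normc_ge0//;
    [have := ub [::] isT x|have := vb [::] isT x]; rewrite big_nil mulr1.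
have -> : fdiffs (p :: l') (fun y => u y * v y) x =
    fdiffs l' (fun y => fdiff p u y * v (y + p.2 *: delta_mx ord0 p.1)) x +
    fdiffs l' (fun y => u y * fdiff p v y) x.
  rewrite -fdiffsD /=; congr (fdiffs l' _ x); apply/funext => y; rewrite /fdiff.
  by ring.
have sub l'' : subseq l'' l' -> subseq (p :: l'') (p :: l') by rewrite /= eqxx.
have sub' l'' : subseq l'' l' -> subseq l'' (p :: l').
  by move=> h; apply: (subseq_trans h); exact: subseq_cons.
apply: (le_trans (normcD _ _)).
have h1 := IH (A * tau p) B _ B0 (fdiff p u) (fun y => v (y + p.2 *: delta_mx ord0 p.1)) _ _ x.
have h2 := IH A (B * tau p) A0 _ u (fdiff p v) _ _ x.
rewrite big_cons (_ : A * B * _ = (A * tau p * B) * \prod_(j <- l') (2 * tau j) +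
    (A * (B * tau p)) * \prod_(j <- l') (2 * tau j)); last by ring.
apply: lerD.
  apply: h1 => [|l'' s y|l'' s y]; first exact: mulr_ge0.
    by have := ub (p :: l'') (sub _ s) y; rewrite big_cons mulrA.
  by rewrite fdiffs_shift; apply: vb; exact: sub'.
apply: h2 => [|l'' s y|l'' s y]; first exact: mulr_ge0.
  by apply: ub; exact: sub'.
by have := vb (p :: l'') (sub _ s) y; rewrite big_cons mulrA.
Qed.

Lemma fdiffs_bounded_prod (I : Type) (r : seq I) l tau (u : I -> 'rV[R]_n -> R[i]) :
  (forall p, 0 <= tau p) -> (forall i, fdiffs_bounded l tau 1 (u i)) ->
  fdiffs_bounded l (fun p => 2 ^+ size r * tau p) 1 (fun x => \prod_(i <- r) u i x).
Proof.
move=> t0 ub; elim: r => [|i r IH].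
  move=> l' _ x; rewrite (_ : (fun y => _) = (fun=> 1)); last first.
    by apply/funext => y; rewrite big_nil.
  case: l' => [|p l']; first by rewrite !big_nil mulr1 /= expr1n expr0n/= addr0 sqrtr1.
  rewrite [fdiffs _ _]/= fdiff_invariant// fdiffs0.
  rewrite complex.ComplexField.Normc.normc0 mulr_ge0// prodr_ge0// => q _.
  by rewrite mulr_ge0.
rewrite (_ : (fun y => _) = (fun y => u i y * \prod_(j <- r) u j y)); last first.
  by apply/funext => y; rewrite big_cons.
rewrite (_ : (fun p => 2 ^+ size (i :: r) * tau p) = fun p => 2 * (2 ^+ size r * tau p)); last first.
  by apply/funext => p; rewrite /= exprS mulrA.
rewrite -[X in fdiffs_bounded _ _ X](mulr1 1).
apply: fdiffs_boundedM => //; first by move=> p; rewrite mulr_ge0.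
apply: fdiffs_boundedS (ub i); last by rewrite ler01 lexx.
by move=> p; rewrite t0/= ler_peMl// exprn_ege1// ler1n.
Qed.

(** The directions of l being distinct, at most one difference is taken in the
    coordinate on which the triangle depends: its Lipschitz bound suffices. *)
Lemma fdiffs_bounded_tri l (lam : R) (w : 'rV[R]_n) i : 0 < lam ->
  uniq (map fst l) ->
  fdiffs_bounded l (fun p => `|p.2| / lam) 1
    (fun x => (tri ((x ord0 i - w ord0 i) / lam))%:C).
Proof.
move=> lam0 ul l' l'l x.
have {ul l'l} : uniq (map fst l') by apply: subseq_uniq ul; exact: map_subseq.
have c0 : 0 <= \prod_(p <- l') (`|p.2| / lam).
  by apply: prodr_ge0 => p _; rewrite divr_ge0// ltW.
have inv j (t : R) (y : 'rV[R]_n) : j != i -> (y + t *: delta_mx ord0 j) ord0 i = y ord0 i.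
  by move=> ji; rewrite !mxE eqxx/= eq_sym (negbTE ji) mulr0 addr0.
case: l' c0 => [|p l'] c0 ul.
  by rewrite big_nil mulr1 normc_real ger0_norm ?tri_le1// tri_ge0.
rewrite [fdiffs _ _]/=.
have [pi|pi] := eqVneq p.1 i; last first.
  rewrite fdiff_invariant ?fdiffs0; last by move=> y t; rewrite inv.
  by rewrite complex.ComplexField.Normc.normc0 mul1r.
case: l' ul c0 => [|q l'].
  move=> _ _; rewrite big_seq1 mul1r [fdiffs _ _]/= /fdiff.
  rewrite [X in normc X](_ : _ =
    (tri (((x + p.2 *: delta_mx ord0 p.1) ord0 i - w ord0 i) / lam) -
     tri ((x ord0 i - w ord0 i) / lam))%:C); last first.
    by apply: complex_ext; rewrite /= ?subrr.
  rewrite normc_real.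
  apply: (le_trans (tri_lipschitz _ _)).
  rewrite -mulrBl normrM normfV (gtr0_norm lam0) ler_pM2r ?invr_gt0//.
  rewrite !mxE eqxx pi eqxx/= mulr1.
  by rewrite (_ : _ - _ = p.2)//; ring.
rewrite /= inE negb_or => /andP[/andP[pq _] _] c0; rewrite [fdiffs _ _]/=.
rewrite (@fdiff_invariant _ q); first by rewrite fdiffs0 complex.ComplexField.Normc.normc0 mul1r.
have qi : q.1 != i by rewrite -pi eq_sym.
by move=> y t; rewrite /fdiff addrAC !(inv _ _ _ qi).
Qed.

Lemma derivable_shift (u : 'rV[R]_n -> R) a x v :
  derivable u (x + a) v -> derivable (fun y => u (y + a)) x v /\
  'D_v (fun y => u (y + a)) x = 'D_v u (x + a).
Proof.
rewrite /derivable /derive.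
rewrite (_ : (fun h => h^-1 *: ((u \o shift (x + a)) (h *: v) - u (x + a))) =
  (fun h => h^-1 *: (((fun y => u (y + a)) \o shift x) (h *: v) - u (x + a))))//.
by apply/funext => h /=; rewrite addrA.
Qed.

Lemma derivable_fdiffs l (u : 'rV[R]_n -> R) v : (forall x, derivable u x v) ->
  (forall x, derivable (fdiffs l u) x v) /\ 'D_v (fdiffs l u) = fdiffs l ('D_v u).
Proof.
elim: l u => //= p l IH u du.
pose a : 'rV[R]_n := p.2 *: delta_mx ord0 p.1.
have ds x : derivable (fun y => u (y + a)) x v by apply: (derivable_shift (du _)).1.
have [|dl ->] := IH (fdiff p u).
  by move=> x; exact: derivableB.
split => //; congr (fdiffs l _); apply/funext => x.
rewrite /fdiff -/a -(derivable_shift (du (x + a))).2.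
by rewrite -deriveB.
Qed.

Lemma fdiff_le_derive (u : 'rV[R]_n -> R) p B :
  (forall x, derivable u x (delta_mx ord0 p.1)) ->
  (forall x, `|'D_(delta_mx ord0 p.1) u x| <= B) ->
  forall x, `|fdiff p u x| <= `|p.2| * B.
Proof.
case: p => i; move=> /= t du uB x.
pose v : 'rV[R]_n := delta_mx ord0 i; rewrite -/v in du uB *.
pose f (s : R) := u (x + s *: v).
have df (s : R) : is_derive s 1 f ('D_v u (x + s *: v)).
  have E : (fun h : R => h^-1 *: ((f \o shift s) (h *: 1) - f s)) =
      (fun h => h^-1 *: ((u \o shift (x + s *: v)) (h *: v) - u (x + s *: v))).
    by apply/funext => h /=; rewrite /f [h *: 1]mulr1 scalerDl addrCA.
  by split; [rewrite /derivable E; exact: du|rewrite /derive E].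
have cf : continuous f by move=> s; apply/differentiable_continuous/derivable1_diffP; case: (df s).
have key a b : a <= b -> `|f b - f a| <= (b - a) * B.
  move=> ab; have [c _ ->] := MVT_segment ab (fun s _ => df s) (continuous_subspaceT cf).
  by rewrite normrM mulrC (@ger0_norm _ (b - a)) ?subr_ge0// ler_wpM2l// subr_ge0.
rewrite /fdiff/= -/v (_ : u x = f 0); last by rewrite /f scale0r addr0.
have [t0|t0] := leP 0 t.
  by have := key 0 t t0; rewrite subr0 (ger0_norm t0).
have := key t 0 (ltW t0); rewrite sub0r (ltr0_norm t0).
by rewrite distrC.
Qed.

(** Mean value theorem along each step. *)
Lemma fdiffs_le_partial (u : 'rV[R]_n -> R) l a B : smooth_r u ->
  (forall x, `|partial_r (rev (map fst l) ++ a) u x| <= B) ->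
  forall x, `|fdiffs l (partial_r a u) x| <= (\prod_(p <- l) `|p.2|) * B.
Proof.
move=> su; elim: l a => [|p l IH] a uB x.
  by rewrite big_nil mul1r; exact: uB.
have [da dE] := derivable_fdiffs l ((su a).2 p.1).
rewrite big_cons -mulrA [fdiffs _ _]/= fdiffs_fdiff.
apply: fdiff_le_derive => // y.
rewrite (_ : 'D_(_) _ y = fdiffs l (partial_r (p.1 :: a) u) y); last first.
  exact: (congr1 (@^~ y) dE).
apply: IH => z.
by have := uB z; rewrite /= rev_cons cat_rcons.
Qed.

Lemma fdiffs_bounded_smooth (f : 'rV[R]_n -> R[i]) l lam (A : R) : smooth f ->
  0 < lam -> 0 <= A ->
  (forall a, (size a <= size l)%N -> forall x, lam ^+ size a * normc (partial a f x) <= A) ->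
  fdiffs_bounded l (fun p => `|p.2| / lam) (2 * A) f.
Proof.
move=> [sr si] lam0 A0 fA l' l'l x.
pose a := rev (map fst l').
have sa : size a = size l' by rewrite size_rev size_map.
have lamn0 : 0 < lam ^+ size l' by rewrite exprn_gt0.
have pE : \prod_(p <- l') (`|p.2| / lam) = (\prod_(p <- l') `|p.2|) / lam ^+ size l'.
  rewrite big_split/=; congr (_ * _); rewrite -exprVn.
  by elim: (l') => [|q k IHk]; rewrite ?big_nil// big_cons IHk exprS.
have bound y : normc (partial a f y) <= A / lam ^+ size l'.
  rewrite ler_pdivlMr// mulrC -sa; apply: fA; rewrite sa; exact: size_subseq.
apply: (le_trans (normc_le_ReIm _)); rewrite fdiffs_Re fdiffs_Im.
have b1 := @fdiffs_le_partial (reF f) l' [::] (A / lam ^+ size l') sr.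
have b2 := @fdiffs_le_partial (imF f) l' [::] (A / lam ^+ size l') si.
rewrite !cats0 -/a in b1 b2.
rewrite (_ : 2 * A * _ = (\prod_(p <- l') `|p.2|) * (A / lam ^+ size l') +
   (\prod_(p <- l') `|p.2|) * (A / lam ^+ size l')); last by rewrite pE; ring.
apply: lerD; [apply: b1|apply: b2] => y; apply: le_trans (bound y).
  exact: (normr_Re_le (partial a f y)).
exact: (normr_Im_le (partial a f y)).
Qed.

End differences.

Section fourier_decay.
Variables (R : realType) (n : nat).
Local Notation mu := (@lebesgue_rV R n).
Implicit Types (f m : 'rV[R]_n -> R[i]) (w x : 'rV[R]_n).

Definition cube w (rho : R) := [set x : 'rV[R]_n | forall i, `|x ord0 i - w ord0 i| <= rho].

Lemma cubeE w rho :
  cube w rho = [set x | forall i, `[w ord0 i - rho, w ord0 i + rho]%classic (x ord0 i)].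
Proof.
by apply/seteqP; split => x h i; move: (h i); rewrite /= in_itv/= -ler_distl.
Qed.

Lemma measurable_cube w rho : measurable (cube w rho).
Proof. by rewrite cubeE; exact: (measurable_rV_box (fun=> measurable_itv _)). Qed.

Lemma lebesgue_rV_cube w (rho : R) : 0 <= rho -> mu (cube w rho) = ((2 * rho) ^+ n)%:E.
Proof.
move=> r0; rewrite cubeE (lebesgue_rV_box (fun=> measurable_itv _)).
rewrite (eq_bigr (fun=> (2 * rho)%:E)) => [|i _].
  by rewrite prodEFin prodr_const card_ord.
rewrite lebesgue_measure_itv/= lte_fin; case: ifPn => [_|].
  by rewrite -EFinB; congr _%:E; ring.
by rewrite -leNgt => h; congr _%:E; lra.
Qed.

Lemma integral_cube_le (u : 'rV[R]_n -> R) w (rho c : R) : 0 <= rho -> 0 <= c ->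
  measurable_fun setT u -> (forall x, 0 <= u x <= c) ->
  (forall x i, rho < `|x ord0 i - w ord0 i| -> u x = 0) ->
  (\int[mu]_x (u x)%:E <= (c * (2 * rho) ^+ n)%:E)%E.
Proof.
move=> r0 c0 mu_ uc u0.
have mcu := measurable_cube w rho.
apply: (@le_trans _ _ (\int[mu]_x (c%:E * (\1_(cube w rho) x)%:E))%E).
  apply: ge0_le_integral => //.
  - by move=> x _; rewrite lee_fin; have /andP[] := uc x.
  - exact/measurable_EFinP.
  - by apply/measurable_EFinP; apply: measurable_funM;
      [exact: measurable_cst|exact: measurable_indic].
  move=> x _; rewrite -EFinM lee_fin indicE.
  have [xc|/negP xc] := boolP (x \in cube w rho).
    by rewrite mulr1; have /andP[] := uc x.
  rewrite mulr0; have [i xi] : exists i, rho < `|x ord0 i - w ord0 i|.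
    apply/not_existsP => h; apply: xc; rewrite inE => i.
    by rewrite leNgt; apply/negP; exact: h.
  by rewrite (u0 x i).
have mE : measurable_fun setT (fun x => (\1_(cube w rho) x : R)%:E).
  by apply/measurable_EFinP; exact: measurable_indic.
have -> : (\int[mu]_x (c%:E * (\1_(cube w rho) x)%:E) = c%:E * \int[mu]_x (\1_(cube w rho) x)%:E)%E.
  by apply: ge0_integralZl => //; rewrite lee_fin.
by rewrite integral_indic// setIT /= lebesgue_rV_cube// EFinM.
Qed.

Lemma measurable_dotp_l x : measurable_fun setT (dotp x).
Proof.
apply: measurable_sum => i; apply: measurable_funM; first exact: measurable_cst.
exact: measurable_coord.
Qed.

Lemma mfunC_cis_dotp c x : mfunC (fun xi : 'rV[R]_n => cis (c * dotp x xi)).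
Proof.
apply: mfunC_cis; apply: measurable_funM; first exact: measurable_cst.
exact: measurable_dotp_l.
Qed.

Lemma itgC_bounded_mul f (k : 'rV[R]_n -> R[i]) (M : R) : mfunC k ->
  (forall x, normc (k x) <= M) -> itgC mu f -> itgC mu (fun x => k x * f x).
Proof.
move=> mk kM fi; apply: (@le_itgC _ _ _ _ _ (fun x => M * normc (f x))).
- by apply: mfunCM => //; exact: itgC_mfunC fi.
- exact: (integrableZl measurableT M (itgC_normc fi)).
- by move=> x; rewrite normcM ler_wpM2r// normc_ge0.
Qed.

Lemma itgC_cis f c x : itgC mu f -> itgC mu (fun xi => cis (c * dotp x xi) * f xi).
Proof.
apply: (itgC_bounded_mul (M := 1)); first exact: mfunC_cis_dotp.
by move=> y; rewrite normc_cis.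
Qed.

Lemma normc_fourier_inv_le f x : itgC mu f ->
  ((normc (fourier_inv f x))%:E <= 2%:E * \int[mu]_x (normc (f x))%:E)%E.
Proof.
move=> fi; apply: (le_trans (intC_norm_le (itgC_cis (2 * pi) x fi))).
by under eq_integral => y _ do rewrite normcM normc_cis mul1r.
Qed.

Lemma dotpDr x y z : dotp x (y + z) = dotp x y + dotp x z.
Proof.
by rewrite /dotp -big_split; apply: eq_bigr => i _; rewrite mxE mulrDr.
Qed.

Lemma dotp_delta x t i : dotp x (t *: delta_mx ord0 i) = t * x ord0 i.
Proof.
rewrite /dotp (bigD1 i)//= big1 => [|j ji].
  by rewrite !mxE !eqxx mulr1 addr0 mulrC.
by rewrite !mxE (negbTE ji) andbF mulr0 mulr0.
Qed.

Lemma itgC_fdiff f p : itgC mu f -> itgC mu (fdiff p f).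
Proof.
move=> fi; apply: itgCD; last exact: itgCN.
exact: (intC_rV_shift _ fi).1.
Qed.

Lemma itgC_fdiffs f l : itgC mu f -> itgC mu (fdiffs l f).
Proof. by elim: l f => //= p l IH f fi; apply: IH; exact: itgC_fdiff. Qed.

(** Shifting f by half a period of the oscillation along one coordinate
    changes the sign of its transform; thus decay of the transform is read off
    from the differences of f, without integrating by parts. *)
Lemma fourier_inv_fdiff f p x : itgC mu f -> p.2 * x ord0 p.1 = 2^-1 ->
  fourier_inv (fdiff p f) x = - (2%:R) * fourier_inv f x.
Proof.
move=> fi px; pose v : 'rV[R]_n := p.2 *: delta_mx ord0 p.1.
have fvi := (intC_rV_shift v fi).1.
pose g xi := cis (2 * pi * dotp x (xi - v)) * f xi.
have dN xi : dotp x (xi - v) = dotp x xi - 2^-1.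
  by rewrite -scaleNr dotpDr dotp_delta mulNr px.
have gE xi : g xi = - 1 * (cis (2 * pi * dotp x xi) * f xi).
  rewrite /g dN (_ : 2 * pi * (_ - _) = 2 * pi * dotp x xi + - pi); last by field.
  rewrite cisD (_ : cis (- pi) = - 1 :> R[i]); first by rewrite mulrN1 [LHS]mulNr mulN1r.
  by apply: complex_ext; rewrite /= ?cosN ?sinN ?cospi ?sinpi ?oppr0.
have gi : itgC mu g.
  have -> : g = fun xi => - 1 * (cis (2 * pi * dotp x xi) * f xi) by exact/funext.
  by apply: itgCZ; exact: itgC_cis.
have [gvi gvE] := intC_rV_shift v gi.
have E : (fun xi => cis (2 * pi * dotp x xi) * fdiff p f xi) =
    (fun xi => g (xi + v) + - (cis (2 * pi * dotp x xi) * f xi)).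
  by apply/funext => xi; rewrite /g addrK /fdiff -/v mulrBr.
rewrite /fourier_inv -[integralC _]/(intC mu _) E intCD//; last exact/itgCN/itgC_cis.
rewrite intCN ?gvE; last exact: itgC_cis.
rewrite (_ : g = fun xi => - 1 * (cis (2 * pi * dotp x xi) * f xi)); last exact/funext.
rewrite intCZ; last exact: itgC_cis.
by rewrite -[integralC _]/(intC mu _); ring.
Qed.

Lemma fourier_inv_fdiffs f l x : itgC mu f ->
  (forall p, p \in l -> p.2 * x ord0 p.1 = 2^-1) ->
  normc (fourier_inv (fdiffs l f) x) = 2 ^+ size l * normc (fourier_inv f x).
Proof.
move=> fi; elim: l f fi => [|p l IH] f fi lx; first by rewrite mul1r.
rewrite [fdiffs _ _]/= IH; last 2 first.
- exact: itgC_fdiff.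
- by move=> q ql; apply: lx; rewrite inE ql orbT.
rewrite fourier_inv_fdiff//; last by apply: lx; exact: mem_head.
rewrite normcM normcN (_ : normc 2%:R = 2) ?exprS; first by rewrite mulrCA mulrA.
rewrite -[2%:R]/(1 + 1 : R[i]) (_ : (1 + 1 : R[i]) = (2 : R)%:C) ?normc_real ?ger0_norm//.
by apply: complex_ext; rewrite /= ?addr0.
Qed.

Lemma wt1E (t : R) : wt 1 t = (Num.max 1 `|t|)^-1.
Proof. by rewrite /wt powR_inv1// le_max ler01. Qed.

(** For each x, differences are taken in the coordinates with lam |x_i| > 1 only,
    with the steps 1 / (2 x_i), which are shorter than lam; each of them gains a
    factor 1 / (lam |x_i|).  They enlarge the support of m, whose side is of
    order lam, by a bounded factor. *)
Lemma fourier_inv_decay m w (lam A kappa : R) : 0 < lam -> 0 <= A -> 1 <= kappa ->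
  mfunC m -> (forall (xi : 'rV[R]_n) i, lam < `|xi ord0 i - w ord0 i| -> m xi = 0) ->
  (forall l, uniq (map fst l) ->
    fdiffs_bounded l (fun p => kappa * (`|p.2| / lam)) A m) ->
  itgC mu m /\
  forall x, normc (fourier_inv m x) <=
    2 * A * (lam * n.+2%:R * kappa) ^+ n * \prod_i wt 1 (lam * x ord0 i).
Proof.
move=> lam0 A0 k1 mm m0 mb.
have mi : itgC mu m.
  apply: itgC_lty => //; apply: (@le_lt_trans _ _ (A * (2 * lam) ^+ n)%:E); last exact: ltry.
  apply: (integral_cube_le (w := w)) => //; first exact: ltW.
  - exact: mfunC_normc.
  - move=> x; rewrite normc_ge0/=.
    by have := mb [::] isT [::] isT x; rewrite big_nil mulr1.
  - by move=> x i xi; rewrite (m0 x i xi) complex.ComplexField.Normc.normc0.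
split => // x.
(* Differences in the other coordinates would not improve on the sup norm. *)
pose P i := 1 < lam * `|x ord0 i|.
pose l := [seq (i, (2 * x ord0 i)^-1) | i <- enum 'I_n & P i].
have mapl : map fst l = [seq i <- enum 'I_n | P i].
  by rewrite /l -map_comp (eq_map (g := id)) ?map_id.
have ul : uniq (map fst l) by rewrite mapl filter_uniq// enum_uniq.
have xP i : P i -> x ord0 i != 0.
  by apply: contraTneq => x0; rewrite /P x0 normr0 mulr0 ltr10.
have lx p : p \in l -> p.2 * x ord0 p.1 = 2^-1.
  case/mapP => i; rewrite mem_filter => /andP[Pi _] -> /=.
  by field; exact: xP.
have sl : (size l <= n)%N.
  rewrite size_map size_filter (leq_trans (count_size _ _))//.
  by rewrite size_enum_ord.
have lam2 : 0 <= lam / 2 by rewrite divr_ge0// ltW.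
have ld p : p \in l -> `|p.2| <= lam / 2.
  case/mapP => i; rewrite mem_filter => /andP[Pi _] -> /=.
  have xi0 : 0 < `|x ord0 i| by rewrite normr_gt0 xP.
  rewrite normfV normrM ger0_norm// invfM mulrC ler_pM2r//.
  by rewrite -[leLHS]mul1r ler_pdivrMr// ltW.
pose rho := lam * n.+2%:R / 2.
have rho0 : 0 <= rho by rewrite divr_ge0// mulr_ge0// ltW.
have dm0 (xi : 'rV[R]_n) i : rho < `|xi ord0 i - w ord0 i| -> fdiffs l m xi = 0.
  move=> h; apply: (fdiffs_support m0 ld lam2 (i := i)); apply: le_lt_trans h.
  have : (size l)%:R <= n%:R :> R by rewrite ler_nat.
  rewrite /rho -[n.+2]addn2 natrD; move: ((size l)%:R) => s; nra.
pose B := A * \prod_(p <- l) (kappa * (`|p.2| / lam)).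
have pr0 : 0 <= \prod_(p <- l) (kappa * (`|p.2| / lam)).
  by apply: prodr_ge0 => p _; rewrite mulr_ge0 ?divr_ge0 ?(ltW lam0)// (le_trans ler01).
have B0 : 0 <= B by rewrite mulr_ge0.
have dmi := itgC_fdiffs l mi.
have dm : (\int[mu]_xi (normc (fdiffs l m xi))%:E <= (B * (2 * rho) ^+ n)%:E)%E.
  apply: (integral_cube_le (w := w)) => //.
  - exact: (mfunC_normc (itgC_mfunC dmi)).
  - by move=> xi; rewrite normc_ge0/=; exact: (mb l ul l (subseq_refl l) xi).
  - by move=> xi i xii; rewrite (dm0 xi i xii) complex.ComplexField.Normc.normc0.
have h1 : normc (fourier_inv m x) <= normc (fourier_inv (fdiffs l m) x).
  by rewrite fourier_inv_fdiffs// ler_peMl ?normc_ge0// exprn_ege1// ler1n.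
apply: (le_trans h1); rewrite -lee_fin.
apply: (le_trans (normc_fourier_inv_le x dmi)).
apply: (@le_trans _ _ (2%:E * (B * (2 * rho) ^+ n)%:E)%E).
  by apply: lee_wpmul2l => //; rewrite lee_fin.
rewrite -EFinM lee_fin.
have -> : 2 * rho = lam * n.+2%:R by rewrite /rho; field.
have pE : \prod_(p <- l) (kappa * (`|p.2| / lam)) <=
    kappa ^+ n * \prod_i wt 1 (lam * x ord0 i).
  rewrite /l big_map big_filter big_enum_cond/= big_mkcond/=.
  rewrite -[n in kappa ^+ n](card_ord n) -prodr_const -big_split/=.
  apply: ler_prod => i _; rewrite wt1E normrM (gtr0_norm lam0).
  have k0 : 0 <= kappa by exact: le_trans k1.
  rewrite /P; have [p1|p1] := ltP 1 (lam * `|x ord0 i|); last first.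
    by rewrite ler01/= invr1 mulr1.
  have xi0 : 0 < `|x ord0 i|.
    by rewrite -(pmulr_rgt0 _ lam0) (lt_trans ltr01).
  rewrite mulr_ge0 ?divr_ge0 ?(ltW lam0)//=; rewrite ler_wpM2l// normfV normrM ger0_norm//.
  rewrite -invfM lef_pV2 ?posrE ?mulr_gt0//; first by nra.
have c0 : 0 <= (lam * n.+2%:R) ^+ n by rewrite exprn_ge0// mulr_ge0// ltW.
rewrite [(_ * kappa) ^+ n]exprMn /B.
rewrite (_ : 2 * A * _ * _ = 2 * (A * (kappa ^+ n * \prod_i wt 1 (lam * x ord0 i)) *
  (lam * n.+2%:R) ^+ n)); last by ring.
by rewrite ler_wpM2l// ler_wpM2r// ler_wpM2l.
Qed.

End fourier_decay.

(** * Lorentz quasi-norms *)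

(** The integral of a non-negative function is a supremum over the simple
    functions below it, so that it is monotone without measurability; this
    spares that of the distribution function in the level. *)
Lemma ge0_le_integral_any d (T : measurableType d) (R : realType)
    (mu : {measure set T -> \bar R}) (D : set T) (f1 f2 : T -> \bar R) :
  (forall x, D x -> 0 <= f1 x)%E -> (forall x, D x -> f1 x <= f2 x)%E ->
  (\int[mu]_(x in D) f1 x <= \int[mu]_(x in D) f2 x)%E.
Proof.
move=> f10 f12; rewrite !ge0_integralE//; last first.
  by move=> x Dx; apply: le_trans (f10 x Dx) (f12 x Dx).
apply: le_ereal_sup => _ [h hf <-]; exists h => //= x; apply: (le_trans (hf x)).
by apply: lee_restrict.
Qed.

Lemma measurable_invR (R : realType) : measurable_fun setT (fun a : R => a^-1).
Proof.
rewrite (_ : (fun a : R => _) = (fun a : R => (a ^+ 2) `^ (- 1) * a)).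
  apply: measurable_funM => //.
  by apply: (measurableT_comp (measurable_powR _)); exact: measurable_funX.
apply/funext => a; rewrite powR_inv1 ?sqr_ge0//.
have [->|a0] := eqVneq a 0; first by rewrite invr0 mulr0.
by field.
Qed.

Section lorentz_bounds.
Variables (R : realType) (n : nat).
Local Notation mu := (@lebesgue_rV R n).
Implicit Types g : 'rV[R]_n -> R[i].

Lemma distribution_function_ge0 g a : (0 <= distribution_function g a)%E.
Proof. exact: measure_ge0. Qed.

Lemma measurable_level g a : mfunC g -> measurable [set x | a < normc (g x)].
Proof.
move=> mg; rewrite (_ : [set _ | _] = (fun x => normc (g x)) @^-1` `]a, +oo[).
  by rewrite -[X in measurable X]setTI; apply: (mfunC_normc mg) => //; exact: measurable_itv.
by apply/seteqP; split => x /=; rewrite in_itv/= andbT.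
Qed.

Lemma distribution_function_le g a b : mfunC g -> a <= b ->
  (distribution_function g b <= distribution_function g a)%E.
Proof.
move=> mg ab; apply: le_measure; rewrite ?inE; try exact: measurable_level.
by move=> x /=; exact: le_lt_trans.
Qed.

(** Interpolation between the sup norm and a weak L^r bound: the integral
    defining the quasi-norm converges at 0 because r < p, and the levels above K
    do not contribute. *)
Lemma lorentz_norm_le (p r : R) (q : \bar R) : 0 < r -> r < p -> 0 < p -> (1 <= q)%E ->
  exists C : R, 0 <= C /\ forall g (K L : R), 0 < K -> 0 <= L ->
    (forall x, normc (g x) <= K) ->
    (forall a : R, 0 < a -> (distribution_function g a <= ((K / a) `^ r * L)%:E)%E) ->
    (lorentz_norm p q g <= (C * (K * L `^ p^-1))%:E)%E.
Proof.
move=> r0 rp p0 q1.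
have pV0 : 0 < p^-1 by rewrite invr_gt0.
have level0 g (K a : R) : (forall x, normc (g x) <= K) -> K <= a ->
    distribution_function g a = 0%E.
  move=> gK Ka; rewrite /distribution_function (_ : [set _ | _] = set0) ?measure0//.
  by apply/seteqP; split => x //= ax; have := lt_le_trans ax (le_trans (gK x) Ka); rewrite ltxx.
have level g (K L a : R) : 0 < K -> 0 <= L -> 0 < a ->
    (distribution_function g a <= ((K / a) `^ r * L)%:E)%E ->
    (distribution_function g a `^ p^-1 <= ((K / a) `^ (r / p) * L `^ p^-1)%:E)%E.
  move=> K0 L0 a0 gL.
  have Ka0 : 0 <= K / a by rewrite divr_ge0// ltW.
  rewrite powRrM -powRM ?powR_ge0// -poweR_EFin; apply: gt0_ler_poweR => //.
  - exact: ltW.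
  - by rewrite in_itv/= distribution_function_ge0 leey.
  - by rewrite in_itv/= leey andbT lee_fin mulr_ge0// powR_ge0.
case: q q1 => [t| |//] q1; last first.
  exists 1; split => // g K L K0 L0 gK gL; rewrite mul1r.
  apply: ge_ereal_sup => _ [a + <-]; rewrite /= in_itv/= andbT => a0.
  have [Ka|aK] := leP K a.
    rewrite (level0 g K)// poweR0r ?gt_eqF// mule0 lee_fin mulr_ge0 ?powR_ge0// ltW//.
  apply: (le_trans (lee_wpmul2l _ (level g K L a K0 L0 a0 (gL a a0)))); first by rewrite lee_fin ltW.
  rewrite -EFinM lee_fin mulrA ler_wpM2r ?powR_ge0//.
  have h : (K / a) `^ (r / p) <= K / a.
    by apply: ler1_powR; rewrite ?ler_pdivlMr ?ler_pdivrMr ?mul1r// ltW.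
  by apply: (le_trans (ler_wpM2l (ltW a0) h)); rewrite mulrC divfK// gt_eqF.
have t1 : 1 <= t by rewrite -lee_fin.
have t0 : 0 < t by rewrite (lt_le_trans ltr01).
have [e eE] : exists e, e = t * (1 - r / p) by exists (t * (1 - r / p)).
have rp1 : r / p < 1 by rewrite ltr_pdivrMr ?mul1r.
have e0 : 0 < e by rewrite eE mulr_gt0 ?subr_gt0.
pose u : R := 2 `^ (- e).
have u1 : u < 1 by rewrite powR_lt1 ?ltr1n// oppr_lt0.
have u0 : 0 <= u by exact: powR_ge0.
pose C1 := p * (2 / (1 - u)).
have C10 : 0 <= C1 by rewrite mulr_ge0 ?(ltW p0)// divr_ge0// subr_ge0 ltW.
exists (C1 `^ t^-1); split; first exact: powR_ge0.
move=> g K L K0 L0 gK gL; rewrite /lorentz_norm.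
pose D := (K * L `^ p^-1) `^ t.
have KL0 : 0 <= K * L `^ p^-1 by rewrite mulr_ge0 ?powR_ge0// ltW.
have D0 : 0 <= D by exact: powR_ge0.
(* the majorant of the integrand, extended by 0 *)
pose phi (a : R) : R := \1_(`]0, K[%classic) a * (D * ((a / K) `^ e * a^-1)).
have phiE0 a : ~~ (0 < a < K) -> phi a = 0.
  by move=> aK; rewrite /phi indicE memNset ?mul0r//= in_itv/=; exact/negP.
have phiE1 a : 0 < a < K -> phi a = D * ((a / K) `^ e * a^-1).
  by move=> aK; rewrite /phi indicE mem_set ?mul1r//= in_itv.
have phi0 a : 0 <= phi a.
  have [aK|/phiE0 ->//] := boolP (0 < a < K); rewrite (phiE1 _ aK).
  by case/andP: aK => a0 _; rewrite mulr_ge0// mulr_ge0 ?powR_ge0// invr_ge0 ltW.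
have mphi : measurable_fun setT phi.
  apply: measurable_funM; first exact: measurable_indic.
  apply: measurable_funM; first exact: measurable_cst.
  apply: measurable_funM.
    apply: (measurableT_comp (measurable_powR _)).
    by apply: measurable_funM => //; exact: measurable_cst.
  exact: measurable_invR.
have phiD : (\int[lebesgue_measure]_a (phi a)%:E <= (2 * D / (1 - u))%:E)%E.
  apply: (@ge0_integral_dyadic_le R _ _ lebesgue_measure _
    (fun m => `]0, (K / 2 ^+ m)]%classic)
    (fun m => D * (u ^+ m * (2 ^+ m.+1 / K))) (2 * D) u) => //.
  - by rewrite mulr_ge0.
  - by apply/measurable_EFinP.
  - by move=> m; rewrite mulr_ge0// mulr_ge0 ?exprn_ge0// divr_ge0 ?exprn_ge0// ltW.
  - move=> a; have [aK0|/phiE0 ->] := boolP (0 < a < K); last by rewrite eqxx.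
    move=> _; rewrite (phiE1 _ aK0); case/andP: aK0 => a0 aK.
    have [|m /andP[m1 m2]] := @dyadic_ex R (K / a); first by rewrite ler_pdivlMr ?mul1r// ltW.
    have p2 k : (0 : R) < 2 ^+ k by rewrite exprn_gt0.
    exists m; split.
      rewrite /= in_itv/= a0/= ler_pdivlMr// mulrC -ler_pdivlMr//.
    rewrite lee_fin; apply: ler_wpM2l => //; apply: ler_pM.
    + exact: powR_ge0.
    + by rewrite invr_ge0 ltW.
    + have -> : u ^+ m = ((2 ^+ m) `^ e)^-1.
        rewrite /u powRN exprVn; congr (_^-1).
        rewrite -(powR_mulrn m (powR_ge0 2 e)) -(powR_mulrn m (ler0n R 2)).
        by rewrite -[LHS]powRrM -[RHS]powRrM mulrC.
      have -> : (a / K) `^ e = ((K / a) `^ e)^-1.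
        have Ka0 : 0 <= K / a by rewrite divr_ge0// ltW.
        by rewrite -(invf_div K a) -[(K / a)^-1]powR_inv1// -powRrM mulN1r powRN.
      rewrite lef_pV2 ?posrE ?powR_gt0 ?divr_gt0//.
      by apply: ge0_ler_powR; rewrite ?nnegrE ?divr_ge0 ?(ltW a0) ?(ltW K0) ?(ltW e0)// ltW.
    + by rewrite -[leLHS]mul1r ler_pdivrMr// mulrAC ler_pdivlMr// mul1r -ler_pdivrMr// ltW.
  - move=> m; rewrite /= lebesgue_measure_itv/= lte_fin divr_gt0 ?exprn_gt0//.
    rewrite -EFinB -EFinM subr0 lee_fin le_eqVlt; apply/orP; left; apply/eqP.
    by rewrite exprS; field; rewrite !gt_eqF ?exprn_gt0.
have phiE : (\int[lebesgue_measure]_(a in `]0%R, +oo[)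
      ((a%:E * distribution_function g a `^ p^-1) `^ t * (a^-1)%:E) <=
    (2 * D / (1 - u))%:E)%E.
  apply: le_trans phiD; rewrite integral_mkcond.
  apply: ge0_le_integral_any => a _.
    by apply: erestrict_ge0 => b /=; rewrite in_itv/= andbT => b0;
      rewrite mule_ge0 ?poweR_ge0// lee_fin invr_ge0 ltW.
  rewrite patchE; case: ifPn => [|_]; last by rewrite lee_fin phi0.
  rewrite inE/= in_itv/= andbT => a0.
  have [aK|Ka] := ltP a K; last first.
    by rewrite (level0 g K)// poweR0r ?gt_eqF// mule0 poweR0r ?gt_eqF// mul0e lee_fin.
  rewrite phiE1 ?a0// mulrA EFinM; apply: lee_wpmul2r; first by rewrite lee_fin invr_ge0 ltW.
  apply: (@le_trans _ _ ((a * ((K / a) `^ (r / p) * L `^ p^-1))%:E `^ t)%E).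
    apply: gt0_ler_poweR; first exact: ltW.
    - by rewrite in_itv/= leey andbT mule_ge0 ?poweR_ge0// lee_fin ltW.
    - by rewrite in_itv/= leey andbT lee_fin mulr_ge0 ?(ltW a0)// mulr_ge0 ?powR_ge0.
    by rewrite EFinM; apply: lee_wpmul2l; [rewrite lee_fin ltW|exact: level (gL a a0)].
  have Ka0 : 0 < K / a by rewrite divr_gt0.
  rewrite poweR_EFin lee_fin eE (mulrC t) (powRrM (a / K)).
  rewrite -[X in _ <= X](powRM t KL0 (powR_ge0 (a / K) (1 - r / p))).
  rewrite le_eqVlt; apply/orP; left; apply/eqP; congr (_ `^ _).
  rewrite mulrAC mulrA; congr (_ * _).
  have -> : a / K = (K / a) `^ (- 1) by rewrite powR_inv1 ?invf_div// ltW.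
  rewrite -powRrM mulN1r opprB powRD; last by rewrite (gt_eqF Ka0) implybT.
  by rewrite powRN powRr1 ?(ltW Ka0)//; field; rewrite !gt_eqF.
apply: (@le_trans _ _ ((p * (2 * D / (1 - u)))%:E `^ t^-1)%E).
  apply: gt0_ler_poweR; first by rewrite invr_ge0 ltW.
  - rewrite in_itv/= leey andbT mule_ge0 ?lee_fin ?(ltW p0)//.
    apply: integral_ge0 => a; rewrite /= in_itv/= andbT => a0.
    by rewrite mule_ge0 ?poweR_ge0// lee_fin invr_ge0 ltW.
  - rewrite in_itv/= leey andbT lee_fin mulr_ge0 ?(ltW p0)// divr_ge0 ?subr_ge0 ?(ltW u1)//.
    by rewrite mulr_ge0.
  by rewrite EFinM; apply: lee_wpmul2l => //; rewrite lee_fin ltW.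
rewrite poweR_EFin lee_fin (_ : p * _ = C1 * D); last first.
  by rewrite /C1; field; rewrite subr_eq0 gt_eqF.
by rewrite powRM// /D -[(_ `^ t) `^ _]powRrM divff ?gt_eqF// powRr1.
Qed.

Lemma lorentz_norm_ge0 p q g : (0 <= p) -> (0 <= lorentz_norm p q g)%E.
Proof.
move=> p0; case: q => [t||] /=; first exact: poweR_ge0.
  apply: ereal_sup_ge; exists (1%:E * distribution_function g 1 `^ p^-1)%E.
    by exists 1 => //=; rewrite in_itv/= ltr01.
  by rewrite mul1e poweR_ge0.
apply: ereal_sup_ge; exists (1%:E * distribution_function g 1 `^ p^-1)%E.
  by exists 1 => //=; rewrite in_itv/= ltr01.
by rewrite mul1e poweR_ge0.
Qed.

(** The embedding of L^(p,q) into weak L^p: on ]a/2, a] the integrand of the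
    quasi-norm is at least its value at the level a, up to a constant. *)
Lemma weak_le_lorentz_norm (p : R) (q : \bar R) g (a : R) : 1 <= p -> (1 <= q)%E ->
  mfunC g -> 0 < a ->
  (a%:E * distribution_function g a `^ p^-1 <= 4%:E * lorentz_norm p q g)%E.
Proof.
move=> p1 q1 mg a0; have p0 : 0 < p by rewrite (lt_le_trans ltr01).
have N0 := lorentz_norm_ge0 q g (ltW p0).
set m := (distribution_function g a `^ p^-1)%E.
have m0 : (0 <= m)%E by exact: poweR_ge0.
have a20 : 0 < a / 2 by rewrite divr_gt0.
case: q q1 N0 => [t| |//] q1 N0; last first.
  apply: (@le_trans _ _ (lorentz_norm p +oo g)); last by rewrite lee_pemull// lee_fin ler1n.
  by apply: ereal_sup_ubound; exists a => //=; rewrite in_itv/= a0.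
have t1 : 1 <= t by rewrite -lee_fin.
have t0 : 0 < t by rewrite (lt_le_trans ltr01).
pose c := ((((a / 2)%:E * m) `^ t) * (a^-1)%:E)%E.
have am0 : (0 <= (a / 2)%:E * m)%E by rewrite mule_ge0// lee_fin ltW.
have c0 : (0 <= c)%E by rewrite mule_ge0 ?poweR_ge0// lee_fin invr_ge0 ltW.
pose I := `](a / 2), a]%classic : set R.
have mI : measurable I by exact: measurable_itv.
have lowI : (c * (a / 2)%:E <= \int[lebesgue_measure]_(b in `]0%R, +oo[)
      ((b%:E * distribution_function g b `^ p^-1) `^ t * (b^-1)%:E))%E.
  have -> : (c * (a / 2)%:E = \int[lebesgue_measure]_b (c * (\1_I b)%:E))%E.
    rewrite ge0_integralZl//; last 1 first.
    - by apply/measurable_EFinP; exact: measurable_indic.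
    rewrite integral_indic// setIT /I /= lebesgue_measure_itv/= lte_fin ifT; last by lra.
    by rewrite -EFinB; congr (_ * _%:E)%E; lra.
  rewrite [leRHS]integral_mkcond; apply: ge0_le_integral_any => b _.
    by rewrite mule_ge0// lee_fin.
  rewrite patchE indicE; have [bI|bI] := boolP (b \in I); last first.
    rewrite mule0; case: ifPn => // ; rewrite inE/= in_itv/= andbT => b0.
    by rewrite mule_ge0 ?poweR_ge0// lee_fin invr_ge0 ltW.
  move: bI; rewrite inE /I/= in_itv/= => /andP[b1 b2].
  have b0 : 0 < b by exact: lt_trans b1.
  rewrite ifT; last by rewrite inE/= in_itv/= b0.
  rewrite mule1; apply: lee_pmul.
  - exact: poweR_ge0.
  - by rewrite lee_fin invr_ge0 ltW.
  - apply: gt0_ler_poweR; rewrite ?in_itv/= ?leey ?andbT//; first exact: ltW.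
      by rewrite mule_ge0 ?poweR_ge0// lee_fin ltW.
    apply: lee_pmul => //; [by rewrite lee_fin ltW|by rewrite lee_fin ltW|].
    apply: gt0_ler_poweR; rewrite ?in_itv/= ?leey ?andbT ?distribution_function_ge0//.
      by rewrite invr_ge0 ltW.
    exact: distribution_function_le.
  - by rewrite lee_fin lef_pV2.
have cE : (c * (a / 2)%:E = (2^-1)%:E * ((a / 2)%:E * m) `^ t)%E.
  rewrite /c -muleA muleC -EFinM; congr (_%:E * _)%E.
  by field; rewrite gt_eqF.
have low : (((2^-1)%:E * ((a / 2)%:E * m) `^ t) `^ t^-1 <= lorentz_norm p t%:E g)%E.
  rewrite -cE /lorentz_norm; apply: gt0_ler_poweR.
  - by rewrite invr_ge0 ltW.
  - by rewrite in_itv/= leey andbT mule_ge0 ?lee_fin ?(ltW a20).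
  - rewrite in_itv/= leey andbT mule_ge0 ?lee_fin ?(ltW p0)//.
    by apply: le_trans lowI; rewrite mule_ge0 ?lee_fin ?(ltW a20).
  apply: (le_trans lowI); rewrite lee_pemull// ?lee_fin//.
  by apply: le_trans lowI; rewrite mule_ge0 ?lee_fin ?(ltW a20).
have half : ((2^-1)%:E <= (2^-1)%:E `^ t^-1 :> \bar R)%E.
  rewrite poweR_EFin lee_fin; apply: ger1_powR; last by rewrite invf_le1.
  by rewrite invr_gt0 ltr0n/= invf_le1// ler1n.
apply: (@le_trans _ _ (4%:E * ((2^-1)%:E * ((a / 2)%:E * m)))%E).
  rewrite !muleA -!EFinM; apply: lee_wpmul2r => //; rewrite lee_fin; lra.
apply: lee_wpmul2l => //; apply: le_trans low.
rewrite poweRM ?poweR_ge0//.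
rewrite -poweRrM divff ?gt_eqF// poweRe1//.
by apply: lee_wpmul2r.
Qed.

(** Hoelder's inequality between weak L^p and the indicator of a cube Q: the
    levels of |g| below |Q|^(-1/p) W are integrated over Q, those above it
    form a geometric series because p > 1. *)
Lemma weak_integral_cube_le (p : R) : 1 < p ->
  exists C : R, 0 < C /\ forall g (W rho : R) (w : 'rV[R]_n), mfunC g -> 0 < W -> 0 < rho ->
    (forall a : R, 0 < a -> (a%:E * distribution_function g a `^ p^-1 <= W%:E)%E) ->
    (\int[mu]_x (normc (g x) * \1_(cube w rho) x)%:E <=
      (C * (W * ((2 * rho) ^+ n) `^ (1 - p^-1)))%:E)%E.
Proof.
move=> p1; have p0 : 0 < p by rewrite (lt_trans ltr01).
pose u : R := 2 `^ (1 - p).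
have u1 : u < 1 by rewrite powR_lt1 ?ltr1n// subr_lt0.
have u0 : 0 < u by exact: powR_gt0.
pose C0 : R := 2 `^ (p + 1) / u.
have C00 : 0 < C0 by rewrite divr_gt0// powR_gt0.
exists (Num.max 1 C0 / (1 - u)); split.
  by rewrite divr_gt0 ?subr_gt0// lt_max ltr01.
move=> g W rho w mg W0 rho0 gW; set V := (2 * rho) ^+ n.
have V0 : 0 < V by rewrite exprn_gt0// mulr_gt0.
(* The level at which the two bounds A V and A (W / A)^p agree. *)
pose A := W * V `^ (- p^-1).
have A0 : 0 < A by rewrite mulr_gt0// powR_gt0.
have AV : A * V = W * V `^ (1 - p^-1).
  rewrite /A -mulrA; congr (_ * _); rewrite [1 - _]addrC powRD; last by rewrite (gt_eqF V0) implybT.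
  by rewrite powRr1// ltW.
rewrite -AV; set D := A * V; have D0 : 0 < D by rewrite mulr_gt0.
have mucube := lebesgue_rV_cube w (ltW rho0).
have level a : 0 < a -> (distribution_function g a <= ((W / a) `^ p)%:E)%E.
  move=> a0; have h : (distribution_function g a `^ p^-1 <= (W / a)%:E)%E.
    by rewrite mulrC EFinM lee_pdivlMl//; exact: gW.
  have := gt0_ler_poweR (ltW p0) _ _ h; rewrite -poweRrM mulVf ?gt_eqF//.
  rewrite poweRe1 ?distribution_function_ge0// poweR_EFin; apply.
    by rewrite in_itv/= poweR_ge0 leey.
  by rewrite in_itv/= leey andbT lee_fin divr_ge0// ltW.
pose B m := if m is k.+1 then [set x | 2 ^+ k * A / 2 < normc (g x)] else cube w rho.
have p2 k : (0 : R) < 2 ^+ k by rewrite exprn_gt0.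
have -> : (Num.max 1 C0 / (1 - u) * D = Num.max 1 C0 * D / (1 - u)) by rewrite mulrAC.
apply: (@ge0_integral_dyadic_le R _ _ mu _ B (fun m => 2 ^+ m * A)).
- by rewrite mulr_ge0 ?le_max ?ler01// ltW.
- exact: ltW.
- exact: u1.
- apply/measurable_EFinP; apply: measurable_funM; first exact: mfunC_normc.
  by apply: measurable_indic; exact: measurable_cube.
- by move=> x; rewrite lee_fin mulr_ge0 ?normc_ge0.
- by case=> [|k]; [exact: measurable_cube|exact: measurable_level].
- by move=> m; rewrite mulr_ge0 ?exprn_ge0// ltW.
- move=> x; rewrite indicE; have [xc|xc] := boolP (x \in cube w rho); last by rewrite mulr0 eqxx.
  rewrite mulr1 => _; have [gA|gA] := leP (normc (g x)) A.
    by exists 0%N; split; [exact: set_mem|rewrite expr0 mul1r lee_fin].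
  have [|m /andP[m1 m2]] := @dyadic_ex R (normc (g x) / A).
    by rewrite ler_pdivlMr// mul1r ltW.
  exists m.+1; split.
    rewrite /= ltr_pdivrMr//; move: m1; rewrite ler_pdivlMr// => m1.
    have := lt_trans A0 gA; move: (normc _) m1 => N; lra.
  by rewrite lee_fin -ler_pdivrMr// ltW.
case=> [|k].
  rewrite expr0 mul1r /= mucube -EFinM mulr1 lee_fin -/V -/D.
  by rewrite ler_peMl ?(ltW D0)// le_max lexx.
have k0 : 0 < 2 ^+ k * A / 2 by rewrite divr_gt0// mulr_gt0.
have h : (mu (B k.+1) <= ((W / (2 ^+ k * A / 2)) `^ p)%:E)%E by exact: (level _ k0).
apply: (@le_trans _ _ ((2 ^+ k.+1 * A)%:E * ((W / (2 ^+ k * A / 2)) `^ p)%:E)%E).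
  by apply: lee_wpmul2l => //; rewrite lee_fin mulr_ge0 ?(ltW A0)// ltW.
rewrite -EFinM lee_fin.
have -> : W / (2 ^+ k * A / 2) = 2 * (2 ^+ k)^-1 * V `^ p^-1.
  rewrite /A powRN; field; rewrite !gt_eqF ?powR_gt0//.
rewrite powRM ?mulr_ge0 ?invr_ge0 ?powR_ge0 ?(ltW (p2 k))//.
rewrite powRM ?invr_ge0 ?(ltW (p2 k))// -[(V `^ _) `^ _]powRrM mulVf ?gt_eqF// powRr1 ?(ltW V0)//.
have uk : u ^+ k = 2 ^+ k * ((2 ^+ k)^-1) `^ p.
  rewrite /u -powR_mulrn ?powR_ge0// -powRrM mulrBl mul1r powRD; last by rewrite pnatr_eq0 implybT.
  rewrite powR_mulrn//; congr (_ * _).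
  by rewrite -mulrN mulrC powRrM powRN powR_mulrn// powR_inv1//.
rewrite (_ : 2 ^+ k.+1 * A * _ = (2 * 2 `^ p) * (u ^+ k * D)); last first.
  by rewrite uk /D exprS; ring.
rewrite (_ : Num.max 1 C0 * D * u ^+ k.+1 = (Num.max 1 C0 * u) * (u ^+ k * D)); last first.
  by rewrite exprS; ring.
apply: ler_wpM2r; first by rewrite mulr_ge0 ?exprn_ge0 ?ltW.
apply: (@le_trans _ _ (C0 * u)); last by rewrite ler_wpM2r ?(ltW u0)// le_max lexx orbT.
rewrite /C0 divfK ?gt_eqF// powRD; last by rewrite pnatr_eq0 implybT.
by rewrite powRr1// mulrC.
Qed.

(** Duality: if g represents T and eta is supported in a cube Q, Hoelder's
    inequality bounds |T eta| by the norm of g times |eta|_oo |Q|^(1 - 1/p).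
    The bound bears on every representative, hence on their infimum. *)
Lemma lorentz_dnorm_ge (p : R) (q : \bar R) : 1 < p -> (1 <= q)%E ->
  exists c : R, 0 < c /\
  forall (T : ('rV[R]_n -> R[i]) -> R[i]) (eta : 'rV[R]_n -> R[i])
    (w : 'rV[R]_n) (rho M kappa : R),
    schwartz eta -> 0 < rho -> 0 < M -> 0 < kappa ->
    (forall x, normc (eta x) <= M * \1_(cube w rho) x) ->
    kappa <= normc (T eta) ->
    ((c * (kappa / (M * ((2 * rho) ^+ n) `^ (1 - p^-1))))%:E <= lorentz_dnorm p q T)%E.
Proof.
move=> p1 q1; have [C [C0 Cle]] := weak_integral_cube_le p1.
have p0 : 0 < p by rewrite (lt_trans ltr01).
exists (16 * C)^-1; split; first by rewrite invr_gt0 mulr_gt0.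
move=> T eta w rho M kappa seta rho0 M0 kappa0 etaM kT.
apply: le_ereal_inf_tmp => _ [g [mr mi gT] <-]; rewrite leNgt; apply/negP => Nlt.
have mg : mfunC g by split.
have V0 : 0 < ((2 * rho) ^+ n) `^ (1 - p^-1).
  by rewrite powR_gt0// exprn_gt0// mulr_gt0.
set V := ((2 * rho) ^+ n) `^ (1 - p^-1) in V0 Nlt *.
set c := (16 * C)^-1 * _ in Nlt.
have c0 : 0 < c by rewrite /c mulr_gt0 ?invr_gt0 ?divr_gt0 ?mulr_gt0.
have W0 : 0 < 4 * c by rewrite mulr_gt0.
have gW a : 0 < a -> (a%:E * distribution_function g a `^ p^-1 <= (4 * c)%:E)%E.
  move=> a0; apply: (le_trans (weak_le_lorentz_norm (ltW p1) q1 mg a0)).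
  by rewrite EFinM; apply: lee_wpmul2l => //; exact: ltW.
have := Cle g (4 * c) rho w mg W0 rho0 gW; rewrite -/V => gI.
have [itg Teta] := gT eta seta.
have : (kappa%:E <= 2%:E * (M%:E * (C * (4 * c * V))%:E))%E.
  apply: (@le_trans _ _ (normc (T eta))%:E); first by rewrite lee_fin.
  rewrite Teta; apply: (le_trans (intC_norm_le itg)); apply: lee_wpmul2l => //.
  apply: (@le_trans _ _ (M%:E * \int[mu]_x (normc (g x) * \1_(cube w rho) x)%:E)%E); last first.
    by apply: lee_wpmul2l; [rewrite lee_fin ltW|exact: gI].
  rewrite -ge0_integralZl//; last 3 first.
  - apply/measurable_EFinP; apply: measurable_funM; first exact: mfunC_normc.
    by apply: measurable_indic; exact: measurable_cube.
  - by move=> x _; rewrite lee_fin mulr_ge0 ?normc_ge0.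
  - by rewrite lee_fin ltW.
  apply: ge0_le_integral_any => x _; first by rewrite lee_fin normc_ge0.
  rewrite -EFinM lee_fin normcM mulrCA ler_wpM2l ?normc_ge0//.
rewrite -!EFinM lee_fin /c.
rewrite (_ : 2 * _ = kappa / 2); first by lra.
by field; rewrite !gt_eqF.
Qed.

End lorentz_bounds.

(** * Smooth functions and test functions *)

Section smooth_functions.
Variables (R : realType) (n : nat).
Local Notation fct := ('rV[R]_n -> R).
Implicit Types (u v : fct) (w x e : 'rV[R]_n).

Lemma derivable_line (F : fct) x e (f : R -> R) (df : R) :
  (forall h : R, F (h *: e + x) = f h) -> is_derive (0 : R) 1 f df ->
  derivable F x e /\ 'D_e F x = df.
Proof.
move=> Ff [fd fE].
have E : (fun h : R => h^-1 *: ((f \o shift 0) (h *: (1 : R)) - f 0)) =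
    (fun h : R => h^-1 *: ((F \o shift x) (h *: e) - F x)).
  apply/funext => h /=; rewrite addr0 [h *: 1]mulr1 Ff.
  by rewrite -(Ff 0) scale0r add0r.
by split; [rewrite /derivable -E; exact: fd|rewrite -fE /derive E].
Qed.

Lemma continuous_dotp w : continuous (dotp w).
Proof.
have c1 i (x : 'rV[R]_n) : {for x, continuous (fun y : 'rV[R]_n => w ord0 i * y ord0 i)}.
  apply: (@continuous_comp _ _ _ (fun y : 'rV[R]_n => y ord0 i) ( *%R (w ord0 i))).
    exact: coord_continuous.
  exact: mulrl_continuous.
suff H (r : seq 'I_n) (x : 'rV[R]_n) :
    {for x, continuous (fun y : 'rV[R]_n => \sum_(i <- r) w ord0 i * y ord0 i)}.
  by move=> x; exact: H.
elim: r => [|i r IH].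
  rewrite (_ : (fun y : 'rV[R]_n => _) = fun=> 0); first exact: cst_continuous.
  by apply/funext => y; rewrite big_nil.
rewrite (_ : (fun y : 'rV[R]_n => _) = (fun y : 'rV[R]_n => w ord0 i * y ord0 i) \+
    (fun y : 'rV[R]_n => \sum_(i <- r) w ord0 i * y ord0 i)); first exact: (cvgD (c1 i x) IH).
by apply/funext => y; rewrite big_cons.
Qed.

Lemma dotp_line w x i (h : R) :
  dotp w (h *: delta_mx ord0 i + x) = w ord0 i * h + dotp w x.
Proof.
rewrite /dotp (bigD1 i)//= [in RHS](bigD1 i)//= !mxE !eqxx mulr1 mulrDr addrA.
congr (_ + _); apply: eq_bigr => j ji.
by rewrite !mxE eqxx (negbTE ji) mulr0 add0r.
Qed.

(** The functions generated by the smooth functions composed with a dilation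
    and by the trigonometric functions of linear forms; this algebra is stable
    under partial derivatives, hence consists of smooth functions. *)
Inductive smooth_alg : fct -> Prop :=
  | alg_dilation v c of smooth_r v : smooth_alg (fun x => v (c *: x))
  | alg_cos w : smooth_alg (fun x => cos (dotp w x))
  | alg_sin w : smooth_alg (fun x => sin (dotp w x))
  | alg_cst c : smooth_alg (fun=> c)
  | alg_add u v of smooth_alg u & smooth_alg v : smooth_alg (fun x => u x + v x)
  | alg_mul u v of smooth_alg u & smooth_alg v : smooth_alg (fun x => u x * v x).

Lemma smooth_r_derive u i : smooth_r u -> smooth_r ('D_(delta_mx ord0 i) u).
Proof.
move=> su a; have E : partial_r a ('D_(delta_mx ord0 i) u) = partial_r (rcons a i) u.
  by rewrite /partial_r foldr_rcons.
by rewrite E; exact: su.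
Qed.

Lemma smooth_algP u : smooth_alg u -> continuous u /\
  forall i, (forall x, derivable u x (delta_mx ord0 i)) /\
    smooth_alg ('D_(delta_mx ord0 i) u).
Proof.
elim=> {u} [v c sv|w|w|c|u v au [cu du] av [cv dv]|u v au [cu du] av [cv dv]].
- have [cv dv] := sv [::]; split.
    move=> x; apply: (@continuous_comp _ _ _ (fun y : 'rV[R]_n => c *: y) v); last exact: cv.
    exact: scaler_continuous.
  move=> i; set e := delta_mx ord0 i.
  have key x : derivable (fun y => v (c *: y)) x e /\
      'D_e (fun y => v (c *: y)) x = c * 'D_e v (c *: x).
    pose g (s : R) := v (s *: e + c *: x).
    have dg : is_derive (c * 0) 1 g ('D_e v (c *: x)).
      rewrite mulr0.
      have E : (fun h : R => h^-1 *: ((g \o shift 0) (h *: (1 : R)) - g 0)) =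
          (fun h : R => h^-1 *: ((v \o shift (c *: x)) (h *: e) - v (c *: x))).
        by apply/funext => h /=; rewrite addr0 [h *: 1]mulr1 /g scale0r add0r.
      by split; [rewrite /derivable E; exact: dv|rewrite /derive E].
    apply: (@derivable_line _ _ _ (fun h => g (c * h))).
      by move=> h; rewrite /g scalerDr scalerA.
    have dc : is_derive (0 : R) 1 (fun h : R => c * h) c.
      by apply: is_derive_eq; rewrite ?scaler0 ?addr0 [c *: 1]mulr1.
    have := @is_derive1_comp R g (fun h : R => c * h) 0 ('D_e v (c *: x)) c dg dc.
    by rewrite [X in is_derive _ _ _ X]mulrC.
  split; first by move=> x; exact: (key x).1.
  rewrite (_ : 'D_e _ = fun x => c * ('D_e v) (c *: x)); last first.
    by apply/funext => x; exact: (key x).2.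
  apply: alg_mul; first exact: alg_cst.
  by apply: (@alg_dilation ('D_e v)); exact: smooth_r_derive.
- split.
    by move=> x; apply: continuous_comp; [exact: continuous_dotp|exact: continuous_cos].
  move=> i; set e := delta_mx ord0 i.
  have key x : derivable (fun y => cos (dotp w y)) x e /\
      'D_e (fun y => cos (dotp w y)) x = - w ord0 i * sin (dotp w x).
    apply: (@derivable_line _ _ _ (fun h => cos (w ord0 i * h + dotp w x))).
      by move=> h; rewrite dotp_line.
    apply: is_derive_eq.
    by rewrite mulr0 add0r addr0 [_%:A]mulr1 mulrC mulrN mulNr.
  split; first by move=> x; exact: (key x).1.
  rewrite (_ : 'D_e _ = fun x => - w ord0 i * sin (dotp w x)); last first.
    by apply/funext => x; exact: (key x).2.
  by apply: alg_mul; [exact: alg_cst|exact: alg_sin].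
- split.
    by move=> x; apply: continuous_comp; [exact: continuous_dotp|exact: continuous_sin].
  move=> i; set e := delta_mx ord0 i.
  have key x : derivable (fun y => sin (dotp w y)) x e /\
      'D_e (fun y => sin (dotp w y)) x = w ord0 i * cos (dotp w x).
    apply: (@derivable_line _ _ _ (fun h => sin (w ord0 i * h + dotp w x))).
      by move=> h; rewrite dotp_line.
    apply: is_derive_eq.
    by rewrite mulr0 add0r addr0 [_%:A]mulr1 mulrC.
  split; first by move=> x; exact: (key x).1.
  rewrite (_ : 'D_e _ = fun x => w ord0 i * cos (dotp w x)); last first.
    by apply/funext => x; exact: (key x).2.
  by apply: alg_mul; [exact: alg_cst|exact: alg_cos].
- split; first by move=> x; exact: cst_continuous.
  move=> i; split; first by move=> x; exact: derivable_cst.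
  rewrite (_ : 'D_ _ _ = cst 0); first exact: alg_cst.
  by apply/funext => x; rewrite derive_cst.
- split; first by move=> x; apply: continuousD; [exact: cu|exact: cv].
  move=> i; have [du1 du2] := du i; have [dv1 dv2] := dv i.
  split; first by move=> x; apply: derivableD.
  rewrite (_ : 'D_ _ _ = fun x => 'D_(delta_mx ord0 i) u x + 'D_(delta_mx ord0 i) v x).
    exact: alg_add.
  by apply/funext => x; rewrite (@deriveD _ _ _ u v).
- split; first by move=> x; apply: continuousM; [exact: cu|exact: cv].
  move=> i; have [du1 du2] := du i; have [dv1 dv2] := dv i.
  split; first by move=> x; apply: derivableM.
  rewrite (_ : 'D_ _ _ = fun x => u x * 'D_(delta_mx ord0 i) v x
      + v x * 'D_(delta_mx ord0 i) u x).
    by apply: alg_add; exact: alg_mul.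
  by apply/funext => x; rewrite (@deriveM _ _ u v).
Qed.

Lemma smooth_alg_smooth u : smooth_alg u -> smooth_r u.
Proof.
move=> au a; have aau : smooth_alg (partial_r a u).
  by elim: a => //= i a IH; have [_ /(_ i)[]] := smooth_algP IH.
by have [ca da] := smooth_algP aau; split => // i x; exact: (da i).1.
Qed.

End smooth_functions.

Section compact_support.
Variables (R : realType) (n : nat).

(** The complement of a closed cube is open, so that a function vanishing there
    has vanishing derivatives there. *)
Lemma partial_r_eq0 (rho : R) (u : 'rV[R]_n -> R) a :
  (forall x, ~ cube 0 rho x -> u x = 0) ->
  forall x, ~ cube 0 rho x -> partial_r a u x = 0.
Proof.
move=> u0; elim: a => [|i a IH] //= x xc.
rewrite -(@derive_cst _ 'rV[R]_n R 0 x (delta_mx ord0 i)).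
apply: near_eq_derive.
have [j xj] : exists j, rho < `|x ord0 j|.
  apply: contrapT => /forallNP h; apply: xc => j.
  by rewrite mxE subr0 leNgt; apply/negP/h.
have e0 : 0 < `|x ord0 j| - rho by rewrite subr_gt0.
apply: filterS (nbhsx_ballx x _ e0) => y xy; apply: IH => /(_ j).
have [_ /(_ ord0 j)] := xy; rewrite /ball/= mxE subr0 => xyj yj.
suff : `|x ord0 j| <= rho + `|x ord0 j - y ord0 j| by lra.
have := ler_normD (y ord0 j) (x ord0 j - y ord0 j); rewrite addrC subrK.
by lra.
Qed.

Lemma continuous_cube_bounded (rho : R) (u : 'rV[R]_n -> R) :
  continuous u -> exists M : R, forall x, cube 0 rho x -> `|u x| <= M.
Proof.
move=> cu.
have kc : compact (cube 0 rho : set 'rV[R]_n).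
  rewrite (_ : cube _ _ = [set v : 'rV[R]_n | forall i, v ord0 i \in `[- rho, rho]]).
    apply: (@rV_compact _ _ (fun=> `[- rho, rho]%classic)).
    by move=> _; exact: segment_compact.
  apply/seteqP; split => v /= h i; have := h i; rewrite /= !mxE subr0 in_itv/= ler_norml//.
have [M [Mr hM]] := compact_bounded (continuous_compact (continuous_subspaceT cu) kc).
exists (M + 1) => x xc; apply: (hM (M + 1)); first by rewrite ltrDl.
by exists x.
Qed.

Lemma schwartz_compact_support (rho : R) (f : 'rV[R]_n -> R[i]) : 0 <= rho ->
  smooth f -> (forall x, ~ cube 0 rho x -> f x = 0) -> schwartz f.
Proof.
move=> rho0 [sr si] f0; split => // k a.
have [M1 h1] := continuous_cube_bounded rho (sr a).1.
have [M2 h2] := continuous_cube_bounded rho (si a).1.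
have z1 := @partial_r_eq0 rho (reF f) a (fun x xc => congr1 (@complex.Re R) (f0 x xc)).
have z2 := @partial_r_eq0 rho (imF f) a (fun x xc => congr1 (@complex.Im R) (f0 x xc)).
exists ((1 + Num.sqrt (n%:R * rho ^+ 2)) ^+ k * (`|M1| + `|M2|)) => x.
have [xc|xc] := pselect (cube 0 rho x); last first.
  rewrite /partial z1// z2// [normc _](_ : _ = 0) ?mulr0; last first.
    by rewrite -[RHS](@ComplexField.Normc.normc0 R).
  by rewrite mulr_ge0// ?addr_ge0// exprn_ge0// addr_ge0// sqrtr_ge0.
apply: ler_pM; rewrite ?exprn_ge0 ?addr_ge0 ?sqrtr_ge0 ?normc_ge0//.
  rewrite lerXn2r ?nnegrE ?addr_ge0 ?sqrtr_ge0// lerD2l.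
  rewrite ler_wsqrtr// /dotp -[X in _ <= X%:R * _]card_ord -sum1_card natr_sum mulr_suml.
  apply: ler_sum => i _; rewrite mul1r -expr2 -real_normK ?num_real//.
  by rewrite lerXn2r ?nnegrE//; have := xc i; rewrite !mxE subr0.
apply: (le_trans (normc_le_ReIm _)); rewrite /= lerD//.
  by rewrite (le_trans (h1 x xc))// ler_norm.
by rewrite (le_trans (h2 x xc))// ler_norm.
Qed.

End compact_support.

(** * Distributions given by integrable functions *)

Section oscillatory_integrals.
Variables (R : realType) (n : nat).
Local Notation mu := (@lebesgue_rV R n).
Implicit Types (f u v phi : 'rV[R]_n -> R[i]) (x y : 'rV[R]_n).

Lemma dotpC x y : dotp x y = dotp y x.
Proof. by apply: eq_bigr => i _; rewrite mulrC. Qed.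

(** Both Fourier transforms at once, for c = 2 pi and c = - 2 pi. *)
Definition osc (c : R) f : 'rV[R]_n -> R[i] :=
  fun x => intC mu (fun y => cis (c * dotp x y) * f y).

Lemma fourier_invE f : fourier_inv f = osc (2 * pi) f.
Proof. by []. Qed.

Lemma fourierE f : fourier f = osc (- (2 * pi)) f.
Proof.
apply/funext => x; congr (intC mu _); apply/funext => y.
by rewrite dotpC mulNr.
Qed.

Lemma mfunC_osc_kernel c f : mfunC f ->
  mfunC (fun z : 'rV[R]_n * 'rV[R]_n => cis (c * dotp z.1 z.2) * f z.2).
Proof.
move=> mf; apply: mfunCM.
  apply: mfunC_cis; apply: measurable_funM; first exact: measurable_cst.
  exact: measurable_dotp.
exact: (mfunC_comp measurable_snd mf).
Qed.

Lemma measurable_Rintegral_param (h : 'rV[R]_n * 'rV[R]_n -> R) :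
  measurable_fun setT h ->
  measurable_fun setT (fun x => \int[mu]_y h (x, y)).
Proof.
move=> mh; have meh : measurable_fun setT (fun z => (h z)%:E) by exact/measurable_EFinP.
rewrite /Rintegral; apply: measurableT_comp => //.
have -> : (fun x => \int[mu]_y (h (x, y))%:E)%E =
    (fun x => \int[mu]_y (fun z => (h z)%:E)^\+ (x, y) -
              \int[mu]_y (fun z => (h z)%:E)^\- (x, y))%E.
  by apply/funext => x; rewrite [LHS]integralE !unlock.
apply: emeasurable_funB.
  apply: (@measurable_fun_fubini_tonelli_F _ _ _ _ _ mu (fun z => (h z)%:E)^\+%E) => //.
  exact: measurable_funepos.
apply: (@measurable_fun_fubini_tonelli_F _ _ _ _ _ mu (fun z => (h z)%:E)^\-%E) => //.
exact: measurable_funeneg.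
Qed.

Lemma mfunC_osc c f : mfunC f -> mfunC (osc c f).
Proof.
move=> mf; have [mr mi] := mfunC_osc_kernel c mf.
by split; [exact: (measurable_Rintegral_param mr)|exact: (measurable_Rintegral_param mi)].
Qed.

Lemma osc_bounded c f : itgC mu f -> exists M : R, forall x, normc (osc c f x) <= M.
Proof.
move=> fi; exists (2 * fine (\int[mu]_y (normc (f y))%:E)) => x.
rewrite -lee_fin EFinM fineK; last exact: (integrable_fin_num measurableT (itgC_normc fi)).
apply: (le_trans (intC_norm_le (itgC_cis c x fi))).
by under eq_integral => y _ do rewrite normcM normc_cis mul1r.
Qed.

(** Fubini's theorem: Fourier transforms move from the test function to the
    integrable function that defines a distribution, and back. *)
Lemma osc_exchange c u v : itgC mu u -> itgC mu v ->
  intC mu (fun x => u x * osc c v x) = intC mu (fun y => v y * osc c u y).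
Proof.
move=> ui vi.
pose k (z : 'rV[R]_n * 'rV[R]_n) := u z.1 * (cis (c * dotp z.1 z.2) * v z.2).
have mk : mfunC k.
  apply: mfunCM; first exact: (mfunC_comp measurable_fst (itgC_mfunC ui)).
  exact: mfunC_osc_kernel (itgC_mfunC vi).
have k1 x : itgC mu (fun y => k (x, y)).
  by apply: (@itgCZ _ _ _ _ (u x)); exact: itgC_cis.
have kE x y : k (x, y) = v y * (cis (c * dotp y x) * u x).
  by rewrite /k dotpC /=; ring.
have k2 y : itgC mu (fun x => k (x, y)).
  have -> : (fun x => k (x, y)) = (fun x => v y * (cis (c * dotp y x) * u x)).
    by apply/funext => x; exact: kE.
  by apply: itgCZ; exact: itgC_cis.
have ik : itgC (mu \x mu)%E k.
  apply: itgC_lty => //.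
  rewrite (@fubini_tonelli1 _ _ _ _ _ mu mu (fun z => (normc (k z))%:E)) /fubini_F; last 2 first.
  - exact/measurable_EFinP/mfunC_normc.
  - by move=> z; rewrite lee_fin normc_ge0.
  have mnv : measurable_fun setT (fun y => (normc (v y))%:E).
    exact/measurable_EFinP/mfunC_normc/(itgC_mfunC vi).
  have mnu : measurable_fun setT (fun y => (normc (u y))%:E).
    exact/measurable_EFinP/mfunC_normc/(itgC_mfunC ui).
  have iv := integrable_fin_num measurableT (itgC_normc vi).
  have iu := integrable_fin_num measurableT (itgC_normc ui).
  have -> : (fun x => \int[mu]_y (normc (k (x, y)))%:E)%E =
      (fun x => (fine (\int[mu]_y (normc (v y))%:E))%:E * (normc (u x))%:E)%E.
    apply/funext => x; rewrite fineK// muleC.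
    transitivity (\int[mu]_y ((normc (u x))%:E * (normc (v y))%:E))%E.
      by apply: eq_integral => y _; rewrite /k !normcM normc_cis mul1r EFinM.
    by apply: (ge0_integralZl _ measurableT mnv); rewrite ?lee_fin ?normc_ge0// => y _; rewrite lee_fin normc_ge0.
  have -> : (\int[mu]_x ((fine (\int[mu]_y (normc (v y))%:E))%:E * (normc (u x))%:E) =
      (fine (\int[mu]_y (normc (v y))%:E))%:E * \int[mu]_x (normc (u x))%:E)%E.
    apply: (ge0_integralZl _ measurableT mnu).
      by move=> x _; rewrite lee_fin normc_ge0.
    by rewrite lee_fin fine_ge0// integral_ge0// => y _; rewrite lee_fin normc_ge0.
  by rewrite -(fineK iu) -EFinM ltry.
have E1 : (fun x => intC mu (fun y => k (x, y))) = (fun x => u x * osc c v x).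
  by apply/funext => x; exact: (@intCZ _ _ _ mu (u x) _ (itgC_cis c x vi)).
have E2 : (fun y => intC mu (fun x => k (x, y))) = (fun y => v y * osc c u y).
  apply/funext => y; have -> : (fun x => k (x, y)) = (fun x => v y * (cis (c * dotp y x) * u x)).
    by apply/funext => x; exact: kE.
  exact: (@intCZ _ _ _ mu (v y) _ (itgC_cis c y ui)).
by rewrite -E1 -E2; exact: intC_fubini.
Qed.

End oscillatory_integrals.

Section schwartz_functions.
Variables (R : realType) (n : nat).
Local Notation mu := (@lebesgue_rV R n).
Implicit Types (phi f : 'rV[R]_n -> R[i]) (x : 'rV[R]_n).

Lemma normr_coord_le_enorm x i : `|x ord0 i| <= enorm x.
Proof.
rewrite -sqrtr_sqr ler_wsqrtr// /dotp (bigD1 i)//= -expr2 lerDl.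
by apply: sumr_ge0 => j _; rewrite -expr2 sqr_ge0.
Qed.

Lemma enorm_ge0 x : 0 <= enorm x. Proof. exact: sqrtr_ge0. Qed.

Lemma schwartz_mfunC phi : schwartz phi -> mfunC phi.
Proof.
by move=> [[sr si] _]; split; apply: continuous_measurable_rV;
  [exact: (sr [::]).1|exact: (si [::]).1].
Qed.

Lemma partial_nil phi x : partial [::] phi x = phi x.
Proof. by rewrite /partial /= /reF /imF; case: (phi x). Qed.

Lemma wt_prod_enorm x : ((1 + enorm x) ^+ (2 * n))^-1 <= \prod_i wt 2 (x ord0 i).
Proof.
have e0 := enorm_ge0 x.
rewrite exprM -exprVn.
rewrite (_ : _ ^+ n = \prod_(i < n) ((1 + enorm x) ^+ 2)^-1); last by rewrite prodr_const card_ord.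
apply: ler_prod => i _; rewrite invr_ge0 exprn_ge0 ?addr_ge0//=.
rewrite /wt powRN powR_mulrn ?le_max ?ler01// lef_pV2 ?posrE ?exprn_gt0 ?lt_max ?ltr01 ?ltr_pwDl//.
rewrite lerXn2r ?nnegrE ?addr_ge0 ?le_max ?ler01// ge_max lerDl e0/=.
by rewrite (le_trans (normr_coord_le_enorm x i))// lerDr.
Qed.

Lemma wt_prod_ge0 r x : 0 <= \prod_i wt r (x ord0 i).
Proof. by apply: prodr_ge0 => i _; exact: wt_ge0. Qed.

Lemma measurable_wt_prod r : measurable_fun setT (fun x => \prod_i wt r (x ord0 i)).
Proof.
apply: measurable_prod => i _.
exact: (measurableT_comp (measurable_wt r) (measurable_coord i)).
Qed.

Lemma integral_wt_prod (r lam : R) : 1 < r -> 0 < lam ->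
  (\int[mu]_x (\prod_i wt r (lam * x ord0 i))%:E = ((lam^-1 * wt_mass r) ^+ n)%:E)%E.
Proof.
move=> r1 lam0; rewrite (ge0_integral_rV_prod (f := fun _ t => wt r (lam * t))
    (c := fun=> lam^-1 * wt_mass r)).
- by rewrite prodr_const card_ord.
- move=> i; apply: (measurableT_comp (measurable_wt r)).
  exact: mulrl_measurable.
- by move=> i t; exact: wt_ge0.
- by move=> i; exact: integral_wt_dilation.
Qed.

Lemma itgC_wt_prod f M : mfunC f ->
  (forall x, normc (f x) <= M * \prod_i wt 2 (x ord0 i)) -> itgC mu f.
Proof.
move=> mf fM.
have iw : mu.-integrable setT (EFin \o fun x => \prod_i wt 2 (x ord0 i)).
  apply/integrableP; split; first by apply/measurable_EFinP; exact: (measurable_wt_prod 2).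
  have := @integral_wt_prod 2 1 _ ltr01; rewrite ltr1n => /(_ isT) E.
  apply: (@le_lt_trans _ _ (\int[mu]_x (\prod_i wt 2 (1 * x ord0 i))%:E)%E).
    by apply: ge0_le_integral_any => // x _; rewrite gee0_abs ?lee_fin ?wt_prod_ge0//;
      apply: ler_prod => i _; rewrite mul1r wt_ge0/=.
  by rewrite E ltry.
exact: (le_itgC mf (integrableZl measurableT M iw) fM).
Qed.

Lemma schwartz_bounded phi : schwartz phi -> exists M, forall x, normc (phi x) <= M.
Proof.
move=> [_ /(_ 0%N [::])[M h]]; exists M => x.
by have := h x; rewrite expr0 mul1r partial_nil.
Qed.

Lemma schwartz_itgC phi : schwartz phi -> itgC mu phi.
Proof.
move=> sphi; have [_ /(_ (2 * n)%N [::])[M h]] := sphi.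
apply: (@itgC_wt_prod _ M); first exact: schwartz_mfunC.
move=> x; have e0 : 0 < (1 + enorm x) ^+ (2 * n).
  by rewrite exprn_gt0// ltr_pwDl// enorm_ge0.
have := h x; rewrite partial_nil mulrC -ler_pdivlMr// => /le_trans; apply.
rewrite ler_wpM2l ?wt_prod_enorm//.
by rewrite (le_trans _ (h 0))// mulr_ge0 ?normc_ge0// exprn_ge0// addr_ge0// enorm_ge0.
Qed.

End schwartz_functions.

(** * Dyadic resolutions of unity *)

Section dyadic_resolution_theory.
Variables (R : realType) (n : nat) (psi : nat -> 'rV[R]_n -> R[i]).
Hypothesis hpsi : dyadic_resolution psi.
Local Notation mu := (@lebesgue_rV R n).
Implicit Types (xi : 'rV[R]_n).

Lemma psi_hi j xi : 2 ^+ j.+1 < enorm xi -> psi j xi = 0.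
Proof.
move=> h; apply/eqP; apply: contraTT h => pj; rewrite -leNgt.
have [_ s0 sS _ _] := hpsi.
have ps : fsupport (psi j) xi by apply: subset_closure.
by case: j pj ps => [_ /s0//|j _ ps]; have /andP[] := sS j.+1 isT _ ps.
Qed.

Lemma psi_lo j xi : (0 < j)%N -> enorm xi < 2 ^+ j.-1 -> psi j xi = 0.
Proof.
move=> j0 h; apply/eqP; apply: contraTT h => pj; rewrite -leNgt.
have [_ _ sS _ _] := hpsi.
have ps : fsupport (psi j) xi by apply: subset_closure.
by have /andP[] := sS j j0 _ ps.
Qed.

(** At a given frequency only finitely many terms of the resolution are non-zero,
    so that the limit is attained. *)
Lemma psi_sum N xi : enorm xi < 2 ^+ N -> \sum_(j < N.+1) psi j xi = 1.
Proof.
move=> h; have [_ _ _ _ /(_ xi) lim1] := hpsi.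
have tail M : (N < M)%N -> \sum_(j < M) psi j xi = \sum_(j < N.+1) psi j xi.
  elim: M => // M IH; rewrite ltnS leq_eqVlt => /predU1P[->//|NM].
  rewrite big_ord_recr IH//= (@psi_lo M) ?addr0 ?(leq_ltn_trans _ NM)//.
  apply: (lt_le_trans h); rewrite ler_weXn2l ?ler1n//.
  by case: M NM {IH}.
have c : normc (\sum_(j < M) psi j xi - 1) @[M --> \oo] -->
    normc (\sum_(j < N.+1) psi j xi - 1).
  apply: cvg_near_cst; near=> M; rewrite tail//.
  by near: M; exists N.+1.
have E : normc (\sum_(j < N.+1) psi j xi - 1) = 0.
  by apply: (cvg_unique _ c lim1); exact: norm_hausdorff.
by apply/eqP; rewrite -subr_eq0; apply/eqP; exact: ComplexField.Normc.eq0_normc E.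
Unshelve. all: by end_near. Qed.

Lemma psi0_eq1 xi : enorm xi < 1 -> psi 0 xi = 1.
Proof. by move=> h; have := @psi_sum 0 xi h; rewrite big_ord_recl big_ord0 addr0. Qed.

Lemma psi_pair i xi : 2 ^+ (2 * i) < enorm xi -> enorm xi < 2 ^+ (2 * i).+1 ->
  psi (2 * i) xi + psi (2 * i).+1 xi = 1.
Proof.
move=> h1 h2; rewrite -(psi_sum h2) big_ord_recr/= big_ord_recr/= big1 ?add0r// => j _.
by apply: psi_hi; apply: le_lt_trans h1; rewrite ler_weXn2l ?ler1n.
Qed.

Lemma psi_schwartz j : schwartz (psi j).
Proof.
have [tf _ _ _ _] := hpsi; apply: (@schwartz_compact_support _ _ (2 ^+ j.+1)) (tf j).1 _ => //.
move=> xi xc; apply: psi_hi; rewrite ltNge; apply/negP => h; apply: xc => l.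
by rewrite mxE subr0 (le_trans (normr_coord_le_enorm xi l)).
Qed.

Lemma psi_bounds N : exists M : R, 0 <= M /\
  forall (a : seq 'I_n), (size a <= N)%N -> forall j xi,
    2 ^+ (j * size a) * normc (partial a (psi j) xi) <= M.
Proof.
have [_ _ _ B _] := hpsi.
elim: N => [|N [M [M0 IH]]].
  have [M hM] := B [::]; exists (Num.max 0 M); split; first by rewrite le_max lexx.
  by move=> a; rewrite leqn0 => /nilP-> j xi; rewrite le_max hM orbT.
have [b hb] := choice (fun t : N.+1.-tuple 'I_n => B t).
exists (M + \sum_t `|b t|); split; first by rewrite addr_ge0// sumr_ge0.
move=> a; rewrite leq_eqVlt => /predU1P[sa|sa] j xi; last first.
  by rewrite (le_trans (IH a _ j xi))// lerDl sumr_ge0.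
have := hb (tcast sa (in_tuple a)) j xi; rewrite val_tcast => /le_trans; apply.
rewrite (le_trans (ler_norm _))// (bigD1 (tcast sa (in_tuple a)))//= addrCA lerDl.
by rewrite addr_ge0// sumr_ge0.
Qed.

(** The Littlewood-Paley blocks of a function, by two exchanges of the order of
    integration. *)
Lemma lp_block_fun (F : 'rV[R]_n -> R[i]) k (phi : 'rV[R]_n -> R[i]) : itgC mu F -> schwartz phi ->
  let m xi := psi k xi * fourier F xi in
  [/\ lp_block psi k (fun f => intC mu (fun x => F x * f x)) phi =
        intC mu (fun xi => m xi * fourier_inv phi xi),
      itgC mu (fun x => fourier_inv m x * phi x),
      itgC mu (fun xi => m xi * fourier_inv phi xi) &
      intC mu (fun xi => m xi * fourier_inv phi xi) =
        intC mu (fun x => fourier_inv m x * phi x)].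
Proof.
move=> Fi sphi m; have phii := schwartz_itgC sphi.
have psii := schwartz_itgC (psi_schwartz k).
have mi : itgC mu m.
  have [M hM] := osc_bounded (- (2 * pi)) Fi.
  have -> : m = fun xi => osc (- (2 * pi)) F xi * psi k xi.
    by apply/funext => xi; rewrite /m fourierE mulrC.
  by apply: (itgC_bounded_mul _ hM) => //; apply: mfunC_osc; exact: itgC_mfunC Fi.
have pi' : itgC mu (fun xi => psi k xi * osc (2 * pi) phi xi).
  have [M hM] := osc_bounded (2 * pi) phii.
  have -> : (fun xi => psi k xi * osc (2 * pi) phi xi) =
      fun xi => osc (2 * pi) phi xi * psi k xi by apply/funext => xi; rewrite mulrC.
  by apply: (itgC_bounded_mul _ hM) => //; apply: mfunC_osc; exact: itgC_mfunC phii.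
split.
- rewrite /lp_block /dfourier_inv /dmul /dfourier fourierE fourier_invE.
  apply: (etrans (osc_exchange (- (2 * pi)) Fi pi')).
  by congr intC; apply/funext => xi; rewrite /m fourierE; ring.
- have [M hM] := osc_bounded (2 * pi) mi; rewrite fourier_invE.
  by apply: (itgC_bounded_mul _ hM) => //; apply: mfunC_osc; exact: itgC_mfunC mi.
- have [M hM] := osc_bounded (2 * pi) phii; rewrite fourier_invE.
  have -> : (fun xi => m xi * osc (2 * pi) phi xi) = fun xi => osc (2 * pi) phi xi * m xi.
    by apply/funext => xi; rewrite mulrC.
  by apply: (itgC_bounded_mul _ hM) => //; apply: mfunC_osc; exact: itgC_mfunC phii.
- rewrite !fourier_invE; apply: (etrans (osc_exchange (2 * pi) mi phii)).
  by congr intC; apply/funext => xi; rewrite mulrC.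
Qed.

Lemma represents_lp_block (F : 'rV[R]_n -> R[i]) k : itgC mu F ->
  represents (fourier_inv (fun xi => psi k xi * fourier F xi))
    (lp_block psi k (fun f => intC mu (fun x => F x * f x))).
Proof.
move=> Fi; set g := fourier_inv _.
have [mr mi] : mfunC g.
  rewrite /g fourier_invE; apply: mfunC_osc; apply: mfunCM.
    exact/schwartz_mfunC/psi_schwartz.
  by rewrite fourierE; apply: mfunC_osc; exact: itgC_mfunC Fi.
split=> // phi sphi; have [e1 e2 _ e3] := lp_block_fun k Fi sphi.
by split; [exact: e2|rewrite e1 e3].
Qed.

(** Pairing with an integrable function is continuous already for the sup norm. *)
Lemma tempered_fun (F : 'rV[R]_n -> R[i]) : itgC mu F ->
  tempered (fun f => intC mu (fun x => F x * f x)).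
Proof.
move=> Fi; have Ff f : schwartz f -> itgC mu (fun x => F x * f x).
  move=> sf; have [M hM] := schwartz_bounded sf.
  have -> : (fun x => F x * f x) = fun x => f x * F x by apply/funext => x; rewrite mulrC.
  by apply: (itgC_bounded_mul _ hM) => //; exact: schwartz_mfunC.
split=> [c f g sf sg|f sf e e0].
  have -> : (fun x => F x * (c * f x + g x)) = fun x => c * (F x * f x) + F x * g x.
    by apply/funext => x; ring.
  by rewrite intCD ?intCZ//; [exact: Ff|apply: itgCZ; exact: Ff|exact: Ff].
pose S := fine (\int[mu]_x (normc (F x))%:E).
have SE : (\int[mu]_x (normc (F x))%:E = S%:E)%E.
  by rewrite fineK//; exact: (integrable_fin_num measurableT (itgC_normc Fi)).
have S0 : 0 <= S by rewrite fine_ge0// integral_ge0// => y _; rewrite lee_fin normc_ge0.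
pose d := e / (2 * S + 1).
have d0 : 0 < d by rewrite divr_gt0// ltr_wpDl// mulr_ge0.
exists 0%N, d; split => // g sg gf.
have gfd x : normc (g x - f x) <= d.
  by have := gf 0%N [::] isT isT x; rewrite expr0 mul1r partial_nil => /ltW.
have -> : intC mu (fun x => F x * g x) - intC mu (fun x => F x * f x) =
    intC mu (fun x => F x * (g x - f x)).
  rewrite -intCN -?intCD; [|exact: Ff|apply: itgCN; exact: Ff|exact: Ff].
  by congr intC; apply/funext => x; ring.
have i1 : itgC mu (fun x => F x * (g x - f x)).
  have -> : (fun x => F x * (g x - f x)) = fun x => F x * g x + - (F x * f x).
    by apply/funext => x; ring.
  by apply: itgCD; [exact: Ff|apply: itgCN; exact: Ff].
rewrite -lte_fin; apply: (le_lt_trans (intC_norm_le i1)).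
apply: (@le_lt_trans _ _ (2%:E * (d%:E * \int[mu]_x (normc (F x))%:E))%E).
  apply: lee_wpmul2l => //.
  rewrite -ge0_integralZl ?lee_fin ?(ltW d0)//; last 2 first.
  - by apply/measurable_EFinP; exact: (mfunC_normc (itgC_mfunC Fi)).
  - by move=> x _; rewrite lee_fin normc_ge0.
  apply: ge0_le_integral_any => x _; first by rewrite lee_fin normc_ge0.
  by rewrite -EFinM lee_fin normcM mulrC ler_wpM2r ?normc_ge0.
rewrite SE -!EFinM lte_fin /d.
have z0 : 0 < 2 * S + 1 by lra.
rewrite (_ : 2 * _ = e * (2 * S / (2 * S + 1))); last by field; rewrite gt_eqF.
by rewrite gtr_pMr// ltr_pdivrMr// mul1r ltrDl.
Qed.

End dyadic_resolution_theory.

(** * Wave packets *)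

Section packets.
Variables (R : realType) (n : nat).
Local Notation mu := (@lebesgue_rV R n).
Implicit Types (w x xi : 'rV[R]_n).

Definition tent (lam : R) w xi : R := \prod_l tri ((xi ord0 l - w ord0 l) / lam).

(** Both this function and its Fourier transform are explicit, so that the packet
    is known on both sides without an inversion theorem. *)
Definition packet (lam : R) w x : R[i] :=
  \prod_l (cis (2 * pi * (x ord0 l * w ord0 l)) * (sinc2 lam (x ord0 l))%:C).

Lemma itgC_packet lam w : 0 < lam -> itgC mu (packet lam w).
Proof.
move=> lam0; apply: (@itgC_rV_prod _ _
  (fun l t => cis (2 * pi * (t * w ord0 l)) * (sinc2 lam t)%:C)) => l.
have := (@fourier_sinc2 R lam (- w ord0 l) lam0).1.
by under [X in itgC _ X -> _]eq_fun do rewrite mulrN mulrN opprK.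
Qed.

Lemma fourier_packet lam w xi : 0 < lam ->
  fourier (packet lam w) xi = ((lam^-1) ^+ n * tent lam w xi)%:C.
Proof.
move=> lam0.
pose f (l : 'I_n) (t : R) := cis (- (2 * pi * (t * (xi ord0 l - w ord0 l)))) * (sinc2 lam t)%:C.
have fE x : cis (- (2 * pi * dotp x xi)) * packet lam w x = \prod_l f l (x ord0 l).
  rewrite /packet /f /dotp mulr_sumr -sumrN.
  rewrite (big_morph (@cis R) (@cisD R) (@cis0 R)) -big_split/=; apply: eq_bigr => l _.
  by rewrite [LHS]mulrA -cisD; congr (cis _ * _); ring.
have -> : fourier (packet lam w) xi = intC mu (fun x => \prod_l f l (x ord0 l)).
  by congr (intC mu _); apply/funext => x; exact: fE.
rewrite intC_rV_prod => [|l]; last exact: (@fourier_sinc2 R lam _ lam0).1.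
under eq_bigr => l _ do rewrite (@fourier_sinc2 R lam _ lam0).2.
rewrite -(rmorph_prod (real_complex R)); congr (_%:C).
by rewrite big_split/= prodr_const card_ord.
Qed.

Lemma tent_ge0 lam w xi : 0 <= tent lam w xi.
Proof. by apply: prodr_ge0 => l _; exact: tri_ge0. Qed.

Lemma tent_neq0 lam w xi l : 0 < lam -> tent lam w xi != 0 ->
  `|xi ord0 l - w ord0 l| < lam.
Proof.
move=> lam0; apply: contraTT; rewrite -leNgt => h; apply/negPn/eqP.
rewrite /tent (bigD1 l)//= tri_eq0 ?mul0r//.
by rewrite normrM normfV (gtr0_norm lam0) ler_pdivlMr// mul1r.
Qed.

Lemma enorm_le_sum x : enorm x <= \sum_l `|x ord0 l|.
Proof.
have S0 : 0 <= \sum_l `|x ord0 l| by exact: sumr_ge0.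
rewrite -[leRHS]ger0_norm// -sqrtr_sqr; apply: ler_wsqrtr; rewrite expr2 mulr_suml.
apply: ler_sum => l _; apply: (le_trans (ler_norm _)); rewrite normrM ler_wpM2l//.
by rewrite (bigD1 l)//= lerDl sumr_ge0.
Qed.

Variable i0 : 'I_n.

(** The frequencies of the packets, in the middle of the even dyadic annuli. *)
Definition freq (i : nat) : 'rV[R]_n := (3 / 2 * 4 ^+ i) *: delta_mx ord0 i0.

Lemma freqE i l : freq i ord0 l = 3 / 2 * 4 ^+ i * (l == i0)%:R.
Proof. by rewrite !mxE eqxx. Qed.

(** The spectrum of a packet is a cube of half-side lam around its frequency; as
    n lam is at most 4^i / 4, it stays away from the spheres of radii 4^i and
    2 4^i. *)
Lemma tent_annulus i lam xi : 0 < lam -> lam <= 4 ^+ i / (4 * n%:R) ->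
  tent lam (freq i) xi != 0 -> 2 ^+ (2 * i) < enorm xi < 2 ^+ (2 * i).+1.
Proof.
move=> lam0 lamn t0; have h l := tent_neq0 l lam0 t0.
have n1 : 1 <= n%:R :> R by rewrite ler1n; case: n i0 => // -[].
have F0 : 0 < 4 ^+ i :> R by rewrite exprn_gt0.
have nl : n%:R * lam <= 4 ^+ i / 4.
  rewrite (le_trans (ler_wpM2l _ lamn))//.
  by rewrite [leLHS](_ : _ = 4 ^+ i / 4)//; field; rewrite gt_eqF// (lt_le_trans ltr01).
have ll : lam <= n%:R * lam by rewrite ler_peMl// ltW.
rewrite exprS exprM (_ : 2 ^+ 2 = 4 :> R); last by ring.
apply/andP; split.
  apply: lt_le_trans (normr_coord_le_enorm xi i0).
  have := h i0; rewrite freqE eqxx mulr1 ltr_norml => /andP[h1 _].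
  by apply: lt_le_trans (ler_norm _); lra.
apply: (le_lt_trans (enorm_le_sum xi)).
apply: (@le_lt_trans _ _ (\sum_l (`|freq i ord0 l| + lam))).
  apply: ler_sum => l _; have := ler_normD (xi ord0 l - freq i ord0 l) (freq i ord0 l).
  by rewrite subrK => /le_trans; apply; rewrite addrC lerD2l ltW.
rewrite big_split/= sumr_const card_ord (bigD1 i0)//= big1 => [|l li].
  have fi0 : 0 <= 3 / 2 * 4 ^+ i :> R by rewrite mulr_ge0 ?ltW.
  rewrite freqE eqxx [_ * true%:R]mulr1 (ger0_norm fi0) -[lam *+ n]mulr_natl; move: nl F0; move: (_ * lam) (4 ^+ i) => z F.
  by lra.
by rewrite freqE (negbTE li) mulr0 normr0.
Qed.

End packets.

Lemma measurable_tri (R : realType) : measurable_fun setT (@tri R).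
Proof.
apply: measurable_maxr; first exact: measurable_cst.
apply: measurable_funB; first exact: measurable_cst.
exact: normr_measurable.
Qed.

Section pulses.
Variables (R : realType) (n : nat) (psi : nat -> 'rV[R]_n -> R[i]).
Hypothesis hpsi : dyadic_resolution psi.
Variable i0 : 'I_n.
Local Notation mu := (@lebesgue_rV R n).
Implicit Types (x xi : 'rV[R]_n) (a lam : nat -> R).

(** Superpositions of packets, one in each even dyadic annulus. *)
Definition pulses N a lam x : R[i] :=
  \sum_(i < N) (a i)%:C * packet (lam i) (freq R i0 i) x.

Definition pulse_dist N a lam (phi : 'rV[R]_n -> R[i]) : R[i] :=
  intC mu (fun x => pulses N a lam x * phi x).

(** The widths for which the spectra of the packets stay in their annuli. *)
Definition widths lam := forall i, 0 < lam i /\ lam i <= 4 ^+ i / (4 * n%:R).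

Lemma itgC_pulses N a lam : widths lam -> itgC mu (pulses N a lam).
Proof.
move=> wl; apply: (@itgC_sum _ _ _ _ _ _ (fun (i : 'I_N) x => (a i)%:C * packet (lam i) (freq R i0 i) x)) => i.
by apply: itgCZ; apply: itgC_packet; exact: (wl i).1.
Qed.

Definition amp a lam i : R := a i * (lam i)^-1 ^+ n.

Lemma fourier_pulses N a lam xi : widths lam -> fourier (pulses N a lam) xi =
  \sum_(i < N) (amp a lam i * tent (lam i) (freq R i0 i) xi)%:C.
Proof.
move=> wl; pose f (i : 'I_N) x := (a i)%:C * packet (lam i) (freq R i0 i) x.
have fi i : itgC mu (f i) by apply: itgCZ; apply: itgC_packet; exact: (wl i).1.
pose g (i : 'I_N) x := cis (- (2 * pi) * dotp xi x) * f i x.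
rewrite fourierE.
transitivity (intC mu (fun x => \sum_(i < N) g i x)).
  by congr intC; apply/funext => x; rewrite /pulses mulr_sumr.
rewrite (@intC_sum _ _ _ _ _ _ g) => [|i]; last exact: itgC_cis.
apply: eq_bigr => i _; have lam0 := (wl i).1.
transitivity (intC mu (fun x => (a i)%:C *
    (cis (- (2 * pi) * dotp xi x) * packet (lam i) (freq R i0 i) x))).
  by congr intC; apply/funext => x; rewrite /g /f mulrCA.
rewrite intCZ; last by apply: itgC_cis; exact: itgC_packet.
rewrite -[intC _ _]/(osc _ _ _) -fourierE fourier_packet//.
by rewrite -(rmorphM (real_complex R)) mulrA.
Qed.

Lemma psi_tent_eq0 k i lam xi : widths lam -> i <> k./2 ->
  psi k xi * (tent (lam i) (freq R i0 i) xi)%:C = 0.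
Proof.
move=> wl ik; have [->|t0] := eqVneq (tent (lam i) (freq R i0 i) xi) 0; first by rewrite mulr0.
have [lam0 lam1] := wl i.
have /andP[h1 h2] := tent_annulus lam0 lam1 t0.
have [ki|ik'] := ltnP k (2 * i).
  rewrite (psi_hi hpsi) ?mul0r//; apply: le_lt_trans h1.
  by rewrite ler_weXn2l// ler1n.
have [ki|ki] := leqP k (2 * i).+1.
  by case: ik; apply/eqP; rewrite eqn_leq geq_half_double leq_half_double -mul2n ik' ki.
rewrite (psi_lo hpsi) ?mul0r//; first by case: k ki {ik' ik}.
apply: (lt_le_trans h2); rewrite ler_weXn2l ?ler1n//.
by case: k ki {ik ik'}.
Qed.

Lemma psi_fourier_pulses N a lam k xi : widths lam ->
  psi k xi * fourier (pulses N a lam) xi =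
  if (k./2 < N)%N then
    psi k xi * (amp a lam k./2 * tent (lam k./2) (freq R i0 k./2) xi)%:C
  else 0.
Proof.
move=> wl; rewrite fourier_pulses// mulr_sumr.
have H i : i <> k./2 -> psi k xi * (amp a lam i * tent (lam i) (freq R i0 i) xi)%:C = 0.
  by move=> ik; rewrite (rmorphM (real_complex R)) mulrCA psi_tent_eq0// mulr0.
case: ifPn => kN; last first.
  rewrite big1// => i _; apply: H => ik; move: kN; rewrite -ik.
  by rewrite ltn_ord.
rewrite (bigD1 (Ordinal kN))//= big1 ?addr0// => i ik; apply: H => h.
by move/eqP: ik; apply; exact/val_inj.
Qed.

(** The multiplier of a block is psi_k times a product of tents, whose
    differences are controlled by those of each factor. *)
Lemma pulse_decay : exists C : R, 0 < C /\ forall (k : nat) (w : 'rV[R]_n) (lam : R), 0 < lam ->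
  lam <= 2 ^+ k -> let m xi := psi k xi * (tent lam w xi)%:C in
  itgC mu m /\ forall x,
    normc (fourier_inv m x) <= C * lam ^+ n * \prod_l wt 1 (lam * x ord0 l).
Proof.
have [M [M0 hM]] := psi_bounds hpsi n.
pose kappa : R := 2 * 2 ^+ n.
pose C := 2 * (2 * M + 1) * (n.+2%:R * kappa) ^+ n.
have kappa1 : 1 <= kappa by rewrite /kappa -exprS exprn_ege1// ler1n.
have A0 : 0 <= 2 * M + 1 by lra.
have C0 : 0 < C.
  rewrite /C mulr_gt0//; first by lra.
  by rewrite exprn_gt0// mulr_gt0// (lt_le_trans ltr01).
exists C; split => // k w lam lam0 lamk m.
have mm : mfunC m.
  apply: mfunCM; first exact: schwartz_mfunC (psi_schwartz hpsi k).
  apply: mfunC_real; apply: measurable_prod => l _.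
  apply: (measurableT_comp (@measurable_tri R)).
  apply: measurable_funM; last exact: measurable_cst.
  by apply: measurable_funB; [exact: measurable_coord|exact: measurable_cst].
have m0 xi i : lam < `|xi ord0 i - w ord0 i| -> m xi = 0.
  move=> h; rewrite /m (_ : tent _ _ _ = 0) ?mulr0//.
  apply/eqP; apply: contraTT h => t0; rewrite -leNgt ltW//.
  exact: tent_neq0.
have mb l : uniq (map fst l) ->
    fdiffs_bounded l (fun p => kappa * (`|p.2| / lam)) (2 * M + 1) m.
  move=> ul; have sl : (size l <= n)%N.
    by rewrite -(size_map fst) -(card_uniqP ul) -[X in (_ <= X)%N](card_ord n) max_card.
  have tp (p : 'I_n * R) : 0 <= `|p.2| / lam by rewrite divr_ge0// ltW.
  have b1 : fdiffs_bounded l (fun p => 2 ^+ n * (`|p.2| / lam)) (2 * M) (psi k).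
    apply: (@fdiffs_boundedS _ _ l (fun p => `|p.2| / lam) _ (2 * M)).
    - by move=> p; rewrite tp/= ler_peMl// exprn_ege1// ler1n.
    - by rewrite mulr_ge0/=.
    apply: fdiffs_bounded_smooth => //; first exact: (psi_schwartz hpsi k).1.
    move=> a sa xi; apply: le_trans (hM a (leq_trans sa sl) k xi).
    rewrite ler_wpM2r ?normc_ge0// exprM.
    by rewrite lerXn2r// ?nnegrE ?exprn_ge0 ?ltW.
  have b2 : fdiffs_bounded l (fun p => 2 ^+ n * (`|p.2| / lam)) 1
      (fun xi => (tent lam w xi)%:C).
    have := @fdiffs_bounded_prod _ _ _ (index_enum 'I_n) l (fun p => `|p.2| / lam)
      (fun i xi => (tri ((xi ord0 i - w ord0 i) / lam))%:C) tp
      (fun i => fdiffs_bounded_tri w i lam0 ul).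
    have -> : size (index_enum 'I_n) = n by rewrite [index_enum _]unlock -enumT size_enum_ord.
    rewrite (_ : (fun xi => \prod_(i <- _) _) = fun xi => (tent lam w xi)%:C)//.
    by apply/funext => xi; rewrite /tent (rmorph_prod (real_complex R)).
  apply: (@fdiffs_boundedS _ _ l (fun p => 2 * (2 ^+ n * (`|p.2| / lam))) _ (2 * M * 1)).
  - by move=> p; rewrite /kappa -[2 * 2 ^+ n * _]mulrA lexx andbT mulr_ge0// mulr_ge0// exprn_ge0.
  - by rewrite mulr1 mulr_ge0//= lerDl.
  by apply: fdiffs_boundedM => //; [move=> p; rewrite mulr_ge0|rewrite mulr_ge0].
have [mi h] := fourier_inv_decay lam0 A0 kappa1 mm m0 mb; split => // x.
apply: (le_trans (h x)); rewrite /C -mulrA -[lam * _ * _]mulrA exprMn.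
by rewrite (_ : 2 * _ * _ = 2 * (2 * M + 1) * (n.+2%:R * kappa) ^+ n * lam ^+ n *
  \prod_i wt 1 (lam * x ord0 i)) //; ring.
Qed.

End pulses.

(** * Lorentz norms of the blocks: upper bound *)

Section pulse_norms.
Variables (R : realType) (n : nat) (psi : nat -> 'rV[R]_n -> R[i]).
Hypothesis hpsi : dyadic_resolution psi.
Variable i0 : 'I_n.
Local Notation mu := (@lebesgue_rV R n).
Implicit Types (x xi : 'rV[R]_n).

Lemma wt_prod_powR (r : R) (I : Type) (s : seq I) (t : I -> R) :
  (\prod_(l <- s) wt 1 (t l)) `^ r = \prod_(l <- s) wt r (t l).
Proof.
elim: s => [|l s IH]; first by rewrite !big_nil powR1.
rewrite !big_cons powRM ?wt_ge0 ?prodr_ge0// => [|j _]; last exact: wt_ge0.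
by rewrite IH /wt -powRrM mulN1r.
Qed.

Lemma freq_dims : 1 <= (n%:R : R).
Proof. by rewrite ler1n; case: n i0 => // -[]. Qed.

Lemma width_le lam i : @widths R n lam -> lam i <= 2 ^+ (2 * i) / 4.
Proof.
move=> /(_ i)[_ h]; apply: (le_trans h); have n1 := freq_dims.
rewrite exprM (_ : 2 ^+ 2 = 4 :> R); last by ring.
have n0 : 0 < 4 * n%:R :> R by rewrite mulr_gt0// (lt_le_trans ltr01).
apply: ler_wpM2l; first exact: exprn_ge0.
by rewrite lef_pV2 ?posrE// ler_peMr.
Qed.

(** A block involves a single packet, and its kernel is bounded by a dilated
    product of weights, whose r-th powers are integrable for r > 1. *)
Lemma pulse_dnorm_le (p : R) (q : \bar R) : 1 < p -> (1 <= q)%E ->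
  exists C : R, 0 < C /\ forall N a lam, @widths R n lam -> (forall i, 0 < a i) ->
  forall k, (lorentz_dnorm p q (lp_block psi k (pulse_dist i0 N a lam)) <=
    (if (k./2 < N)%N then C * (a k./2 * (lam k./2 `^ (- (n%:R / p)))) else 0)%:E)%E.
Proof.
move=> p1 q1; have p0 : 0 < p by lra.
pose r := (1 + p) / 2; have r0 : 0 < r by rewrite /r; lra.
have r1 : 1 < r by rewrite /r; lra.
have rp : r < p by rewrite /r; lra.
have [C1 [C10 h1]] := @lorentz_norm_le R n p r q r0 rp p0 q1.
have [C2 [C20 h2]] := pulse_decay hpsi.
pose W : R := wt_mass r ^+ n.
have W0 : 0 <= W by rewrite exprn_ge0// wt_mass_ge0.
pose C := C1 * (C2 * W `^ p^-1) + 1.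
exists C; split.
  by rewrite /C ltr_wpDl// !mulr_ge0 ?powR_ge0// ltW.
move=> N a lam wl a0 k; have Fi := itgC_pulses i0 N a wl.
have rep := represents_lp_block hpsi k Fi; set g := fourier_inv _ in rep.
apply: (@le_trans _ _ (lorentz_norm p q g)).
  by apply: ereal_inf_lbound; exists g.
have mg : mfunC g by case: rep.
have gE : g = fourier_inv (fun xi => if (k./2 < N)%N then
    psi k xi * (@amp R n a lam k./2 * tent (lam k./2) (freq R i0 k./2) xi)%:C else 0).
  by congr fourier_inv; apply/funext => xi; exact: psi_fourier_pulses.
move: gE; case: ifPn => kN gE; last first.
  have g0 x : g x = 0.
    rewrite gE /fourier_inv; under [X in integralC X]eq_fun do rewrite mulr0.
    exact: (intC0 mu).
  (* A block away from all the packets is 0: take K = 1 and L = 0. *)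
  apply: (le_trans (h1 g 1 0 ltr01 (lexx _) _ _)).
  - by move=> x; rewrite g0 ComplexField.Normc.normc0.
  - move=> b b0; rewrite mulr0 (_ : distribution_function _ _ = 0%E)//.
    rewrite /distribution_function (_ : [set _ | _] = set0) ?measure0//.
    rewrite -subset0 => x; rewrite /mkset g0.
    by rewrite ComplexField.Normc.normc0 => /(lt_trans b0); rewrite ltxx.
  by rewrite powR0 ?mulr0// invr_neq0// gt_eqF.
set i := k./2 in gE kN *.
have [lam0 _] := wl i.
have lamk : lam i <= 2 ^+ k.
  apply: (le_trans (width_le i wl)); apply: (@le_trans _ _ (2 ^+ (2 * i))).
    by rewrite ler_pdivrMr// ler_peMr ?exprn_ge0// ler1n.
  by rewrite ler_weXn2l ?ler1n// mul2n -geq_half_double.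
pose K := C2 * a i; have K0 : 0 < K by rewrite mulr_gt0.
have [mi h3] := h2 k (freq R i0 i) (lam i) lam0 lamk.
have gx x : normc (g x) <= K * \prod_l wt 1 (lam i * x ord0 l).
  have -> : g x = (@amp R n a lam i)%:C *
      fourier_inv (fun xi => psi k xi * (tent (lam i) (freq R i0 i) xi)%:C) x.
    rewrite gE; set m := fun xi => psi k xi * (tent _ _ _)%:C.
    rewrite /fourier_inv -[RHS]intCZ; last exact: itgC_cis.
    congr (intC mu _); apply/funext => xi.
    by rewrite /m (rmorphM (real_complex R)); ring.
  rewrite normcM normc_real ger0_norm; last by rewrite mulr_ge0 ?exprn_ge0 ?invr_ge0 ?ltW.
  have al : 0 <= @amp R n a lam i by rewrite mulr_ge0 ?exprn_ge0 ?invr_ge0 ?ltW.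
  apply: (le_trans (ler_wpM2l al (h3 x))).
  rewrite le_eqVlt; apply/orP; left; apply/eqP; rewrite /amp /K exprVn.
  by field; rewrite expf_neq0// gt_eqF.
pose L := (lam i)^-1 ^+ n * W.
have L0 : 0 <= L by rewrite mulr_ge0// exprn_ge0// invr_ge0 ltW.
apply: (le_trans (h1 g K L K0 L0 _ _)).
- move=> x; apply: (le_trans (gx x)); rewrite ler_piMr ?(ltW K0)//.
  by apply: prodr_ile1 => l _; rewrite wt_ge0 wt_le1.
- move=> b b0; rewrite /distribution_function.
  set A := [set _ | _]; have mA : measurable A by exact: measurable_level.
  have -> : lebesgue_rV A = (\int[mu]_x (\1_A x)%:E)%E by rewrite integral_indic// setIT.
  apply: (@le_trans _ _ (\int[mu]_x (((K / b) `^ r)%:E * (\prod_l wt r (lam i * x ord0 l))%:E))%E).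
    apply: ge0_le_integral_any => x _; first by rewrite lee_fin.
    rewrite -EFinM lee_fin indicE; case: (boolP (x \in _)) => [|_]; last first.
      by rewrite mulr_ge0 ?powR_ge0// prodr_ge0// => l _; exact: wt_ge0.
    rewrite inE /= => bx; rewrite -wt_prod_powR -powRM; last 2 first.
    - by rewrite divr_ge0// ltW.
    - by rewrite prodr_ge0// => l _; exact: wt_ge0.
    rewrite (_ : 1%:R = 1 `^ r); [|by rewrite powR1]; apply: ge0_ler_powR; rewrite ?nnegrE ?(ltW r0)//.
      by rewrite mulr_ge0 ?divr_ge0 ?(ltW K0) ?(ltW b0)// prodr_ge0// => l _; exact: wt_ge0.
    rewrite mulrAC ler_pdivlMr// mul1r; exact: ltW (lt_le_trans bx (gx x)).
  rewrite ge0_integralZl//; last 3 first.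
  - apply/measurable_EFinP/measurable_prod => l _; apply: (measurableT_comp (measurable_wt r)).
    by apply: measurable_funM; [exact: measurable_cst|exact: measurable_coord].
  - by move=> x _; rewrite lee_fin prodr_ge0// => l _; exact: wt_ge0.
  - by rewrite lee_fin powR_ge0.
  by rewrite integral_wt_prod// -EFinM lee_fin exprMn.
rewrite lee_fin /C mulrDl mul1r.
have E : K * L `^ p^-1 = C2 * W `^ p^-1 * (a i * lam i `^ (- (n%:R / p))).
  rewrite /L powRM ?exprn_ge0 ?invr_ge0 ?(ltW lam0) ?wt_mass_ge0//.
  rewrite -powR_mulrn ?invr_ge0 ?(ltW lam0)// -powR_inv1 ?(ltW lam0)//.
  rewrite -!powRrM (_ : -1 * (n%:R * p^-1) = - (n%:R / p)); last by ring.
  by rewrite /K; ring.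
by rewrite E [C1 * _]mulrA lerDl mulr_ge0 ?powR_ge0// ltW.
Qed.

End pulse_norms.

(** * Lorentz norms of the blocks: lower bound *)

Section probes.
Variables (R : realType) (n : nat) (psi : nat -> 'rV[R]_n -> R[i]).
Hypothesis hpsi : dyadic_resolution psi.
Variable i0 : 'I_n.
Local Notation mu := (@lebesgue_rV R n).
Implicit Types (x xi w : 'rV[R]_n).

Lemma Rintegral_cube_ge (h : 'rV[R]_n -> R) w (rho b : R) : 0 <= rho -> 0 <= b ->
  mu.-integrable setT (EFin \o h) -> (forall x, 0 <= h x) ->
  (forall x, cube w rho x -> b <= h x) ->
  b * (2 * rho) ^+ n <= \int[mu]_x h x.
Proof.
move=> rho0 b0 ih h0 hb; rewrite -lee_fin /Rintegral fineK; last first.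
  exact: integrable_fin_num ih.
apply: (@le_trans _ _ (\int[mu]_x (b%:E * (\1_(cube w rho) x)%:E))%E).
  have mc := measurable_cube w rho.
  rewrite ge0_integralZl//; last first.
    by apply/measurable_EFinP; exact: measurable_indic.
  by rewrite integral_indic// setIT /= lebesgue_rV_cube// EFinM.
apply: ge0_le_integral_any => x _; first by rewrite -EFinM lee_fin mulr_ge0.
rewrite -EFinM lee_fin indicE; case: (boolP (x \in _)) => [|_]; last by rewrite mulr0.
by rewrite inE mulr1 => /hb.
Qed.

Lemma cos_ge_half (y : R) : `|y| <= 1 -> 2^-1 <= cos y.
Proof.
move=> y1; have E : cos y = 1 - 2 * sin (y / 2) ^+ 2.
  by rewrite {1}(_ : y = y / 2 *+ 2) ?cos_mulr2n ?cos2sin2; [ring|rewrite -mulr_natl; field].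
have := normr_sin_le (y / 2); rewrite normrM (ger0_norm (_ : 0 <= 2^-1))// => s1.
have : `|sin (y / 2)| ^+ 2 <= 2^-1 ^+ 2.
  by rewrite lerXn2r ?nnegrE// (le_trans s1)// ler_piMl.
by rewrite real_normK ?num_real// E => h; move: (sin _ ^+ 2) h => s; lra.
Qed.

(** The square of |psi_0|, dilated: psi_0 itself may take complex values. *)
Definition bump (c : R) x : R :=
  complex.Re (psi 0 (c *: x)) ^+ 2 + complex.Im (psi 0 (c *: x)) ^+ 2.

Lemma bump_ge0 c x : 0 <= bump c x.
Proof. by rewrite addr_ge0// sqr_ge0. Qed.

Lemma bump_eq0 c x : 0 < c -> ~ cube 0 (2 / c) x -> bump c x = 0.
Proof.
move=> c0 xc; rewrite /bump (psi_hi hpsi) /= ?expr0n/= ?addr0//.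
rewrite expr1 ltNge; apply/negP => h; apply: xc => l; rewrite mxE subr0.
rewrite ler_pdivlMr// mulrC -[X in X * _]gtr0_norm// -normrM.
by apply: le_trans h; have := normr_coord_le_enorm (c *: x) l; rewrite mxE.
Qed.

(** psi_0 = 1 on the unit ball, which contains the cube of half-side 1 / (2 n). *)
Lemma bump_eq1 c x : 0 < c -> cube 0 ((2 * (n%:R * c))^-1) x -> bump c x = 1.
Proof.
move=> c0 xc; have n1 := freq_dims R i0.
rewrite /bump (psi0_eq1 hpsi) /= ?expr0n/= ?addr0 ?expr1n//.
apply: (le_lt_trans (enorm_le_sum _)).
apply: (@le_lt_trans _ _ (\sum_(l < n) (2 * n%:R)^-1)).
  apply: ler_sum => l _; rewrite mxE normrM (gtr0_norm c0).
  have := xc l; rewrite mxE subr0 => h; apply: (le_trans (ler_wpM2l (ltW c0) h)).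
  rewrite le_eqVlt; apply/orP; left; apply/eqP.
  by field; rewrite ?(gt_eqF c0) ?gt_eqF// (lt_le_trans ltr01).
rewrite sumr_const card_ord -[_^-1 *+ n]mulr_natl.
have -> : n%:R * (2 * n%:R)^-1 = 2^-1 :> R.
  by field; rewrite gt_eqF// (lt_le_trans ltr01).
by lra.
Qed.

Lemma bump_bounded : exists M : R, 0 < M /\ forall c x, bump c x <= M.
Proof.
have [M hM] := schwartz_bounded (psi_schwartz hpsi 0).
have M0 : 0 <= M by rewrite (le_trans (normc_ge0 _) (hM 0)).
exists (2 * M ^+ 2 + 1); split; first by rewrite ltr_wpDl// mulr_ge0// sqr_ge0.
move=> c x; have h1 := le_trans (normr_Re_le _) (hM (c *: x)).
have h2 := le_trans (normr_Im_le _) (hM (c *: x)).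
rewrite /bump -(real_normK (num_real (complex.Re _))) -(real_normK (num_real (complex.Im _))).
have l1 : `|complex.Re (psi 0 (c *: x))| ^+ 2 <= M ^+ 2 by rewrite lerXn2r ?nnegrE.
have l2 : `|complex.Im (psi 0 (c *: x))| ^+ 2 <= M ^+ 2 by rewrite lerXn2r ?nnegrE.
by lra.
Qed.

(** A Schwartz function concentrated in a cube of side 4/c and whose inverse
    Fourier transform is large near the frequency w. *)
Definition probe c w x : R[i] := (bump c x)%:C * cis (dotp (- (2 * pi) *: w) x).

Lemma probe_schwartz c w : 0 < c -> schwartz (probe c w).
Proof.
move=> c0; have [[sr si] _] := psi_schwartz hpsi 0.
have ab : smooth_alg (bump c).
  rewrite (_ : bump c = fun x => reF (psi 0) (c *: x) * reF (psi 0) (c *: x) +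
      imF (psi 0) (c *: x) * imF (psi 0) (c *: x)); last exact/funext.
  by apply: alg_add; apply: alg_mul; exact: alg_dilation.
apply: (@schwartz_compact_support _ _ (2 / c)).
- by rewrite divr_ge0// ltW.
- split; apply: smooth_alg_smooth.
    rewrite (_ : reF _ = fun x => bump c x * cos (dotp (- (2 * pi) *: w) x)).
      by apply: alg_mul => //; exact: alg_cos.
    by apply/funext => x; rewrite /reF cReM/= mul0r subr0.
  rewrite (_ : imF _ = fun x => bump c x * sin (dotp (- (2 * pi) *: w) x)).
    by apply: alg_mul => //; exact: alg_sin.
  by apply/funext => x; rewrite /imF cImM/= mul0r addr0.
- by move=> x xc; rewrite /probe bump_eq0// mul0r.
Qed.

Lemma normc_probe c w x : normc (probe c w x) = bump c x.
Proof. by rewrite /probe normcM normc_cis mulr1 normc_real ger0_norm ?bump_ge0. Qed.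

(** On the support of the bump |x_l| <= 2 / c, so that the phase
    2 pi x.(xi - w) is at most pi / 4 < 1 in absolute value, where the cosine is
    at least 1 / 2. *)
Lemma fourier_inv_probe_ge c w xi : 0 < c ->
  (forall l, `|xi ord0 l - w ord0 l| <= c / (16 * n%:R)) ->
  2^-1 * ((n%:R * c)^-1) ^+ n <= complex.Re (fourier_inv (probe c w) xi).
Proof.
move=> c0 xiw; have n1 := freq_dims R i0.
have n0 : n%:R != 0 :> R by rewrite gt_eqF// (lt_le_trans ltr01).
have pi4 : pi <= 4 :> R by have := pihalf_lt2 R; lra.
pose h x := bump c x * cos (2 * pi * dotp x (xi - w)).
have dE x : 2 * pi * dotp xi x + dotp (- (2 * pi) *: w) x = 2 * pi * dotp x (xi - w).
  rewrite /dotp !mulr_sumr -big_split/=; apply: eq_bigr => l _; rewrite !mxE; ring.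
have hE x : complex.Re (cis (2 * pi * dotp xi x) * probe c w x) = h x.
  by rewrite /probe mulrCA -cisD dE cReM/= mul0r subr0.
have ih : mu.-integrable setT (EFin \o h).
  have [ir _] := itgC_cis (2 * pi) xi (schwartz_itgC (probe_schwartz w c0)).
  by move: ir; under eq_fun do rewrite hE.
have cosx x : cube 0 (2 / c) x -> 2^-1 <= cos (2 * pi * dotp x (xi - w)).
  move=> xc; apply: cos_ge_half; rewrite normrM ger0_norm ?mulr_ge0 ?pi_ge0//.
  have : `|dotp x (xi - w)| <= 8^-1.
    apply: (le_trans (ler_norm_sum _ _ _)).
    apply: (@le_trans _ _ (\sum_(l < n) (8 * n%:R)^-1)).
      apply: ler_sum => l _; rewrite normrM; have := xc l; rewrite !mxE subr0 => h1.
      apply: (le_trans (ler_pM _ _ h1 (xiw l))) => //.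
      rewrite le_eqVlt; apply/orP; left; apply/eqP.
      by field; rewrite n0 gt_eqF.
    rewrite sumr_const card_ord -[_^-1 *+ n]mulr_natl (_ : _ * _ = 8^-1)//.
    by field.
  move: `|dotp _ _| (normr_ge0 (dotp x (xi - w))) => D D0 D8.
  have p4 : 0 <= 4 - pi :> R by rewrite subr_ge0.
  by have := mulr_ge0 D0 p4; rewrite mulrBr; lra.
have -> : complex.Re (fourier_inv (probe c w) xi) = \int[mu]_x h x.
  by rewrite /fourier_inv /=; under eq_Rintegral do rewrite /reF hE.
have -> : (n%:R * c)^-1 = 2 * (2 * (n%:R * c))^-1 by field; rewrite n0 gt_eqF.
apply: (@Rintegral_cube_ge _ 0) => //.
- by rewrite invr_ge0 !mulr_ge0// ltW.
- move=> x; have [xc|xc] := pselect (cube 0 (2 / c) x); last by rewrite /h bump_eq0// mul0r.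
  by rewrite mulr_ge0 ?bump_ge0// (le_trans _ (cosx x xc)).
move=> x xc; rewrite /h bump_eq1// mul1r; apply: cosx => l; apply: (le_trans (xc l)).
rewrite [leRHS](_ : _ = (c / 2)^-1); last by field; rewrite gt_eqF.
have h1 : 0 < c / 2 by rewrite divr_gt0.
have h2 : 0 < 2 * (n%:R * c) by rewrite !mulr_gt0// (lt_le_trans ltr01).
by rewrite lef_pV2 ?posrE//; nra.
Qed.

Lemma tent_ge (lam : R) w xi : 0 < lam -> cube w (lam / 2) xi ->
  2^-1 ^+ n <= tent lam w xi.
Proof.
move=> lam0 xc; have -> : 2^-1 ^+ n = \prod_(l < n) 2^-1 :> R.
  by rewrite prodr_const card_ord.
apply: ler_prod => l _; rewrite invr_ge0 ler0n/=.
have := xc l; rewrite -ler_pdivrMl// mulrC -{1}(gtr0_norm lam0) -normfV -normrM => h.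
by rewrite /tri le_max; apply/orP; right; lra.
Qed.

Lemma half_le_or (z X Y : R) : z <= X + Y -> z / 2 <= X \/ z / 2 <= Y.
Proof. by move=> h; have [?|?] := leP (z / 2) X; [left|right; lra]. Qed.

(** The two blocks meeting the annulus of a packet add up to the packet; paired
    with the probe at its frequency, at least one of them is large. *)
Lemma pulse_pairing_ge : exists b : R, 0 < b /\
  forall N a lam, @widths R n lam -> (forall i, 0 < a i) -> forall i, (i < N)%N ->
  exists k, k./2 = i /\
    b * (a i * (lam i)^-1 ^+ n) <= normc (lp_block psi k (pulse_dist i0 N a lam)
      (probe (16 * n%:R * lam i) (freq R i0 i))).
Proof.
have n1 := freq_dims R i0; have n0 : 0 < n%:R :> R by rewrite (lt_le_trans ltr01).
(* The first factor bounds the tent from below on the cube of half its side. *)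
pose b1 : R := 2^-1 ^+ n * (2^-1 * ((16 * n%:R ^+ 2)^-1) ^+ n).
have b10 : 0 < b1.
  by rewrite /b1 !mulr_gt0// ?exprn_gt0// invr_gt0 mulr_gt0// exprn_gt0.
exists (b1 / 2); split; first by rewrite divr_gt0.
move=> N a lam wl a0 i iN; have [lam0 lam1] := wl i.
set c := 16 * n%:R * lam i; have c0 : 0 < c by rewrite !mulr_gt0.
have cE : c = 16 * n%:R * lam i by []; clearbody c.
set w := freq R i0 i; set eta := probe c w; set T := pulse_dist _ _ _ _.
have seta := probe_schwartz w c0.
have Fi := itgC_pulses i0 N a wl.
pose H xi := amp n a lam i * tent (lam i) w xi.
have amp0 : 0 < amp n a lam i by rewrite mulr_gt0// exprn_gt0// invr_gt0.
pose B : R := 2^-1 * ((n%:R * c)^-1) ^+ n.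
have nc0 : 0 < n%:R * c := mulr_gt0 n0 c0.
have B0 : 0 <= B.
  by apply: mulr_ge0; [rewrite invr_ge0|apply: exprn_ge0; rewrite invr_ge0 ltW].
have cn : c / (16 * n%:R) = lam i by rewrite cE; field; rewrite gt_eqF.
have bE : b1 * (a i * (lam i)^-1 ^+ n) =
    (amp n a lam i * (2^-1 ^+ n * B)) * (2 * (lam i / 2)) ^+ n.
  rewrite /B /b1 /amp cE.
  have -> : 2 * (lam i / 2) = lam i by field.
  have -> : n%:R * (16 * n%:R * lam i) = 16 * n%:R ^+ 2 * lam i by ring.
  rewrite [(16 * n%:R ^+ 2 * lam i)^-1]invfM [(_ * (lam i)^-1) ^+ n]exprMn [(lam i)^-1 ^+ n]exprVn.
  have ln0 : lam i ^+ n != 0 by rewrite expf_neq0// gt_eqF.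
  move: (lam i ^+ n) ln0 ((16 * n%:R ^+ 2)^-1 ^+ n) (2^-1 ^+ n) => z z0 u v.
  by field.
have v0 : 0 <= 2^-1 ^+ n :> R by apply: exprn_ge0; rewrite invr_ge0.
have pos1 : 0 <= amp n a lam i * (2^-1 ^+ n * B).
  exact: (mulr_ge0 (ltW amp0) (mulr_ge0 v0 B0)).
have pos2 : 0 <= lam i / 2 by rewrite divr_ge0// ltW.
have tpos xi : cube w (lam i / 2) xi -> tent (lam i) w xi != 0.
  move=> xc; have := tent_ge lam0 xc.
  by case: eqP => // ->; rewrite leNgt exprn_gt0.
have blockE k : k./2 = i ->
    lp_block psi k T eta = intC mu (fun xi => psi k xi * (H xi)%:C * fourier_inv eta xi) /\
    itgC mu (fun xi => psi k xi * (H xi)%:C * fourier_inv eta xi).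
  move=> ki; have [e1 _ e3 _] := lp_block_fun hpsi k Fi seta.
  have mE : (fun xi => psi k xi * fourier (pulses i0 N a lam) xi) =
      fun xi => psi k xi * (H xi)%:C.
    by apply/funext => xi; rewrite (psi_fourier_pulses hpsi)// ki iN.
  split.
    rewrite e1; congr (intC mu _); apply/funext => xi.
    by rewrite -[_ * fourier _ _](congr1 (@^~ xi) (esym mE)).
  have E : (fun xi => psi k xi * fourier (pulses i0 N a lam) xi * fourier_inv eta xi) =
      fun xi => psi k xi * (H xi)%:C * fourier_inv eta xi.
    by apply/funext => xi; rewrite -[psi k xi * (H xi)%:C](congr1 (@^~ xi) mE).
  by rewrite -E.
have k1 : (2 * i)./2 = i by rewrite mul2n doubleK.
have k2 : (2 * i).+1./2 = i by rewrite mul2n -uphalfE uphalf_double.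
have [[E1 I1] [E2 I2]] := (blockE _ k1, blockE _ k2).
have sumE xi : psi (2 * i) xi * (H xi)%:C * fourier_inv eta xi +
    psi (2 * i).+1 xi * (H xi)%:C * fourier_inv eta xi = (H xi)%:C * fourier_inv eta xi.
  rewrite -!mulrA -mulrDl; have [t0|t0] := eqVneq (tent (lam i) w xi) 0.
    by rewrite /H t0 mulr0 !mul0r mulr0.
  have /andP[h1 h2] := tent_annulus lam0 lam1 t0.
  by rewrite (psi_pair hpsi h1 h2) mul1r.
have IH : itgC mu (fun xi => (H xi)%:C * fourier_inv eta xi).
  by move: (itgCD I1 I2); under eq_fun do rewrite sumE; apply.
have SE : lp_block psi (2 * i) T eta + lp_block psi (2 * i).+1 T eta =
    intC mu (fun xi => (H xi)%:C * fourier_inv eta xi).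
  rewrite E1 E2; apply: (etrans (esym (intCD I1 I2))).
  by congr intC; apply/funext => xi; exact: sumE.
have hE xi : complex.Re ((H xi)%:C * fourier_inv eta xi) = H xi * complex.Re (fourier_inv eta xi).
  by rewrite cReM/= mul0r subr0.
have reB xi : tent (lam i) w xi != 0 -> B <= complex.Re (fourier_inv eta xi).
  move=> t0; apply: (fourier_inv_probe_ge c0) => l; rewrite cn.
  exact/ltW/(tent_neq0 l lam0 t0).
have key : b1 * (a i * (lam i)^-1 ^+ n) <=
    complex.Re (lp_block psi (2 * i) T eta + lp_block psi (2 * i).+1 T eta).
  rewrite SE -[leRHS]/(\int[mu]_xi complex.Re ((H xi)%:C * fourier_inv eta xi)).
  under eq_Rintegral do rewrite hE.
  rewrite bE; apply: (@Rintegral_cube_ge _ w _ _ pos2 pos1).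
  - by move: IH.1; under eq_fun do rewrite hE.
  - move=> xi; have [t0|t0] := eqVneq (tent (lam i) w xi) 0.
      by rewrite /H t0 mulr0 mul0r.
    exact: (mulr_ge0 (mulr_ge0 (ltW amp0) (tent_ge0 _ _ _)) (le_trans B0 (reB xi t0))).
  move=> xi xc; rewrite /H -mulrA; apply: (ler_wpM2l (ltW amp0)).
  by apply: (ler_pM v0 B0 (tent_ge lam0 xc)); exact: reB (tpos _ xc).
have zXY := le_trans key (le_trans (ler_norm _) (le_trans (normr_Re_le _) (normcD _ _))).
clear blockE reB key sumE hE SE E1 E2.
have zE : b1 / 2 * (a i * (lam i)^-1 ^+ n) = b1 * (a i * (lam i)^-1 ^+ n) / 2.
  exact: mulrAC.
case: (half_le_or zXY) => h; [exists (2 * i)%N|exists (2 * i).+1].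
  by split; [exact: k1|rewrite zE; exact: h].
by split; [exact: k2|rewrite zE; exact: h].
Qed.

(** The duality bound applied to the probe, whose support has a side of order
    1 / lam: the powers of lam combine into lam^(-n/p). *)
Lemma pulse_dnorm_ge (p : R) (q : \bar R) : 1 < p -> (1 <= q)%E ->
  exists C : R, 0 < C /\ forall N a lam, @widths R n lam -> (forall i, 0 < a i) ->
  forall i, (i < N)%N -> exists k, k./2 = i /\
    ((C * (a i * lam i `^ (- (n%:R / p))))%:E <=
      lorentz_dnorm p q (lp_block psi k (pulse_dist i0 N a lam)))%E.
Proof.
move=> p1 q1; have [c0 [c00 hc]] := @lorentz_dnorm_ge R n p q p1 q1.
have [b [b0 hb]] := pulse_pairing_ge; have [M [M0 hM]] := bump_bounded.
have n1 := freq_dims R i0; have n0 : 0 < n%:R :> R by rewrite (lt_le_trans ltr01).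
pose d : R := (4^-1 / n%:R) ^+ n.
have d0 : 0 < d by rewrite exprn_gt0// divr_gt0.
exists (c0 * (b / (M * d `^ (1 - p^-1)))); split.
  by rewrite mulr_gt0// divr_gt0// mulr_gt0// powR_gt0.
move=> N a lam wl a0 i iN; have [k [ki hk]] := hb N a lam wl a0 i iN.
exists k; split => //; have [lam0 _] := wl i.
set c := 16 * n%:R * lam i in hk; have cc0 : 0 < c by rewrite !mulr_gt0.
have cE : c = 16 * n%:R * lam i by []; clearbody c.
have lamn : 0 < (lam i)^-1 ^+ n by rewrite exprn_gt0// invr_gt0.
have := hc _ _ 0 (2 / c) M (b * (a i * (lam i)^-1 ^+ n)) (probe_schwartz _ cc0) _ M0 _ _ hk.
rewrite divr_gt0// !mulr_gt0// => /(_ isT isT) H.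
apply: le_trans (H _); last first.
  move=> x; rewrite normc_probe indicE; case: (boolP (x \in _)) => [_|/negP xc].
    by rewrite mulr1 hM.
  by rewrite mulr0 bump_eq0//; move=> h; apply: xc; rewrite inE.
rewrite lee_fin -!mulrA ler_wpM2l ?(ltW c00)// ler_wpM2l ?(ltW b0)//.
have -> : (2 * (2 / c)) ^+ n = d * (lam i)^-1 ^+ n.
  by rewrite /d -exprMn; congr (_ ^+ n); rewrite cE; field; rewrite !gt_eqF.
rewrite powRM ?(ltW d0) ?(ltW lamn)//.
have z0 : M * d `^ (1 - p^-1) != 0 by rewrite gt_eqF// mulr_gt0// powR_gt0.
have y0 : 0 < ((lam i)^-1 ^+ n) `^ (1 - p^-1) by rewrite powR_gt0.
rewrite le_eqVlt; apply/orP; left; apply/eqP.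
have -> : lam i `^ (- (n%:R / p)) = (lam i)^-1 ^+ n / (((lam i)^-1 ^+ n) `^ (1 - p^-1)).
  have XE (X : R) : 0 < X -> X / (X `^ (1 - p^-1)) = X `^ p^-1.
    move=> X0; rewrite -powRN -{1}(powRr1 (ltW X0)) -powRD ?(gt_eqF X0) ?implybT//.
    by congr (_ `^ _); ring.
  rewrite (XE _ lamn).
  rewrite -powR_mulrn ?invr_ge0 ?(ltW lam0)// -[(lam i)^-1]powR_inv1 ?(ltW lam0)// -!powRrM.
  by congr (_ `^ _); field; rewrite gt_eqF// (lt_trans ltr01).
by field; rewrite (gt_eqF y0) (gt_eqF M0) gt_eqF// powR_gt0.
Qed.

End probes.

(** * The inequality tested on superpositions of packets *)

Section besov_norms.
Variables (R : realType) (n : nat) (psi : nat -> 'rV[R]_n -> R[i]).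
Implicit Types (T : ('rV[R]_n -> R[i]) -> R[i]).

Lemma lorentz_dnorm_ge0 (p : R) (q : \bar R) T : 0 <= p -> (0 <= lorentz_dnorm p q T)%E.
Proof.
by move=> p0; apply: le_ereal_inf_tmp => _ [g _ <-]; exact: lorentz_norm_ge0.
Qed.

Lemma besov_term_ge0 (s p : R) q T k : 0 <= p ->
  (0 <= (2 `^ (k%:R * s))%:E * lorentz_dnorm p q (lp_block psi k T))%E.
Proof. by move=> p0; rewrite mule_ge0 ?lee_fin ?powR_ge0 ?lorentz_dnorm_ge0. Qed.

Lemma besov_sup_le (s p : R) q T (B : R) : 0 <= p ->
  (forall k, ((2 `^ (k%:R * s))%:E * lorentz_dnorm p q (lp_block psi k T) <= B%:E)%E) ->
  (besov_lorentz_norm psi s +oo p q T <= B%:E)%E.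
Proof.
move=> p0 h; rewrite /besov_lorentz_norm unlock; case: ifP => _.
  apply/ess_supP; apply: nearW => k /=.
  by rewrite gee0_abs ?besov_term_ge0.
exact: le_trans (besov_term_ge0 s q T 0 p0) (h 0%N).
Qed.

(** Each i owns the blocks 2 i and 2 i + 1: the contributions of distinct packets
    to the l^1 sum do not overlap. *)
Lemma besov_sum_ge (s p : R) q T N (c : nat -> R) : 0 <= p ->
  (forall i, (i < N)%N -> exists k, k./2 = i /\
    ((c i)%:E <= (2 `^ (k%:R * s))%:E * lorentz_dnorm p q (lp_block psi k T))%E) ->
  ((\sum_(i < N) c i)%:E <= besov_lorentz_norm psi s 1%E p q T)%E.
Proof.
move=> p0 h; rewrite /besov_lorentz_norm Lnorm1 ge0_integral_count => [|k]; last exact: abse_ge0.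
pose u k := `|(2 `^ (k%:R * s))%:E * lorentz_dnorm p q (lp_block psi k T)|%E.
have u0 k : (0 <= u k)%E by exact: abse_ge0.
apply: (le_trans _ (@nneseries_lim_ge R u xpredT 0%N (2 * N)%N (fun n _ _ => u0 n))).
elim: N h => [|N IH] h; first by rewrite big_ord0 muln0 big_geq.
rewrite big_ord_recr/= EFinD mulnS addnC addn2.
rewrite !big_nat_recr//= -addeA; apply: leeD; first by apply: IH => i iN; apply: h; exact: ltnW.
have [k [kN ck]] := h N (ltnSn N).
have uk : ((c N)%:E <= u k)%E by rewrite /u gee0_abs ?besov_term_ge0.
have : k = (2 * N)%N \/ k = (2 * N).+1.
  have := odd_double_half k; rewrite kN -mul2n; case: odd => <-; [right|left]; by [].
move=> [kE|kE]; rewrite -kE; apply: (le_trans uk).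
  by rewrite leeDl.
by rewrite leeDr.
Qed.

End besov_norms.

(** * Necessary conditions on the exponents *)

Section necessary_conditions.
Variables (R : realType) (n : nat) (psi : nat -> 'rV[R]_n -> R[i]).
Hypothesis hpsi : dyadic_resolution psi.
Variable i0 : 'I_n.
Variables (s s1 s2 p p1 p2 theta : R) (q1 q2 q : \bar R).
Hypotheses (hp : 1 < p) (hp1 : 1 < p1) (hp2 : 1 < p2).
Hypotheses (hq1 : (1 <= q1)%E) (hq2 : (1 <= q2)%E) (hq : (1 <= q)%E).
Hypotheses (htheta0 : 0 < theta) (htheta1 : theta < 1).
Variable C0 : R.
Hypothesis hC0 : 0 < C0.
Hypothesis hineq : forall f : ('rV[R]_n -> R[i]) -> R[i],
  besov_lorentz psi s1 +oo%E p1 q1 f -> besov_lorentz psi s2 +oo%E p2 q2 f ->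
  (besov_lorentz_norm psi s 1%E p q f <=
     C0%:E * besov_lorentz_norm psi s1 +oo p1 q1 f `^ (1 - theta)
           * besov_lorentz_norm psi s2 +oo p2 q2 f `^ theta)%E.

Lemma weight_le (t : R) k i : k./2 = i -> 2 `^ (k%:R * t) <= 2 `^ `|t| * 2 `^ ((2 * i)%:R * t).
Proof.
move=> <-; rewrite -powRD ?pnatr_eq0 ?implybT//; apply: ler_powR; first by rewrite ler1n.
rewrite -{1}(odd_double_half k) -mul2n natrD mulrDl lerD2r.
by case: odd; rewrite ?mul1r ?ler_norm// mul0r.
Qed.

Lemma weight_ge (t : R) k i : k./2 = i -> 2 `^ (- `|t|) * 2 `^ ((2 * i)%:R * t) <= 2 `^ (k%:R * t).
Proof.
move=> <-; rewrite -powRD ?pnatr_eq0 ?implybT//; apply: ler_powR; first by rewrite ler1n.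
rewrite -{2}(odd_double_half k) -mul2n natrD mulrDl lerD2r.
case: odd; rewrite ?mul1r ?mul0r; last by rewrite oppr_le0.
by have := ler_norm (- t); rewrite normrN; lra.
Qed.

Lemma pulse_besov_le (t r : R) (q' : \bar R) : 1 < r -> (1 <= q')%E ->
  exists C : R, 0 < C /\ forall N a lam X, widths n lam -> (forall i, 0 < a i) -> 0 < X ->
  (forall i, (i < N)%N -> 2 `^ ((2 * i)%:R * t) * (a i * lam i `^ (- (n%:R / r))) <= X) ->
  besov_lorentz psi t +oo%E r q' (pulse_dist i0 N a lam) /\
  (besov_lorentz_norm psi t +oo%E r q' (pulse_dist i0 N a lam) <= (C * X)%:E)%E.
Proof.
move=> r1 q'1; have r0 : 0 <= r by rewrite ltW// (lt_trans ltr01).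
have [C [C00 hC]] := pulse_dnorm_le hpsi i0 r1 q'1.
exists (2 `^ `|t| * C); split; first by rewrite mulr_gt0// powR_gt0.
move=> N a lam X wl a0 X0 hX.
have B : (besov_lorentz_norm psi t +oo%E r q' (pulse_dist i0 N a lam) <=
    (2 `^ `|t| * C * X)%:E)%E.
  apply: besov_sup_le => // k; have h := hC N a lam wl a0 k.
  apply: (@le_trans _ _ ((2 `^ (k%:R * t))%:E *
    (if (k./2 < N)%N then C * (a k./2 * (lam k./2 `^ (- (n%:R / r)))) else 0)%:E)%E).
    by apply: lee_wpmul2l => //; rewrite lee_fin powR_ge0.
  rewrite -EFinM lee_fin; case: ifPn => kN; last first.
    by rewrite mulr0 !mulr_ge0 ?powR_ge0// ltW.
  have wk := @weight_le t k k./2 erefl.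
  have c0 : 0 <= C * (a k./2 * lam k./2 `^ (- (n%:R / r))).
    by rewrite !mulr_ge0 ?powR_ge0// ltW.
  apply: (le_trans (ler_wpM2r c0 wk)).
  rewrite mulrACA; apply: ler_wpM2l; last exact: hX.
  by rewrite mulr_ge0 ?powR_ge0// ltW.
split => //; split; first exact: (tempered_fun (itgC_pulses i0 N a wl)).
by rewrite (le_lt_trans B)// ltry.
Qed.

(** The norms on the right see the largest packet only, and that on the left sees
    the sum of all of them. *)
Lemma pulse_inequality : exists K : R, 0 < K /\
  forall N a lam X1 X2, widths n lam -> (forall i, 0 < a i) -> 0 < X1 -> 0 < X2 ->
  (forall i, (i < N)%N -> 2 `^ ((2 * i)%:R * s1) * (a i * lam i `^ (- (n%:R / p1))) <= X1) ->
  (forall i, (i < N)%N -> 2 `^ ((2 * i)%:R * s2) * (a i * lam i `^ (- (n%:R / p2))) <= X2) ->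
  \sum_(i < N) 2 `^ ((2 * i)%:R * s) * (a i * lam i `^ (- (n%:R / p))) <=
    K * (X1 `^ (1 - theta) * X2 `^ theta).
Proof.
have [C1 [C10 h1]] := pulse_besov_le s1 hp1 hq1.
have [C2 [C20 h2]] := pulse_besov_le s2 hp2 hq2.
have [C [C00 h]] := pulse_dnorm_ge hpsi i0 hp hq.
have p0 : 0 <= p by rewrite ltW// (lt_trans ltr01).
pose b := 2 `^ (- `|s|) * C.
have b0 : 0 < b by rewrite mulr_gt0// powR_gt0.
exists (C0 * (C1 `^ (1 - theta) * C2 `^ theta) / b); split.
  by rewrite divr_gt0// !mulr_gt0// powR_gt0.
move=> N a lam X1 X2 wl a0 X10 X20 hX1 hX2.
have [B1 le1] := h1 N a lam X1 wl a0 X10 hX1.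
have [B2 le2] := h2 N a lam X2 wl a0 X20 hX2.
have := hineq B1 B2; set T := pulse_dist _ _ _ _ in B1 le1 B2 le2 *.
have lower : ((\sum_(i < N) b * (2 `^ ((2 * i)%:R * s) * (a i * lam i `^ (- (n%:R / p)))))%:E <=
    besov_lorentz_norm psi s 1%E p q T)%E.
  apply: (besov_sum_ge (c := fun i => b * (2 `^ ((2 * i)%:R * s) * (a i * lam i `^ (- (n%:R / p)))))) => //.
  move=> i iN; have [k [ki hk]] := h N a lam wl a0 i iN; exists k; split => //.
  have wk := @weight_ge s k i ki.
  apply: (le_trans _ (lee_wpmul2l _ hk)); last by rewrite lee_fin powR_ge0.
  rewrite -EFinM lee_fin /b mulrACA.
  by apply: ler_wpM2r => //; rewrite !mulr_ge0 ?powR_ge0// ltW.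
move=> /(le_trans lower) upper.
have {upper} : \sum_(i < N) b * (2 `^ ((2 * i)%:R * s) * (a i * lam i `^ (- (n%:R / p)))) <=
    C0 * (C1 * X1) `^ (1 - theta) * (C2 * X2) `^ theta.
  have t1 : 0 <= 1 - theta by rewrite subr_ge0 ltW.
  have mono (B : \bar R) (X e : R) : 0 <= e -> (B <= X%:E)%E -> (0 <= B)%E ->
      (B `^ e <= (X `^ e)%:E)%E.
    move=> e0 BX B0; rewrite -poweR_EFin; apply: gt0_ler_poweR => //.
      by rewrite in_itv/= B0 leey.
    by rewrite in_itv/= (le_trans B0 BX) leey.
  rewrite -lee_fin; apply: (le_trans upper); rewrite !EFinM.
  have n1 : (0 <= besov_lorentz_norm psi s1 +oo p1 q1 T)%E by exact: Lnorm_ge0.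
  have n2 : (0 <= besov_lorentz_norm psi s2 +oo p2 q2 T)%E by exact: Lnorm_ge0.
  apply: lee_pmul; rewrite ?mule_ge0 ?poweR_ge0 ?lee_fin ?(ltW hC0)//.
    by apply: lee_wpmul2l; [rewrite lee_fin ltW|exact: mono].
  by apply: mono => //; exact: ltW.
rewrite -mulr_sumr mulrC -ler_pdivlMr// => /le_trans; apply.
rewrite !powRM ?(ltW C10) ?(ltW C20) ?(ltW X10) ?(ltW X20)//.
by rewrite le_eqVlt; apply/orP; left; apply/eqP; ring.
Qed.

(** Packets with amplitudes 2^(2 i m) and widths proportional to 2^(2 i v): on
    the right only the last of the N + 1 packets counts, the exponents being
    non-negative. *)
Lemma geometric_inequality : exists K : R, 0 < K /\
  forall (N : nat) (m v : R), v <= 1 ->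
  0 <= s1 + m - v * (n%:R / p1) -> 0 <= s2 + m - v * (n%:R / p2) ->
  \sum_(i < N.+1) 2 `^ ((2 * i)%:R * (s + m - v * (n%:R / p))) <=
    K * 2 `^ ((2 * N)%:R * ((1 - theta) * (s1 + m - v * (n%:R / p1)) +
      theta * (s2 + m - v * (n%:R / p2)))).
Proof.
have [K [K0 hK]] := pulse_inequality.
have n1 := freq_dims R i0; have n0 : 0 < n%:R :> R by rewrite (lt_le_trans ltr01).
pose c : R := (4 * n%:R)^-1.
have c0 : 0 < c by rewrite invr_gt0 mulr_gt0.
pose d (r : R) := c `^ (- (n%:R / r)).
have d0 r : 0 < d r by exact: powR_gt0.
exists (K * (d p1 `^ (1 - theta) * d p2 `^ theta) / d p); split.
  by rewrite divr_gt0// !mulr_gt0// powR_gt0.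
move=> N m v v1 e1 e2.
pose a (i : nat) : R := 2 `^ ((2 * i)%:R * m).
pose lam (i : nat) : R := c * 2 `^ ((2 * i)%:R * v).
have term t r i : 2 `^ ((2 * i)%:R * t) * (a i * lam i `^ (- (n%:R / r))) =
    d r * 2 `^ ((2 * i)%:R * (t + m - v * (n%:R / r))).
  rewrite /a /lam powRM ?powR_ge0 ?(ltW c0)// -/(d r) mulrA mulrCA; congr (_ * _).
  rewrite -powRrM -!powRD ?pnatr_eq0 ?implybT//.
  by congr (_ `^ _); ring.
have wl : widths n lam.
  move=> i; split; first by rewrite mulr_gt0// powR_gt0.
  rewrite /lam mulrC ler_pM2r// (_ : 4 ^+ i = 2 `^ ((2 * i)%:R * 1)).
    by apply: ler_powR; rewrite ?ler1n// ler_wpM2l.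
  by rewrite mulr1 powR_mulrn// exprM; congr (_ ^+ _); ring.
have last_le (e : R) i : 0 <= e -> (i < N.+1)%N ->
    2 `^ ((2 * i)%:R * e) <= 2 `^ ((2 * N)%:R * e).
  move=> e0 iN; apply: ler_powR; first by rewrite ler1n.
  by rewrite ler_wpM2r// ler_nat leq_mul2l/=.
pose X (t r : R) := d r * 2 `^ ((2 * N)%:R * (t + m - v * (n%:R / r))).
have X0 t r : 0 < X t r by rewrite mulr_gt0// powR_gt0.
have := hK N.+1 a lam (X s1 p1) (X s2 p2) wl (fun i => powR_gt0 _ (ltr0Sn _ _)) (X0 _ _) (X0 _ _).
have h1 i : (i < N.+1)%N -> 2 `^ ((2 * i)%:R * s1) * (a i * lam i `^ (- (n%:R / p1))) <= X s1 p1.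
  by move=> iN; rewrite term ler_pM2l// last_le.
have h2 i : (i < N.+1)%N -> 2 `^ ((2 * i)%:R * s2) * (a i * lam i `^ (- (n%:R / p2))) <= X s2 p2.
  by move=> iN; rewrite term ler_pM2l// last_le.
move=> /(_ h1 h2); under eq_bigr do rewrite term.
rewrite -mulr_sumr mulrC -ler_pdivlMr// => /le_trans; apply.
rewrite /X !powRM ?powR_ge0 ?(ltW (d0 _))// -!powRrM.
set u1 := s1 + m - _; set u2 := s2 + m - _.
have -> : 2 `^ ((2 * N)%:R * ((1 - theta) * u1 + theta * u2)) =
    2 `^ ((2 * N)%:R * u1 * (1 - theta)) * 2 `^ ((2 * N)%:R * u2 * theta).
  by rewrite -powRD ?pnatr_eq0 ?implybT//; congr (_ `^ _); ring.
by rewrite le_eqVlt; apply/orP; left; apply/eqP; ring.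
Qed.

Lemma natmul_unbounded (d K : R) : 0 < d -> ~ (forall N : nat, N%:R * d <= K).
Proof.
move=> d0 h; have := h (Num.bound (`|K| / d)); apply/negP; rewrite -ltNge.
rewrite -ltr_pdivrMr//; apply: le_lt_trans (archi_boundP _).
  by rewrite ler_pM2r ?invr_gt0// ler_norm.
by rewrite divr_ge0// ltW.
Qed.

Local Notation sS := ((1 - theta) * s1 + theta * s2).
Local Notation aS := ((1 - theta) * (n%:R / p1) + theta * (n%:R / p2)).

(** The previous inequality, restricted to the last packet, is of the form
    2^(2 N x) <= K 2^(2 N y) for all N, hence x <= y. *)
Lemma exponent_inequality (v : R) : v <= 1 -> s - v * (n%:R / p) <= sS - v * aS.
Proof.
move=> v1; have [K [K0 hK]] := geometric_inequality.
pose m := `|s1 - v * (n%:R / p1)| + `|s2 - v * (n%:R / p2)|.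
have e1 : 0 <= s1 + m - v * (n%:R / p1).
  have := ler_norm (- (s1 - v * (n%:R / p1))); rewrite normrN /m.
  by have := normr_ge0 (s2 - v * (n%:R / p2)); lra.
have e2 : 0 <= s2 + m - v * (n%:R / p2).
  have := ler_norm (- (s2 - v * (n%:R / p2))); rewrite normrN /m.
  by have := normr_ge0 (s1 - v * (n%:R / p1)); lra.
rewrite leNgt; apply/negP => lt.
set d := s - v * (n%:R / p) - (sS - v * aS).
have d0 : 0 < d by rewrite subr_gt0.
apply: (@natmul_unbounded (2 * d * ln 2) K).
  by rewrite !mulr_gt0// ln_gt0// ltr1n.
move=> N; have := hK N m v v1 e1 e2.
rewrite big_ord_recr/= => h.
have {}h : 2 `^ ((2 * N)%:R * (s + m - v * (n%:R / p))) <=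
    K * 2 `^ ((2 * N)%:R * ((1 - theta) * (s1 + m - v * (n%:R / p1)) +
      theta * (s2 + m - v * (n%:R / p2)))).
  by apply: le_trans h; rewrite lerDr sumr_ge0// => i _; exact: powR_ge0.
move: h; rewrite -ler_pdivrMr ?powR_gt0// -powRN -powRD ?pnatr_eq0 ?implybT//.
rewrite (_ : _ + _ = (2 * N)%:R * d); last by rewrite /d; ring.
apply: le_trans; rewrite /powR pnatr_eq0/= -[leLHS]add0r.
apply: le_trans (expR_ge1Dx _); apply: lerD => //.
by rewrite natrM le_eqVlt; apply/orP; left; apply/eqP; ring.
Qed.

(** If all the exponents vanish, then the left-hand side counts the packets while
    the right-hand side is constant. *)
Lemma exponents_not_zero (m v : R) : v <= 1 ->
  s1 + m - v * (n%:R / p1) = 0 -> s2 + m - v * (n%:R / p2) = 0 ->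
  s + m - v * (n%:R / p) <> 0.
Proof.
move=> v1 e1 e2 e; have [K [K0 hK]] := geometric_inequality.
apply: (@natmul_unbounded 1 K) => // N.
have := hK N m v v1; rewrite e1 e2 e => /(_ (lexx _) (lexx _)).
rewrite !mulr0 addr0 mulr0 powRr0 mulr1; apply: le_trans.
rewrite (eq_bigr (fun=> 1)) => [|i _]; last by rewrite mulr0 powRr0.
by rewrite sumr_const card_ord mulr1 ler_nat.
Qed.

End necessary_conditions.


Lemma q_star_ge1 (R : realType) (theta : R) (q1 q2 q : \bar R) :
  0 < theta -> theta < 1 -> (1 <= q1)%E -> (1 <= q2)%E ->
  (q^-1 = (1 - theta)%:E / q1 + theta%:E / q2)%E -> (1 <= q)%E.
Proof.
move=> t0 t1 h1 h2 hq.
have inv1 (x : \bar R) : (1 <= x)%E -> (0 <= x^-1 <= 1)%E.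
  move=> x1; have x0 : (0 <= x)%E by apply: le_trans x1; rewrite lee_fin.
  by rewrite inve_ge0 x0/= -[leRHS]inve1 lee_pV2// inE.
have /andP[a1 b1] := inv1 _ h1; have /andP[a2 b2] := inv1 _ h2.
have T0 : (0 <= theta%:E)%E by rewrite lee_fin ltW.
have T1 : (0 <= (1 - theta)%:E)%E by rewrite lee_fin subr_ge0 ltW.
have q0 : (0 <= q^-1)%E by rewrite hq adde_ge0// mule_ge0.
have qle : (q^-1 <= 1)%E.
  rewrite hq (_ : 1%E = ((1 - theta)%:E * 1 + theta%:E * 1)%E); last first.
    by rewrite !mule1 -EFinD subrK.
  by apply: leeD; apply: lee_wpmul2l.
by rewrite -[q]inveK -[leLHS]inve1 lee_pV2// inE.
Qed.

Theorem theorem4p6 (R : realType) (n : nat) (hn : (0 < n)%N)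
  (psi : nat -> 'rV[R]_n -> R[i]) (hpsi : dyadic_resolution psi)
  (s s1 s2 p p1 p2 theta : R) (q1 q2 : \bar R)
  (hp : 1 < p) (hp1 : 1 < p1) (hp2 : 1 < p2)
  (hq1 : (1 <= q1)%E) (hq2 : (1 <= q2)%E)
  (htheta0 : 0 < theta) (htheta1 : theta < 1)
  (s_star p_star : R) (q_star : \bar R)
  (hs_star : s_star = (1 - theta) * s1 + theta * s2)
  (hp_star : p_star^-1 = (1 - theta) / p1 + theta / p2)
  (hq_star : (q_star^-1 = (1 - theta)%:E / q1 + theta%:E / q2)%E)
  (hineq : exists C : R, 0 < C /\
    forall f : ('rV[R]_n -> R[i]) -> R[i],
      besov_lorentz psi s1 +oo%E p1 q1 f ->
      besov_lorentz psi s2 +oo%E p2 q2 f ->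
      (besov_lorentz_norm psi s 1%E p q_star f <=
         C%:E * besov_lorentz_norm psi s1 +oo p1 q1 f `^ (1 - theta)
              * besov_lorentz_norm psi s2 +oo p2 q2 f `^ theta)%E) :
  [\/ [/\ s_star = s, p_star = p, s1 <> s2 & s2 - s1 <> n%:R / p2 - n%:R / p1],
      s < s_star /\ p_star = p,
      [/\ s_star - s = n%:R / p_star - n%:R / p,
          0 < n%:R / p_star - n%:R / p &
          s2 - s1 <> n%:R / p2 - n%:R / p1] |
      n%:R / p_star - n%:R / p < s_star - s /\ 0 < n%:R / p_star - n%:R / p].

Proof.
have [C [C0 hC]] := hineq.
have hq : (1 <= q_star)%E := q_star_ge1 htheta0 htheta1 hq1 hq2 hq_star.
pose i0 := Ordinal hn; have n0 : 0 < n%:R :> R by rewrite ltr0n.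
have aS : n%:R / p_star = (1 - theta) * (n%:R / p1) + theta * (n%:R / p2).
  by rewrite hp_star; ring.
have ineq v : v <= 1 -> s - v * (n%:R / p) <= s_star - v * (n%:R / p_star).
  move=> v1; rewrite aS hs_star.
  exact: (exponent_inequality hpsi i0 hp hp1 hp2 hq1 hq2 hq htheta0 htheta1 C0 hC).
have not0 := exponents_not_zero hpsi i0 hp hp1 hp2 hq1 hq2 hq htheta0 htheta1 C0 hC.
set al := n%:R / p in ineq not0 *; set als := n%:R / p_star in aS ineq *.
set al1 := n%:R / p1 in aS not0 *; set al2 := n%:R / p2 in aS not0 *.
have B : als - al <= s_star - s by have := ineq 1 (lexx _); rewrite !mul1r; lra.
(* The limit of v to -oo: packets of unbounded extent. *)
have A : al <= als.
  rewrite leNgt; apply/negP => lt.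
  have d0 : 0 < al - als by rewrite subr_gt0.
  pose z := (`|s_star - s| + 1) / (al - als).
  have z0 : 0 <= z by rewrite divr_ge0// ltW.
  have zd : z * (al - als) = `|s_star - s| + 1 by rewrite divfK// gt_eqF.
  have z1 : - z <= 1 by rewrite (le_trans _ ler01)// oppr_le0.
  have := ineq _ z1; have := ler_norm (s_star - s).
  by move: zd; rewrite mulrBr !mulNr; lra.
(* If s_j - n/p_j = s - n/p for j = 1, 2, then packets of widths proportional
   to 4^i can be scaled so as to have comparable norms in the three spaces. *)
have critical : s - al = s_star - als -> s2 - s1 <> al2 - al1.
  move=> e1 e2; apply: (not0 (al1 - s1) 1 (lexx _)); rewrite ?mul1r.
  - by lra.
  - by lra.
  have : (1 - theta) * (s1 - al1) + theta * (s2 - al2) = s1 - al1.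
    by rewrite (_ : s2 - al2 = s1 - al1); [ring|lra].
  by move: e1; rewrite hs_star aS; lra.
move: A; rewrite le_eqVlt => /predU1P[A|A].
  have pE : p_star = p.
    apply: invr_inj; apply: (@mulfI _ n%:R); first by rewrite gt_eqF.
    exact: esym A.
  have : s <= s_star by lra.
  rewrite le_eqVlt => /predU1P[sE|ss]; last by apply: Or42.
  apply: Or41; split=> //; last by apply: critical; lra.
  (* Packets of the same width, scaled by 4^(- i s). *)
  move=> s12; apply: (not0 (- s1) 0 ler01); rewrite mul0r subr0.
  - by lra.
  - by lra.
  by rewrite sE hs_star -s12; ring.
move: B; rewrite le_eqVlt => /predU1P[B|B]; last by apply: Or44; split => //; lra.
by apply: Or43; split; [lra|lra|apply: critical; lra].
Qed.
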